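(* Let $u_0\in L^1(\mathbb{R}^N)$ be nonnegative and nontrivial, let $u$ be the corresponding mild solution and $M=\int_{\mathbb{R}^N}u_0$. If $p$ is subcritical, then $$t^{\frac{\alpha N}{2}(1-\frac1p)}\big\|u(\cdot,t)-M Z(\cdot,t)\big\|_{L^p(\mathbb{R}^N)}\to0\quad\text{as }t\to\infty.$$
   Context: Fix $N\ge1$ and $\alpha\in(0,1)$. Let $\mathbb{E}_\alpha(s)=\sum_{k\ge0}s^k/\Gamma(1+k\alpha)$ be the Mittag-Leffler function. The fundamental solution of the time-fractional heat equation $\partial_t^\alpha u=\Delta u$ (where $\partial_t^\alpha$ is the Caputo derivative $\partial_t^\alpha u(x,t)=\frac{1}{\Gamma(1-\alpha)}\partial_t\int_0^t\frac{u(x,\tau)-u(x,0)}{(t-\tau)^\alpha}\,d\tau$) is the function $Z$ on $\mathbb{R}^N\times(0,\infty)$ whose Fourier transform in $x$ is $\widehat Z(\omega,t)=\mathbb{E}_\alpha(-|\omega|^2t^\alpha)$. It has the self-similar form $Z(x,t)=t^{-\alpha N/2}F(xt^{-\alpha/2})$ with a positive radially symmetric profile $F$, smooth on $\mathbb{R}^N\setminus\{0\}$, $\int F=1$. For nonnegative nontrivial $u_0\in L^1(\mathbb{R}^N)$ the (mild) solution of $\partial_t^\alpha u=\Delta u$ in $\mathbb{R}^N\times(0,\infty)$, $u(\cdot,0)=u_0$, is $u(x,t)=\int_{\mathbb{R}^N}Z(x-y,t)u_0(y)\,dy$. The exponent $p$ is called subcritical if $p\in[1,\infty]$ when $N=1$,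 or $p\in[1,p_c)$ when $N\ge2$, where $p_c=N/(N-2)$ if $N\ge3$ and $p_c=\infty$ if $N=2$. *)

(* Defs.v *)
From HB Require Import structures.
From mathcomp Require Import all_boot all_order all_algebra.
From mathcomp Require Import all_classical all_reals all_analysis.
Set Implicit Arguments. Unset Strict Implicit. Unset Printing Implicit Defensive.
Import Order.TTheory GRing.Theory Num.Theory.
Import numFieldNormedType.Exports.
Local Open Scope classical_set_scope.
Local Open Scope ring_scope.

(** Points of R^N are N-tuples of reals (with the product/Borel sigma-algebra
    generated by the coordinates, already provided by the library). *)

Section Defs.
Variable R : realType.

(** Iterated Lebesgue integral over R^n of an extended-real function
    (used only on nonnegative measurable functions, where by Tonelli it is
    the Lebesgue integral over R^n). *)
Fixpoint iint (n : nat) : (n.-tuple R -> \bar R) -> \bar R :=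
  match n return (n.-tuple R -> \bar R) -> \bar R with
  | 0 => fun f => f [tuple]
  | n'.+1 => fun f =>
      (\int[@lebesgue_measure R]_(x in [set: R])
          iint (fun t : n'.-tuple R => f (cons_tuple x t)))%E
  end.

Definition sint (n : nat) (f : n.-tuple R -> R) : \bar R :=
  (iint (fun x => (Num.max (f x) 0)%:E) - iint (fun x => (Num.max (- f x) 0)%:E))%E.

Definition integrable_RN (n : nat) (f : n.-tuple R -> R) : Prop :=
  measurable_fun [set: n.-tuple R] f /\ (iint (fun x => (`|f x|)%:E) < +oo)%E.

Definition ae_zero (n : nat) (f : n.-tuple R -> R) : Prop :=
  iint (fun x => if f x != 0 then 1%E else 0%E) = 0%E.

Definition vsub (n : nat) (x y : n.-tuple R) : n.-tuple R :=
  [tuple tnth x i - tnth y i | i < n].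
Definition vdot (n : nat) (x y : n.-tuple R) : R := \sum_(i < n) tnth x i * tnth y i.
Definition vnorm2 (n : nat) (x : n.-tuple R) : R := \sum_(i < n) tnth x i ^+ 2.

Definition esssupN (n : nat) (f : n.-tuple R -> R) : \bar R :=
  ereal_inf [set M : \bar R |
    iint (fun x => if (M < (`|f x|)%:E)%E then 1%E else 0%E) = 0%E].

Definition LpnormN (n : nat) (p : \bar R) (f : n.-tuple R -> R) : \bar R :=
  match p with
  | r%:E => poweR (iint (fun x => (`|f x| `^ r)%:E)) r^-1
  | +oo%E => esssupN f
  | -oo%E => 0%E
  end.

Definition one_minus_inv (p : \bar R) : R :=
  match p with
  | r%:E => 1 - r^-1
  | +oo%E => 1
  | -oo%E => 1
  end.

Definition subcritical (N : nat) (p : \bar R) : Prop :=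
  (1%:E <= p)%E /\
  [\/ N = 1%N,
      (N = 2%N /\ (p < +oo)%E) |
      ((3 <= N)%N /\ (p < (N%:R / (N%:R - 2))%:E)%E)].

Definition Gamma (s : R) : R :=
  fine (\int[@lebesgue_measure R]_(x in `]0%R, +oo[%classic)
          ((x `^ (s - 1)) * expR (- x))%:E)%E.

Definition mittag_leffler (a s : R) : R :=
  limn (fun n => \sum_(k < n) s ^+ k / Gamma (1 + k%:R * a)).

(** Z is the fundamental solution: for each t > 0, Z(.,t) is integrable and its
    Fourier transform  w |-> \int Z(x,t) e^{-i w.x} dx  equals E_a(-|w|^2 t^a). *)
Definition is_fundamental_solution (N : nat) (a : R)
    (Z : N.-tuple R -> R -> R) : Prop :=
  forall t : R, 0 < t ->
    integrable_RN (fun x => Z x t) /\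
    forall w : N.-tuple R,
      sint (fun x => Z x t * cos (vdot w x)) = (mittag_leffler a (- vnorm2 w * t `^ a))%:E /\
      sint (fun x => Z x t * sin (vdot w x)) = 0%E.

Definition mild_solution (N : nat) (Z : N.-tuple R -> R -> R) (u0 : N.-tuple R -> R)
    (x : N.-tuple R) (t : R) : R :=
  fine (sint (fun y => Z (vsub x y) t * u0 y)).

End Defs.

(* Main.v *)
(** The number K_n of tables of the Chinese restaurant process with parameter a
    satisfies E exp(- l K_n / n^a) --> E_a(- l). By Fourier inversion, a Gaussian
    mollification of Z(_, t) at scale e is therefore the pointwise limit of the
    mixtures of the heat kernels G_s at the times s = e + K_n t^a / n^a.
    For such a mixture, |G_s(x - y) - G_s(x)| is at most
    C (|y|^2 / s)^d (G_(2s)(x) + G_(2s)(x - y)) for 0 <= d <= 1/2, the L^p norm of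
    G_s is at most s^(- th) with th = N/2 (1 - 1/p), and
    E K_n^(- r) <= n^(- a r) / (1 - r) for 0 <= r < 1. Subcriticality of p is exactly
    th < 1, so there is room for some d > 0 with th + d < 1, and Minkowski's
    inequality gives a bound of t^(a th) |u - M Z|_p that tends to 0. Fatou's lemma,
    first in n and then along a sequence of scales e --> 0 for which the
    mollifications converge almost everywhere, transfers it to u - M Z. *)
Require Import Defs.
From HB Require Import structures.
From mathcomp Require Import all_boot all_order all_algebra.
From mathcomp Require Import all_classical all_reals all_analysis.
From mathcomp Require Import measurable_realfun ring lra.
Set Implicit Arguments. Unset Strict Implicit. Unset Printing Implicit Defensive.
Import Order.TTheory GRing.Theory Num.Theory.
Import numFieldNormedType.Exports.
Local Open Scope classical_set_scope.
Local Open Scope ring_scope.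

(** * Table counts of the Chinese restaurant process and their rising factorial moments *)

Section RestaurantWeights.
Variable R : realType.
Implicit Types (a s x y : R).

(** [Z] is given only through its Fourier transform: positivity, self-similarity and decay of its
    profile are not among the hypotheses, and E_a(-|w|^2 t^a) decays only like |w|^(-2), too slowly
    for a direct inversion when N >= 2. The Gaussian factor of the mollification makes every Fourier
    integral absolutely convergent, and finite sums of heat kernels replace the continuous
    subordination formula, so that the weights are visibly nonnegative and no density of a limit law
    appears. The restaurant process is suitable because one identity, the eigenfunction property of
    rising factorials, yields both ingredients in closed form: at integer exponents it produces the
    coefficients of the Mittag-Leffler series, at negative exponents the negative moments. The
    bounds are uniform in n and e, as the passage to the limit requires. The difference u - M Z
    enters as the average of the increments Z(x - y) - Z(x) against u0(y), so that all smallness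
    comes from these increments. *)

Definition rprod s n : R := \prod_(i < n) (1 + s / i.+1%:R).

Lemma rprodS s n : rprod s n.+1 = rprod s n * (1 + s / n.+1%:R).
Proof. by rewrite /rprod big_ord_recr. Qed.

Lemma rprod0 s : rprod s 0 = 1.
Proof. by rewrite /rprod big_ord0. Qed.

(* [crp a n j] is the probability that n.+1 customers of the (a, 0) Chinese
   restaurant process occupy j.+1 tables. *)
Fixpoint crp a n j : R :=
  if n is n'.+1 then crp a n' j * (1 - a * j.+1%:R / n%:R) +
                     crp a n' j.-1 * (a * j%:R / n%:R)
  else (j == 0)%:R.

Lemma crp_out a n j : (n < j)%N -> crp a n j = 0.
Proof.
elim: n j => [|n IH] [|j]//= nj.
by rewrite IH 1?ltnW// IH// !mul0r addr0.
Qed.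

Lemma crp_ge0 a n j : 0 <= a <= 1 -> 0 <= crp a n j.
Proof.
move=> /andP[a0 a1]; elim: n j => [|n IH] j /=; first by rewrite ler0n.
apply: addr_ge0; last first.
  by apply: mulr_ge0 => //; rewrite divr_ge0// mulr_ge0.
(* For j > n the factor 1 - a (j + 1) / (n + 1) may be negative, but then [crp a n j] is 0. *)
have [nj|jn] := ltnP n j; first by rewrite crp_out// mul0r.
apply: mulr_ge0 => //; rewrite subr_ge0 ler_pdivrMr ?ltr0Sn// mul1r.
by apply: le_trans (_ : 1 * j.+1%:R <= _); [rewrite ler_wpM2r|rewrite mul1r ler_nat].
Qed.

(* The rising factorials [rprod s] are eigenfunctions of one seating step. *)
Lemma crp_rprod a s n :
  \sum_(j < n.+1) crp a n j * rprod s j = rprod (a * s) n.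
Proof.
elim: n => [|n IH]; first by rewrite big_ord1/= !rprod0 mulr1.
rewrite rprodS -IH /=.
under eq_bigr do rewrite mulrDl.
rewrite big_split/= [X in _ + X]big_ord_recl/= !mulr0 !mul0r mulr0 mul0r add0r.
rewrite big_ord_recr/= crp_out// !mul0r addr0.
rewrite mulr_suml -big_split/=; apply: eq_bigr => i _.
rewrite /bump/= add1n rprodS.
have n0 : n.+1%:R != 0 :> R by rewrite pnatr_eq0.
have i0 : i.+1%:R != 0 :> R by rewrite pnatr_eq0.
by field; rewrite !nat1r n0 i0.
Qed.

Lemma crp_sum a n : \sum_(j < n.+1) crp a n j = 1.
Proof.
have := crp_rprod a 0 n; rewrite mulr0.
have r1 k : rprod 0 k = 1.
  by rewrite /rprod big1// => i _; rewrite mul0r addr0.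
by rewrite r1 => <-; apply: eq_bigr => i _; rewrite r1 mulr1.
Qed.

(** Bernoulli's inequality for exponents in [0, 1], from the convexity of exp between 0 and ln y.
    Most of the product and Gamma estimates below rest on it. *)
Lemma powR_le_lin s y : 0 <= s <= 1 -> 0 <= y -> y `^ s <= 1 + s * (y - 1).
Proof.
move=> /andP[s0 s1]; rewrite le_eqVlt => /predU1P[<-|y0].
  (* At y = 0 the convention that 0 to the power 0 is 1 makes s = 0 a separate case. *)
  by rewrite /powR eqxx sub0r; case: eqP => [->|]/=; lra.
rewrite /powR gt_eqF//.
have s01 : 0 <= s <= 1 by rewrite s0.
have := convex_expR (Itv01 s0 s1) (ln y) 0.
rewrite !convRE/= /unstable.onem mulr0 addr0 expR0 lnK ?posrE// => H.
by apply: (le_trans H); lra.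
Qed.

Lemma powRV x s : 0 <= x -> x^-1 `^ s = (x `^ s)^-1.
Proof. by move=> x0; rewrite -powR_inv1// powRAC powR_inv1 ?powR_ge0. Qed.

(** The first factor of the product is 1 - s and is the source of the constant. The factor with
    denominator k + 2 is at least ((k + 1) / (k + 2))^s by Bernoulli, and these ratios telescope. *)
Lemma rprodN_ge s n : 0 <= s < 1 -> (1 - s) * n.+1%:R `^ (- s) <= rprod (- s) n.
Proof.
move=> /andP[s0 s1].
have h k : k.+1%:R `^ (- s) <= \prod_(i < k) (1 - s / i.+2%:R) :> R.
  elim: k => [|k IH]; first by rewrite big_ord0 powR1.
  rewrite big_ord_recr/=.
  have e : k.+2%:R `^ (- s) = k.+1%:R `^ (- s) * (k.+1%:R / k.+2%:R) `^ s :> R.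
    rewrite powRM ?invr_ge0// !powRN mulrA mulVf ?mul1r; last first.
      by rewrite gt_eqF// powR_gt0.
    by rewrite powRV.
  rewrite e ler_pM ?powR_ge0//.
  apply: (le_trans (powR_le_lin _ _)); rewrite ?s0 ?(ltW s1) ?divr_ge0//.
  have k0 : k.+2%:R != 0 :> R by rewrite pnatr_eq0.
  suff -> : k.+1%:R / k.+2%:R - 1 = - k.+2%:R^-1 :> R by rewrite mulrN.
  by rewrite -[in X in X / _](natr1 k) -(natr1 k.+1) -(natr1 k); field;
     rewrite natr1 natr1 pnatr_eq0.
case: n => [|n]; first by rewrite rprod0 powR1; lra.
rewrite /rprod big_ord_recl divr1.
rewrite ler_pM ?powR_ge0//; [lra|].
under eq_bigr do rewrite mulNr lift0.
apply: le_trans (h n).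
rewrite !powRN lef_pV2 ?posrE ?powR_gt0//.
by rewrite ge0_ler_powR ?nnegrE ?ler_nat.
Qed.

(** Bernoulli at the inverse ratio (n + 2) / (n + 1) gives 1 - s / (n + 1) <= 1 / (1 + s / (n + 1))
    <= ((n + 1) / (n + 2))^s, and the product telescopes. *)
Lemma rprodN_le s n : 0 <= s <= 1 -> rprod (- s) n <= n.+1%:R `^ (- s).
Proof.
move=> /andP[s0 s1]; elim: n => [|n IH]; first by rewrite rprod0 powR1.
have h : 1 - s / n.+1%:R <= (n.+1%:R / n.+2%:R) `^ s :> R.
  have := @powR_le_lin s (n.+2%:R / n.+1%:R) _ _.
  rewrite s0 s1 divr_ge0// => /(_ isT isT) H.
  rewrite -[n.+1%:R / n.+2%:R]invf_div powRV ?divr_ge0//.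
  have n0 : n.+1%:R != 0 :> R by rewrite pnatr_eq0.
  apply: (@le_trans _ _ (1 + s / n.+1%:R)^-1).
    have sn : 0 <= s / n.+1%:R by rewrite divr_ge0.
    move: (s / n.+1%:R) sn => z z0.
    by rewrite -[leRHS]mul1r ler_pdivlMr; [nra|lra].
  rewrite lef_pV2 ?posrE ?powR_gt0 ?divr_gt0//; last first.
    by rewrite ltr_wpDr ?divr_ge0.
  apply: (le_trans H); rewrite lerD2l ler_wpM2l//.
  by rewrite -natr1 mulrDl divff// mul1r addrAC subrr add0r.
have e : n.+2%:R `^ (- s) = n.+1%:R `^ (- s) * (n.+1%:R / n.+2%:R) `^ s :> R.
  rewrite powRM ?invr_ge0// !powRN mulrA mulVf ?mul1r; last first.
    by rewrite gt_eqF// powR_gt0.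
  by rewrite powRV.
rewrite rprodS e mulNr; apply: ler_pM => //.
  rewrite /rprod prodr_ge0// => i _; rewrite mulNr subr_ge0.
  by rewrite ler_pdivrMr ?ltr0Sn// mul1r (le_trans s1)// ler1n.
by rewrite subr_ge0 ler_pdivrMr ?ltr0Sn// mul1r (le_trans s1)// ler1n.
Qed.

(** The power (j + 1)^(-s) is traded for [rprod (- s) j] at the price 1 / (1 - s); the mean of the
    latter is exactly [rprod (- (a * s)) n], which decays like a power again. *)
Lemma crp_negmoment a s n : 0 <= a <= 1 -> 0 <= s < 1 ->
  \sum_(j < n.+1) crp a n j * j.+1%:R `^ (- s) <=
  (1 - s)^-1 * n.+1%:R `^ (- (a * s)).
Proof.
move=> a01 /andP[s0 s1]; have s1' : 0 < 1 - s by lra.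
rewrite mulrC ler_pdivlMr// mulr_suml.
have as01 : 0 <= a * s <= 1.
  case/andP: a01 => a0 a1; rewrite mulr_ge0//=.
  by rewrite (le_trans (ler_pM a0 s0 a1 (ltW s1)))// mulr1.
apply: le_trans (rprodN_le _ as01); rewrite -mulrN -crp_rprod.
apply: ler_sum => i _; rewrite -mulrA ler_wpM2l ?crp_ge0// mulrC.
by rewrite rprodN_ge// s0.
Qed.

End RestaurantWeights.

(** * The Gamma function: recurrence, one-sided bounds and Euler's product *)

Section GammaFunction.
Variable R : realType.
Implicit Types (s r x : R).
Notation mu := (@lebesgue_measure R).

Lemma continuous_expRN : continuous (fun x : R => expR (- x)).
Proof.
move=> x; apply: continuous_comp; last exact: continuous_expR.
exact: (@continuousN _ R^o).
Qed.

Lemma powR_continuous_pos s x : 0 < x -> {for x, continuous (fun z : R => z `^ s)}.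
Proof.
move=> x0; apply: differentiable_continuous; apply/derivable1_diffP.
by apply: derivable_powR; rewrite in_itv/= andbT.
Qed.

Lemma powR_continuous_itv s (x y : R) : 0 <= s -> 0 <= x -> x < y ->
  {within `[x, y], continuous (fun z : R => z `^ s)}.
Proof.
rewrite le_eqVlt => /predU1P[<-|s0] x0 xy.
  rewrite (_ : (fun z : R => z `^ 0) = cst 1).
    by apply: continuous_subspaceT => z; exact: cvg_cst.
  by apply/funext => z; rewrite powRr0.
apply: derivable_oo_LRcontinuous_within; split.
- move=> z; rewrite in_itv/= => /andP[xz _].
  by apply: derivable_powR; rewrite in_itv/= andbT (le_lt_trans x0).
- move: x0; rewrite le_eqVlt => /predU1P[<-|x0].
    by rewrite powR0 ?gt_eqF//; exact: powR_cvg0.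
  by apply/cvg_at_right_filter; exact: powR_continuous_pos.
- by apply/cvg_at_left_filter; apply: powR_continuous_pos; exact: le_lt_trans xy.
Qed.

(** The bound ln y < y at y = x / (2 s) costs half of the exponential decay. *)
Lemma powR_expRN_le s x : 0 < s -> 0 < x ->
  x `^ s * expR (- x) <= (2 * s) `^ s * expR (- (x / 2)).
Proof.
move=> s0 x0; have K0 : 0 < 2 * s by lra.
rewrite /powR !gt_eqF// -!expRD ler_expR.
have := @ln_sublinear R (x / (2 * s)) _; rewrite divr_gt0// => /(_ isT) /ltW.
rewrite lnM ?posrE ?invr_gt0// lnV ?posrE// => h.
have : s * (ln x - ln (2 * s)) <= x / 2.
  apply: le_trans (ler_wpM2l (ltW s0) h) _.
  have -> : s * (x / (2 * s)) = x / 2 by field; rewrite gt_eqF.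
  by [].
lra.
Qed.

(** This is Gamma(1 + s), kept in the extended reals until it is known to be finite. The shift makes
    the integrand finite and continuous up to 0 when s >= 0, so that intervals closed at 0 can be
    used. *)
Definition gammai s : \bar R :=
  (\int[mu]_(x in `[0%R, +oo[%classic) ((x `^ s) * expR (- x))%:E)%E.

Lemma measurable_gamma_integrand s : measurable_fun [set: R] (fun x => x `^ s * expR (- x)).
Proof. by apply: measurable_funM => //; apply: measurableT_comp. Qed.

Lemma gammai_ge0 s : (0 <= gammai s)%E.
Proof. by apply: integral_ge0 => x _; rewrite lee_fin mulr_ge0 ?powR_ge0 ?expR_ge0. Qed.

Lemma GammaE s : Gamma (1 + s) = fine (gammai s).
Proof.
rewrite /Gamma /gammai -integral_itv_obnd_cbnd; last first.
  apply: measurable_funTS; apply/measurable_EFinP; exact: measurable_gamma_integrand.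
by rewrite addrAC subrr add0r.
Qed.

Lemma gammai_cvg s : (\int[mu]_(x in `[0%R, n%:R]) ((x `^ s) * expR (- x))%:E)%E
  @[n --> \oo] --> gammai s.
Proof.
apply: ge0_cvgn_integral => [x|].
  by rewrite mulr_ge0 ?powR_ge0 ?expR_ge0.
exact: measurable_gamma_integrand.
Qed.

(** Integration by parts; the right endpoint is [n.+1] so that the interval is never degenerate, and
    the boundary term at 0 vanishes because 1 + s > 0. *)
Lemma gammaiS_itv s (n : nat) : 0 <= s ->
  (\int[mu]_(x in `[0%R, n.+1%:R]) ((x `^ (1 + s)) * expR (- x))%:E =
  (- (n.+1%:R `^ (1 + s) * expR (- n.+1%:R)))%:E +
  (1 + s)%:E * \int[mu]_(x in `[0%R, n.+1%:R]) ((x `^ s) * expR (- x))%:E)%E.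
Proof.
move=> s0; have s1 : 0 < 1 + s by lra.
have e0 (x : R) : is_derive x 1 (fun x => - expR (- x)) (expR (- x)).
  by apply: is_derive_eq; rewrite /GRing.scale/=; ring.
have ce := continuous_expRN.
rewrite (@integration_by_parts _ (fun x : R => x `^ (1 + s)) (fun x => - expR (- x))
  (fun x => (1 + s) * x `^ s) (fun x => expR (- x))) ?ltr0n//.
- rewrite powR0 ?gt_eqF// mul0r subr0 mulrN; congr (_ + _)%E.
  under eq_integral do rewrite mulrN EFinN.
  rewrite integral_ge0N; last first.
    by move=> x _; rewrite lee_fin !mulr_ge0 ?expR_ge0 ?powR_ge0 ?ltW.
  rewrite oppeK -ge0_integralZl ?lee_fin ?ltW//.
  + by apply: eq_integral => x _; rewrite -EFinM mulrA.
  + apply: measurable_funTS; apply/measurable_EFinP; exact: measurable_gamma_integrand.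
  + by move=> x _; rewrite lee_fin !mulr_ge0 ?expR_ge0 ?powR_ge0 ?ltW.
- by move=> x; apply: cvgM; [exact: cvg_cst|exact: powR_continuous_itv].
- split.
  + move=> z; rewrite in_itv/= => /andP[xz _].
    by apply: derivable_powR; rewrite in_itv/= andbT.
  + by rewrite powR0 ?gt_eqF//; exact: powR_cvg0.
  + by apply/cvg_at_left_filter; exact: powR_continuous_pos.
- move=> z; rewrite in_itv/= => /andP[xz _].
  by rewrite powR_derive1 ?in_itv/= ?andbT// addrAC subrr add0r.
- exact: continuous_subspaceT.
- by split; [move=> z _| |];
    [|apply/cvg_at_right_filter; apply: cvgN; exact: ce
     |apply/cvg_at_left_filter; apply: cvgN; exact: ce].
- by move=> z _; rewrite derive1E; exact: derive_val.
Qed.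

Lemma gammaiS s : 0 <= s -> gammai (1 + s) = ((1 + s)%:E * gammai s)%E.
Proof.
move=> s0; have s1 : 0 < 1 + s by lra.
have h1 := @gammai_cvg (1 + s); have h0 := @gammai_cvg s.
rewrite -cvg_shiftS in h1; rewrite -cvg_shiftS in h0.
have {h1} : (fun n : nat => (- (n.+1%:R `^ (1 + s) * expR (- n.+1%:R)))%:E +
  (1 + s)%:E * \int[mu]_(x in `[0%R, n.+1%:R]) ((x `^ s) * expR (- x))%:E)%E
  @ \oo --> gammai (1 + s).
  by under eq_fun do rewrite -gammaiS_itv//.
move=> h1; rewrite -(cvg_lim (@ereal_hausdorff R) h1).
apply/cvg_lim; first exact: ereal_hausdorff.
rewrite -[X in _ --> X]add0e; apply: cvgeD.
- by rewrite fin_num_adde_defr.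
- apply/fine_cvgP; split; first exact: nearW.
  rewrite -oppr0; apply: cvgN => /=.
  apply: (@squeeze_cvgr _ _ _ _ (cst 0)
    (fun n : nat => (2 * (1 + s)) `^ (1 + s) * expR (- (n.+1%:R / 2)))).
  + apply: nearW => n; rewrite mulr_ge0 ?powR_ge0 ?expR_ge0//=.
    exact: powR_expRN_le.
  + exact: cvg_cst.
  + rewrite -[X in _ --> X](mulr0 ((2 * (1 + s)) `^ (1 + s))).
    have h2 : 0 < 2^-1 :> R by rewrite invr_gt0.
    have h3 : (n.+1%:R / 2 : R) @[n --> \oo] --> +oo.
      apply/cvgryPge => A; near=> n; rewrite ler_pdivlMr//.
      apply: (@le_trans _ _ n%:R); last by rewrite ler_nat.
      by near: n; exact: nbhs_infty_ger.
    by apply: cvgMr; exact: cvg_comp h3 (@cvgr_expR R).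
- by apply: cvgeZl.
Unshelve. all: by end_near. Qed.

Lemma gammai0 : gammai 0 = 1%E.
Proof.
rewrite /gammai (@ge0_continuous_FTC2y _ _ (fun x => - expR (- x)) _ 0).
- by rewrite oppr0 expR0 -EFinB sub0r opprK.
- by move=> x _; rewrite mulr_ge0 ?powR_ge0 ?expR_ge0.
- apply: continuous_subspaceT => x; under eq_fun do rewrite powRr0 mul1r.
  exact: continuous_expRN.
- by rewrite -oppr0; apply: cvgN; exact: cvgr_expR.
- by move=> x _; exact: ex_derive.
- by apply/cvg_at_right_filter; apply: cvgN; exact: continuous_expRN.
- move=> x _; rewrite derive1E powRr0 mul1r.
  have : is_derive x 1 (fun x => - expR (- x)) (expR (- x)).
    by apply: is_derive_eq; rewrite /GRing.scale/=; ring.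
  by move=> /@derive_val.
Qed.

Lemma gammai_nat (n : nat) : gammai n%:R = (n`!%:R)%:E.
Proof.
elim: n => [|n IH]; first by rewrite gammai0 fact0.
by rewrite -nat1r gammaiS ?ler0n// IH -EFinM nat1r factS natrM.
Qed.

Lemma gammai_fin_num s : 0 <= s -> gammai s \is a fin_num.
Proof.
move=> s0; rewrite ge0_fin_numE ?gammai_ge0//.
(* On the half-line x^s <= 1 + x^n for any integer n >= s, and the right side integrates to 1 +
   n!. *)
pose n := Num.bound s.
have sn : s <= n%:R by rewrite ltW// archi_boundP.
apply: (@le_lt_trans _ _ (gammai 0 + gammai n%:R)%E); last first.
  by rewrite gammai0 gammai_nat -EFinD ltry.
have mE r : measurable_fun (`[0%R, +oo[%classic : set R) (fun x : R => (x `^ r * expR (- x))%:E).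
  by apply: measurable_funTS; apply/measurable_EFinP; exact: measurable_gamma_integrand.
have gE r x : (0%E <= (x `^ r * expR (- x))%:E)%E.
  by rewrite lee_fin mulr_ge0 ?powR_ge0 ?expR_ge0.
rewrite /gammai -ge0_integralD//; last 2 first.
- exact: mE.
- exact: mE.
apply: ge0_le_integral => //.
- exact: mE.
- by apply: emeasurable_funD; exact: mE.
- move=> x; rewrite /= in_itv/= andbT => x0.
  rewrite -EFinD lee_fin -mulrDl ler_wpM2r ?expR_ge0// powRr0.
  have [x1|x1] := leP x 1.
    apply: (@le_trans _ _ 1); last by rewrite lerDl powR_ge0.
    by rewrite -[leRHS](congr1 (@^~ s) (@powR1 R)); apply: ge0_ler_powR; rewrite ?nnegrE.
  by apply: (@le_trans _ _ (x `^ n%:R)); rewrite ?lerDr// ler_powR// ltW.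
Qed.

(** Jensen's inequality for the concave function x^s under the density x^r e^(-x) / Gamma(1 + r),
    whose mean is 1 + r: x^s lies below its tangent at the mean, and the centred linear part
    integrates to 0. *)
Lemma gammai_powR_ub r s : 0 <= r -> 0 <= s <= 1 ->
  (gammai (r + s) <= ((1 + r) `^ s)%:E * gammai r)%E.
Proof.
move=> r0 /andP[s0 s1]; have r1 : 0 < 1 + r by lra.
have mE u : measurable_fun (`[0%R, +oo[%classic : set R) (fun x : R => (x `^ u * expR (- x))%:E).
  by apply: measurable_funTS; apply/measurable_EFinP; exact: measurable_gamma_integrand.
have gE u x : (0%E <= (x `^ u * expR (- x))%:E)%E.
  by rewrite lee_fin mulr_ge0 ?powR_ge0 ?expR_ge0.
pose c := (1 + r) `^ s.
have c0 : 0 <= c by exact: powR_ge0.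
(* The tangent is written with two nonnegative coefficients, so that only integrals of nonnegative
   functions occur. *)
have ineq : (gammai (r + s) <= (c * (1 - s))%:E * gammai r +
    (c * s / (1 + r))%:E * gammai (1 + r))%E.
  have c1 : 0 <= c * (1 - s) by rewrite mulr_ge0// subr_ge0.
  have c2 : 0 <= c * s / (1 + r) by rewrite divr_ge0 ?mulr_ge0// ltW.
  rewrite /gammai -!ge0_integralZl_EFin//; try exact: mE.
  rewrite -ge0_integralD//; last 4 first.
  - by move=> x _; rewrite mule_ge0.
  - by apply: measurable_funeM; exact: mE.
  - by move=> x _; rewrite mule_ge0.
  - by apply: measurable_funeM; exact: mE.
  apply: ge0_le_integral => //.
  - exact: mE.
  - by apply: emeasurable_funD; apply: measurable_funeM; exact: mE.
  move=> x; rewrite /= in_itv/= andbT => x0.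
  rewrite -!EFinM -EFinD lee_fin !mulrA -mulrDl ler_wpM2r ?expR_ge0//.
  move: x0; rewrite le_eqVlt => /predU1P[<-|x0].
    have [/eqP|rs] := eqVneq (r + s) 0.
      rewrite paddr_eq0// => /andP[/eqP -> /eqP s00].
      rewrite s00 addr0 !powRr0 /c s00 powRr0; rewrite mulr0 mul0r mul0r addr0; lra.
    by rewrite powR0//; apply: addr_ge0; apply: mulr_ge0 => //; exact: powR_ge0.
  have -> : x `^ (r + s) = x `^ r * (c * (x / (1 + r)) `^ s).
    rewrite powRD; last by rewrite (gt_eqF x0) implybT.
    rewrite /c -powRM ?divr_ge0 ?(ltW r1) ?(ltW x0)//.
    by rewrite mulrCA divff ?mulr1 ?gt_eqF.
  have -> : x `^ (1 + r) = x * x `^ r.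
    by rewrite powRD ?(gt_eqF x0) ?implybT// powRr1 // ltW.
  have := @powR_le_lin R s (x / (1 + r)) _ _.
  rewrite s0 s1 divr_ge0 ?(ltW x0) ?(ltW r1)// => /(_ isT isT) h.
  apply: (@le_trans _ _ (x `^ r * (c * (1 + s * (x / (1 + r) - 1))))).
    by rewrite ler_wpM2l ?powR_ge0// ler_wpM2l.
  rewrite le_eqVlt; apply/orP; left; apply/eqP.
  by field; rewrite gt_eqF.
apply: (le_trans ineq); rewrite gammaiS//.
rewrite -(fineK (gammai_fin_num r0)) -!EFinM -EFinD lee_fin.
rewrite le_eqVlt; apply/orP; left; apply/eqP.
by rewrite /c; field; rewrite gt_eqF.
Qed.

Definition gammar s : R := fine (gammai s).

Lemma GammaD1 s : Gamma (1 + s) = gammar s. Proof. exact: GammaE. Qed.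

Lemma gammarS s : 0 <= s -> gammar (1 + s) = (1 + s) * gammar s.
Proof. by move=> s0; rewrite /gammar gammaiS// fineM ?gammai_fin_num. Qed.

Lemma gammar_nat (n : nat) : gammar n%:R = n`!%:R.
Proof. by rewrite /gammar gammai_nat. Qed.

Lemma gammar_powR_ub r s : 0 <= r -> 0 <= s <= 1 ->
  gammar (r + s) <= (1 + r) `^ s * gammar r.
Proof.
move=> r0 s01; have := gammai_powR_ub r0 s01.
have rs0 : 0 <= r + s by case/andP: s01 => *; rewrite addr_ge0.
by rewrite -(fineK (gammai_fin_num rs0)) -(fineK (gammai_fin_num r0)) -EFinM lee_fin.
Qed.

Lemma gammar_rprod s (n : nat) : 0 <= s ->
  gammar (n%:R + s) = n`!%:R * rprod s n * gammar s.
Proof.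
move=> s0; elim: n => [|n IH]; first by rewrite rprod0 add0r mulr1 mul1r.
have -> : n.+1%:R + s = 1 + (n%:R + s) by rewrite -nat1r addrA.
have ns0 : 0 <= n%:R + s by rewrite addr_ge0.
rewrite (gammarS ns0) IH rprodS factS (natrM R n.+1 n`!).
by rewrite -[in RHS]nat1r; field; rewrite nat1r pnatr_eq0.
Qed.

(** Positivity is read off from [gammar_powR_ub]: on [0, 1], raising r by 1 - r reaches [gammar 1],
    which is 1, so [gammar r] cannot vanish; the recurrence carries this to larger arguments. *)
Lemma gammar_gt0 s : 0 <= s -> 0 < gammar s.
Proof.
move=> s0; rewrite lt_neqAle fine_ge0 ?gammai_ge0// andbT.
apply/eqP => g0.
pose n := Num.bound s; have sn : s <= n%:R by rewrite ltW// archi_boundP.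
have h (m : nat) r : 0 <= r -> r <= m%:R -> gammar r != 0.
  elim: m r => [|m IH] r r0 rm.
    have -> : r = 0 by apply/le_anti; rewrite r0 rm.
    by rewrite (gammar_nat 0) fact0 oner_eq0.
  have [r1|r1] := leP r 1.
    have r1' : 0 <= 1 - r <= 1 by lra.
    have := gammar_powR_ub r0 r1'; rewrite addrC subrK (gammar_nat 1) factS fact0 muln1.
    by apply: contraPneq => ->; rewrite mulr0 ler10.
  have -> : r = 1 + (r - 1) by lra.
  rewrite gammarS; last by lra.
  rewrite mulf_neq0 ?IH//; [lra|lra|].
  by rewrite lerBlDr natr1.
by have := h _ _ s0 sn; rewrite -g0 eqxx.
Qed.

(* Euler's product for the Gamma function. *)
Lemma rprod_cvg s : 0 <= s ->
  (fun n : nat => rprod s n * n.+1%:R `^ (- s)) @ \oo --> (gammar s)^-1.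
Proof.
move=> s0; have [n sn] : exists n : nat, s <= n%:R.
  by exists (Num.bound s); rewrite ltW// archi_boundP.
have cr (r : R) : (fun m : nat => (m.+1%:R + r) / m.+1%:R : R) @ \oo --> (1 : R).
  rewrite -[X in _ --> X]addr0 -[X in _ --> _ + X](mulr0 r).
  under eq_fun do rewrite mulrDl divff ?pnatr_eq0//.
  apply: cvgD; first exact: cvg_cst.
  by apply: cvgMr; exact: cvg_harmonic.
(* Induction on an integer bound for s: an exponent above 1 is lowered by 1 through the recurrence
   of Gamma. *)
elim: n s s0 sn => [|n IH] s s0 sn.
  have -> : s = 0 by apply/le_anti; rewrite s0 sn.
  rewrite (gammar_nat 0) fact0 invr1 oppr0.
  rewrite (_ : (fun=> _) = cst 1); first exact: cvg_cst.
  apply/funext => m; rewrite powRr0 mulr1 /rprod big1// => i _.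
  by rewrite mul0r addr0.
have [s1|s1] := leP s 1; last first.
  have s10 : 0 <= s - 1 by lra.
  have := IH _ s10; rewrite lerBlDr natr1 => /(_ sn) h.
  have e : s = 1 + (s - 1) by lra.
  have sn0 : s != 0 by rewrite gt_eqF//; lra.
  have -> : (fun m : nat => rprod s m * m.+1%:R `^ (- s)) =
      (fun m : nat => s^-1 * ((m.+1%:R + (s - 1)) / m.+1%:R *
         (rprod (s - 1) m * m.+1%:R `^ (- (s - 1))))).
    apply/funext => m.
    have -> : m.+1%:R `^ (- s) = m.+1%:R^-1 * m.+1%:R `^ (- (s - 1)) :> R.
      rewrite -powR_inv1// -powRD; last by rewrite pnatr_eq0 implybT.
      by congr (_ `^ _); lra.
    have -> : rprod s m = s^-1 * (m.+1%:R + (s - 1)) * rprod (s - 1) m.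
      elim: m => [|m IHm]; first by rewrite !rprod0 mulr1 addrC subrK mulVf.
      rewrite !rprodS IHm -[in RHS](natr1 m.+1) -[in LHS](natr1 m) -[in RHS](natr1 m).
      by field; rewrite natr1 pnatr_eq0 sn0.
    by move: s^-1 m.+1%:R^-1 (m.+1%:R `^ _) (rprod _ _) => x1 x2 x3 x4; ring.
  rewrite e gammarS// -e invfM; apply: cvgMr.
  by rewrite -[X in _ --> X]mul1r; apply: cvgM.
have g0 := gammar_gt0 s0.
rewrite -[X in _ --> X]mul1r.
have -> : (fun m : nat => rprod s m * m.+1%:R `^ (- s)) =
  (fun m : nat => (gammar (m%:R + s) / m`!%:R * m.+1%:R `^ (- s)) * (gammar s)^-1).
  apply/funext => m; rewrite gammar_rprod//; field.
  by rewrite gt_eqF//= pnatr_eq0 -lt0n fact_gt0.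
apply: cvgMl.
have s01 : 0 <= s <= 1 by rewrite s0.
(* [gammar_powR_ub] is used twice: raising m by s bounds the ratio above by 1, and raising m + s by
   1 - s, which reaches m + 1, bounds it below by (m + 1) / (m + 1 + s). *)
apply: (@squeeze_cvgr _ _ _ _ (fun m : nat => ((m.+1%:R + s) / m.+1%:R)^-1) (fun=> 1 : R)).
- apply: nearW => m.
  have f0 : 0 < m`!%:R :> R by rewrite ltr0n fact_gt0.
  apply/andP; split; last first.
    rewrite powRN ler_pdivrMr ?powR_gt0// ler_pdivrMr// mul1r.
    have := @gammar_powR_ub m%:R s _ s01; rewrite ler0n => /(_ isT).
    by rewrite nat1r gammar_nat.
  have s1' : 0 <= 1 - s <= 1 by lra.
  have ms0 : 0 <= m%:R + s by rewrite addr_ge0.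
  have := gammar_powR_ub ms0 s1'.
  rewrite addrA addrAC addrK natr1 gammar_nat factS natrM addrA nat1r => h.
  have ms1 : 0 < m.+1%:R + s by rewrite ltr_pwDl.
  have m1 : 0 < m.+1%:R :> R by [].
  have h2 : m.+1%:R `^ (- s) >= (m.+1%:R + s) `^ (1 - s) * (m.+1%:R + s)^-1.
    rewrite -powR_inv1 ?(ltW ms1)// -powRD; last by rewrite (gt_eqF ms1) implybT.
    have -> : 1 - s + (-1) = - s by lra.
    rewrite !powRN lef_pV2 ?posrE ?powR_gt0//.
    by rewrite ge0_ler_powR ?nnegrE ?(ltW ms1) ?(ltW m1)// lerDl.
  rewrite invf_div ler_pdivrMr//.
  move: h2; rewrite ler_pdivrMr// => h2.
  rewrite mulrAC -mulrA -ler_pdivrMl ?divr_gt0 ?gammar_gt0//.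
  rewrite [leRHS]mulrC; apply: le_trans h2.
  by rewrite invf_div mulrAC ler_pdivrMr ?gammar_gt0// mulrC.
- by rewrite -[X in _ --> X]invr1; apply: cvgV; rewrite ?oner_eq0.
- exact: cvg_cst.
Qed.

End GammaFunction.

(** * The Laplace transform of the table count and the Mittag-Leffler series *)

Section MittagLefflerLimit.
Variable R : realType.
Implicit Types (a s y l : R).

Lemma rprod_ge0 s n : 0 <= s -> 0 <= rprod s n.
Proof. by move=> s0; apply: prodr_ge0 => i _; rewrite addr_ge0// divr_ge0. Qed.

Lemma rprodSs s n : rprod s n.+1 = rprod (s + 1) n * ((s + 1) / n.+1%:R).
Proof.
elim: n => [|n IH]; first by rewrite rprodS !rprod0 !mul1r !divr1 addrC.
rewrite rprodS IH rprodS -!mulrA; congr (_ * _).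
by rewrite -(natr1 n.+1) -(natr1 n); field; rewrite !natr1 !pnatr_eq0.
Qed.

Lemma rprod_le s r n : 0 <= s <= r -> rprod s n <= rprod r n.
Proof.
move=> /andP[s0 sr]; apply: ler_prod => i _.
by rewrite addr_ge0 ?divr_ge0//= lerD2l ler_wpM2r// invr_ge0.
Qed.

(** [rprod m%:R j] is the binomial coefficient of m + j over j, so this is the passage from j to j +
    1 for partial sums of the negative binomial series. The remainder is kept exact: its sign gives
    boundedness, its decay gives the limit. *)
Let negbin_psum y j M :
  (1 - y) * series (fun m => rprod m%:R j.+1 * y ^+ m) M
    + y ^+ M * (rprod M%:R j * (M%:R / j.+1%:R))
  = series (fun m => rprod m%:R j * y ^+ m) M.
Proof.
rewrite /series/=; elim: M => [|M IH].
  by rewrite !big_geq// mulr0 mul0r !mulr0 addr0.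
rewrite !big_nat_recr//= -IH.
have -> : rprod M.+1%:R j * (M.+1%:R / j.+1%:R) = rprod M%:R j.+1 :> R.
  by rewrite rprodSs natr1.
by rewrite rprodS exprS; ring.
Qed.

Let negbin_cvg0 y j : 0 <= y < 1 ->
  cvgn (series (fun m => rprod m%:R j * y ^+ m)).
Proof.
move=> /andP[y0 y1]; have y1' : 0 < 1 - y by lra.
have t0 k m : 0 <= rprod m%:R k * y ^+ m by rewrite mulr_ge0 ?rprod_ge0 ?exprn_ge0.
have nd k : nondecreasing_seq (series (fun m => rprod m%:R k * y ^+ m)).
  exact: nondecreasing_series.
elim: j => [|j /(nondecreasing_cvgn_le (nd _)) ub].
  rewrite (_ : (fun _ => _) = geometric 1 y).
    by apply: is_cvg_geometric_series; rewrite ger0_norm.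
  by apply/funext => m; rewrite rprod0.
apply: nondecreasing_is_cvgn => //.
exists ((1 - y)^-1 * limn (series (fun m => rprod m%:R j * y ^+ m))).
move=> _ [M _ <-]; rewrite ler_pdivlMl//; apply: le_trans (ub M).
rewrite -[leRHS]negbin_psum lerDl mulr_ge0 ?exprn_ge0// mulr_ge0 ?rprod_ge0//.
Qed.

Lemma negbin_cvg y j : `|y| < 1 ->
  series (fun m => rprod m%:R j * y ^+ m) @ \oo --> (1 - y) ^- j.+1.
Proof.
move=> y1; have y1' : 1 - y != 0.
  by rewrite subr_eq0; apply: contraTneq y1 => <-; rewrite normr1 ltxx.
elim: j => [|j IH].
  rewrite (_ : (fun _ => _) = geometric 1 y).
    by rewrite expr1 -[X in _ --> X]mul1r; exact: cvg_geometric_series.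
  by apply/funext => m; rewrite rprod0.
(* Up to the factor y and an index shift, the remainder is the general term of the convergent series
   at j + 1. *)
have tail : (fun M => y ^+ M * (rprod M%:R j * (M%:R / j.+1%:R))) @ \oo --> (0 : R).
  have h : (fun M => y * (rprod M%:R j.+1 * y ^+ M)) @ \oo --> (0 : R).
    rewrite -[X in _ --> X](mulr0 y); apply: cvgMr; apply/norm_cvg0P.
    rewrite (_ : (fun M => _) = (fun M => rprod M%:R j.+1 * `|y| ^+ M)).
      by apply/cvg_series_cvg_0/negbin_cvg0; rewrite normr_ge0.
    by apply/funext => M; rewrite normrM normrX ger0_norm// rprod_ge0.
  rewrite -cvg_shiftS; apply: cvg_trans h; apply: near_eq_cvg; apply: nearW => M /=.
  by rewrite rprodSs natr1 exprS; ring.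
rewrite (_ : series _ = (fun M => (1 - y)^-1 *
  (series (fun m => rprod m%:R j * y ^+ m) M -
   y ^+ M * (rprod M%:R j * (M%:R / j.+1%:R))))); last first.
  by apply/funext => M; rewrite -negbin_psum addrK mulKf.
rewrite exprS invfM -[X in _ * X]subr0.
by apply: cvgMr; apply: cvgB.
Qed.

(** Dominated convergence for series. The domination starts at [n0] because the generating series to
    which it is applied converge only for small arguments. *)
Lemma tannery (f : nat -> nat -> R) (g b F : nat -> R) (n0 : nat) :
  (forall n m, (n0 <= n)%N -> `|f n m| <= b m) -> cvgn (series b) ->
  (forall m, f n m @[n --> \oo] --> g m) ->
  (forall n, (n0 <= n)%N -> series (f n) @ \oo --> F n) ->
  F @ \oo --> limn (series g) /\ cvgn (series g).
Proof.
move=> fb cb fg fF.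
have b0 m : 0 <= b m by apply: le_trans (fb n0 m _).
have gb m : `|g m| <= b m.
  apply: (ler_cvg_to (cvg_norm (fg m)) (cvg_cst (b m))).
  by exists n0 => // n /= n0n; exact: fb.
have cg : cvgn (series g).
  by apply: normed_cvg; apply: series_le_cvg cb => // n /=.
have ndb : nondecreasing_seq (series b) by exact: nondecreasing_series.
(* One tail estimate that serves both for the limit coefficients [g] and for every [f n] with n >=
   n0. *)
have tail u l M : (forall m, `|u m| <= b m) -> series u @ \oo --> l ->
    `|l - series u M| <= limn (series b) - series b M.
  move=> ub ul.
  have h : (fun K => `|series u K - series u M|) @ \oo --> `|l - series u M|.
    by apply: cvg_norm; apply: cvgB => //; exact: cvg_cst.
  apply: (ler_cvg_to h (cvg_cst _)).
  exists M => // K /= MK.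
  apply: (@le_trans _ _ (series b K - series b M)); last first.
    by rewrite lerD2r; exact: nondecreasing_cvgn_le.
  rewrite !sub_series_geq//; apply: le_trans (ler_norm_sum _ _ _) _.
  by apply: ler_sum.
split=> //; apply/cvgrPdist_le => e e0.
have e3 : 0 < e / 3 by rewrite divr_gt0.
have [M _ hM] : \forall M \near \oo, limn (series b) - series b M <= e / 3.
  move/cvgrPdist_le : cb => /(_ _ e3); apply: filterS => M.
  by apply: le_trans; exact: ler_norm.
have {}hM := hM M (leqnn M).
have : series (f n) M @[n --> \oo] --> series g M.
  by apply: cvg_big => [|m _]; [exact: add_continuous|exact: fg].
move=> /cvgrPdist_le/(_ _ e3)[n1 _ hn1].
exists (maxn n0 n1) => // n /=; rewrite geq_max => /andP[n0n n1n].
have h1 := tail _ _ M gb cg.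
have h2 := tail _ _ M (fun m => fb n m n0n) (fF n n0n).
have h3 := hn1 n n1n.
have -> : limn (series g) - F n = (limn (series g) - series g M) +
  (series g M - series (f n) M) - (F n - series (f n) M) by ring.
rewrite (le_trans (ler_normB _ _))//.
have := ler_normD (limn (series g) - series g M) (series g M - series (f n) M).
rewrite /= in h3; lra.
Qed.

(** The negative binomial series expands each (1 + y)^(-(j + 1)); the coefficient of (-y)^m is then
    the mean of [rprod m%:R j], which [crp_rprod] evaluates. *)
Lemma crp_negbin a n y : 0 <= y < 1 ->
  series (fun m => rprod (a * m%:R) n * (- y) ^+ m) @ \oo -->
  \sum_(j < n.+1) crp a n j * (1 + y) ^- j.+1.
Proof.
move=> /andP[y0 y1].
rewrite (_ : series _ = (fun M => \sum_(j < n.+1)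
    crp a n j * series (fun m => rprod m%:R j * (- y) ^+ m) M)); last first.
  apply/funext => M; under [RHS]eq_bigr do rewrite /series/= mulr_sumr.
  rewrite exchange_big/= /series/=; apply: eq_bigr => m _.
  by rewrite -crp_rprod mulr_suml; apply: eq_bigr => j _; rewrite mulrA.
apply: cvg_big => [|j _]; first exact: add_continuous.
apply: cvgMr; have := @negbin_cvg (- y) j.
by rewrite opprK normrN ger0_norm//; exact.
Qed.

(** Two uses of [gammar_powR_ub]: [rprod s n * gammar s] is at most (n + 1)^s, and 1 <= (1 + s)^(1 -
    s) [gammar s] <= 2 [gammar s]. *)
Lemma rprod_powR_ub s n : 0 <= s <= 1 -> rprod s n * n.+1%:R `^ (- s) <= 2.
Proof.
move=> s01; have /andP[s0 s1] := s01; have g0 := gammar_gt0 s0.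
have f0 : 0 < n`!%:R :> R by rewrite ltr0n fact_gt0.
have h : rprod s n * gammar s <= n.+1%:R `^ s.
  have := @gammar_powR_ub R n%:R s _ s01; rewrite ler0n => /(_ isT).
  by rewrite gammar_rprod// nat1r gammar_nat -mulrA mulrC ler_pM2r.
have s1' : 0 <= 1 - s <= 1 by lra.
have := gammar_powR_ub s0 s1'.
rewrite addrC subrK (gammar_nat _ 1) factS fact0 muln1 => h2.
have h3 : (1 + s) `^ (1 - s) <= 2.
  apply: (@le_trans _ _ (2 `^ (1 - s))).
    by apply: ge0_ler_powR; rewrite ?nnegrE//; lra.
  by rewrite ler1_powR//; lra.
have h4 : 1 <= 2 * gammar s by apply: (le_trans h2); rewrite ler_pM2r.
rewrite powRN ler_pdivrMr ?powR_gt0//.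
apply: (@le_trans _ _ (rprod s n * gammar s * 2)); last first.
  by rewrite mulrC ler_pM2l.
rewrite -mulrA [_ * 2]mulrC -[leLHS]mulr1 ler_wpM2l// rprod_ge0//.
Qed.

(** The ratio of consecutive terms is at most 1 by Bernoulli with exponent 1 / s, in the form 1 + s
    / (m + 1) <= (1 + 1 / (m + 1))^s. *)
Lemma rprod_powR_nincr s n k : 1 <= s ->
  rprod s (n + k) * (n + k).+1%:R `^ (- s) <= rprod s n * n.+1%:R `^ (- s).
Proof.
move=> s1; have s0 : 0 <= s by lra.
elim: k => [|k]; first by rewrite addn0.
apply: le_trans; rewrite addnS; move: (n + k)%N => {k}m.
rewrite rprodS -mulrA ler_wpM2l ?rprod_ge0//.
rewrite !powRN ler_pdivrMr ?powR_gt0// [leRHS]mulrC ler_pdivlMr ?powR_gt0//.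
have si : 0 < s^-1 <= 1 by rewrite invr_gt0 invf_le1; lra.
have := @powR_le_lin R s^-1 (1 + s / m.+1%:R) _ _.
rewrite (ltW (proj1 (andP si))) (proj2 (andP si)) addr_ge0 ?divr_ge0// => /(_ isT isT).
rewrite addrAC subrr add0r mulrA mulVf ?gt_eqF ?mul1r//; last by lra.
move=> h; have {}h : 1 + s / m.+1%:R <= (1 + m.+1%:R^-1) `^ s.
  have -> : 1 + s / m.+1%:R = ((1 + s / m.+1%:R) `^ s^-1) `^ s.
    by rewrite -powRrM mulVf ?powRr1 ?addr_ge0 ?divr_ge0 ?gt_eqF//; lra.
  by rewrite ge0_ler_powR ?nnegrE ?powR_ge0 ?addr_ge0.
have -> : m.+2%:R = m.+1%:R * (1 + m.+1%:R^-1) :> R.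
  by rewrite mulrDr mulr1 divff// natr1.
by rewrite powRM ?addr_ge0// [leLHS]mulrC ler_wpM2l ?powR_ge0.
Qed.

(** The constant has to be independent of s, since s = a m runs through all terms of the series. For
    s >= 1 monotonicity in n suffices; for s < 1 the left side is at most 2 and the last bracket on
    the right is at least 1 / (n0 + 1). *)
Lemma rprod_powR_dom s n0 n : 0 <= s -> (n0 <= n)%N ->
  rprod s n * n.+1%:R `^ (- s) <=
  (2 * n0.+1%:R) * (rprod s n0 * n0.+1%:R `^ (- s)).
Proof.
move=> s0 n0n; have N1 : 1 <= n0.+1%:R :> R by rewrite ler1n.
have [s1|s1] := leP 1 s.
  rewrite -(subnKC n0n); apply: (le_trans (rprod_powR_nincr _ _ s1)).
  rewrite -[leLHS]mul1r ler_wpM2r ?mulr_ge0 ?rprod_ge0 ?powR_ge0//.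
  lra.
apply: (le_trans (rprod_powR_ub _ _)); first by rewrite s0 ltW.
rewrite -mulrA -[leLHS]mulr1 ler_wpM2l// mulrCA.
apply: (@le_trans _ _ (1 * (n0.+1%:R * n0.+1%:R `^ (-1)))).
  by rewrite mul1r powR_inv1// divff.
apply: ler_pM; [by []|by rewrite mulr_ge0 ?powR_ge0| |].
  rewrite /rprod; elim/big_ind: _ => // [x y x1 y1|i _].
    by rewrite -[leLHS]mulr1 ler_pM.
  by rewrite lerDl divr_ge0.
by rewrite ler_wpM2l// ler_powR// lerN2 ltW.
Qed.

Lemma natr_powR_cvgy a : 0 < a -> (n.+1%:R `^ a : R) @[n --> \oo] --> +oo.
Proof.
move=> a0; apply/cvgryPge => A; near=> n.
apply: (@le_trans _ _ (`|A| `^ a^-1 `^ a)).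
  by rewrite -powRrM mulVf ?gt_eqF// powRr1// ler_norm.
apply: ge0_ler_powR; rewrite ?nnegrE ?powR_ge0 ?ltW//.
apply: (@lt_le_trans _ _ n%:R); last by rewrite ler_nat.
by near: n; exact: nbhs_infty_gtr.
Unshelve. all: by end_near. Qed.

(** The inequalities 1 + x <= e^x <= 1 / (1 - x) at x = l / r squeeze the expression between l and l
    / (1 - l / r). *)
Lemma expR_sub1_cvg l (r : nat -> R) : 0 <= l -> (forall n, 0 < r n) ->
  r n @[n --> \oo] --> +oo -> r n * (expR (l / r n) - 1) @[n --> \oo] --> l.
Proof.
move=> l0 r0 ry.
have lr0 : l / r n @[n --> \oo] --> (0 : R).
  rewrite -[X in _ --> X](mulr0 l); apply: cvgMr.
  by apply/gtr0_cvgV0 => //; exact: nearW.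
apply: (@squeeze_cvgr _ _ _ _ (fun=> l) (fun n => l / (1 - l / r n))).
- near=> n.
  have x1 : l / r n < 1.
    by near: n; apply: (cvgr_lt (0 : R)).
  have rn := r0 n; apply/andP; split.
    have := expR_ge1Dx (l / r n); rewrite -lerBrDl => h.
    apply: le_trans (ler_wpM2l (ltW rn) h).
    by rewrite mulrCA divff ?mulr1// gt_eqF.
  have x0 : 0 <= l / r n by rewrite divr_ge0 // ltW.
  have h : expR (l / r n) - 1 <= (l / r n) / (1 - l / r n).
    rewrite ler_pdivlMr ?subr_gt0//.
    have := expR_ge1Dx (- (l / r n)); rewrite expRN.
    have := expR_gt0 (l / r n); move: (expR (l / r n)) (l / r n) x0 x1 => e x x0 x1 e0.
    rewrite -[X in _ <= X -> _]mul1r ler_pdivlMr//; nra.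
  apply: le_trans (ler_wpM2l (ltW rn) h) _.
  by rewrite mulrA [r n * _]mulrCA divff ?mulr1// gt_eqF.
- exact: cvg_cst.
- have e : l = l * 1^-1 by rewrite invr1 mulr1.
  rewrite [X in _ --> X]e; apply: cvgMr.
  apply: cvgV; first exact: oner_neq0.
  by rewrite -[X in _ --> X]subr0; apply: cvgB => //; exact: cvg_cst.
Unshelve. all: by end_near. Qed.

Lemma crp_mittag_leffler a l : 0 < a < 1 -> 0 <= l ->
  (\sum_(j < n.+1) crp a n j * expR (- (j.+1%:R * (l / n.+1%:R `^ a))))
    @[n --> \oo] --> mittag_leffler a (- l).
Proof.
move=> /andP[a0 a1] l0.
pose r n : R := n.+1%:R `^ a.
have r0 n : 0 < r n by rewrite powR_gt0.
have ry : r n @[n --> \oo] --> +oo := natr_powR_cvgy a0.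
(* With y equal to this value, (1 + y)^(-(j + 1)) is exactly e^(-(j + 1) l / (n + 1)^a), so
   [crp_negbin] expands the Laplace transform without any error term. *)
pose m_ n := expR (l / r n) - 1.
have m0 n : 0 <= m_ n.
  by rewrite subr_ge0 -(expR0 R) ler_expR divr_ge0// ltW.
have rm : r n * m_ n @[n --> \oo] --> l by exact: expR_sub1_cvg.
(* The bound l + 1 leaves room above the limit l of [r n * m_ n]; asking [r n0] to exceed it gives
   both [m_ n < 1] for n >= n0 and the geometric ratio [q < 1]. *)
have [n0 [rn0 hn0]] : exists n0, l + 1 < r n0 /\
    forall n, (n0 <= n)%N -> r n * m_ n <= l + 1.
  have [N1 _ h1] : \forall n \near \oo, r n * m_ n <= l + 1.
    by apply: (cvgr_le l) => //; rewrite ltrDl.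
  have [N2 _ h2] : \forall n \near \oo, l + 1 < r n.
    by move/cvgryPgt : ry; apply.
  exists (maxn N1 N2); split; first by apply: h2; rewrite /= leq_maxr.
  by move=> n; rewrite geq_max => /andP[n1 _]; exact: h1.
have rmono n : (n0 <= n)%N -> r n0 <= r n.
  by move=> nn; apply: ge0_ler_powR; rewrite ?nnegrE ?ler_nat// ltW.
pose q := (l + 1) / r n0.
have q01 : 0 <= q < 1.
  by rewrite divr_ge0 ?(ltW (r0 _)) ?addr_ge0//= ltr_pdivrMr// mul1r.
have rV n m : n.+1%:R `^ (- (a * m%:R)) = (r n)^-1 ^+ m.
  rewrite powRN /r -powR_mulrn ?invr_ge0 ?powR_ge0// powRV ?powR_ge0//.
  by rewrite powRrM.
pose f n m := rprod (a * m%:R) n * (- m_ n) ^+ m.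
have fE n m : f n m = (- (r n * m_ n)) ^+ m * (rprod (a * m%:R) n * n.+1%:R `^ (- (a * m%:R))).
  rewrite /f rV mulrCA -exprMn mulNr mulrAC divff ?mul1r//.
  by rewrite gt_eqF.
pose g m := (- l) ^+ m * (gammar (a * m%:R))^-1.
(* At the fixed index [n0] the product [rprod m%:R n0] is polynomial in m, so the geometric factor
   makes the dominating series converge. *)
pose b m := 2 * n0.+1%:R * (rprod m%:R n0 * q ^+ m).
have am0 m : 0 <= a * m%:R by rewrite mulr_ge0// ltW.
have [] := @tannery f g b (fun n => \sum_(j < n.+1) crp a n j * (1 + m_ n) ^- j.+1) n0.
- move=> n m n0n; rewrite fE normrM normrX normrN.
  rewrite (ger0_norm (mulr_ge0 (ltW (r0 n)) (m0 n))).
  rewrite ger0_norm ?mulr_ge0 ?rprod_ge0 ?powR_ge0//.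
  apply: (@le_trans _ _ ((l + 1) ^+ m * (2 * n0.+1%:R * (rprod (a * m%:R) n0 * n0.+1%:R `^ (- (a * m%:R)))))).
    apply: ler_pM; rewrite ?exprn_ge0 ?mulr_ge0 ?rprod_ge0 ?powR_ge0 ?(ltW (r0 n))//.
      have h0 := mulr_ge0 (ltW (r0 n)) (m0 n).
      by apply: lerXn2r; [|rewrite nnegrE addr_ge0|exact: hn0].
    exact: rprod_powR_dom.
  rewrite mulrCA ler_wpM2l ?mulr_ge0// rV mulrCA -exprMn.
  rewrite ler_wpM2r ?exprn_ge0//; first by case/andP: q01.
  by apply: rprod_le; rewrite am0/= -[leRHS]mul1r ler_wpM2r// (ltW a1).
- rewrite (_ : series b = (fun M => 2 * n0.+1%:R * series (fun m => rprod m%:R n0 * q ^+ m) M)).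
    by apply: is_cvgMr; exact: negbin_cvg0.
  by apply/funext => M; rewrite /series/= mulr_sumr.
- move=> m; under eq_fun do rewrite fE.
  apply: cvgM; last exact: rprod_cvg.
  apply: (@continuous_cvg _ _ _ _ _ _ (fun x : R => x ^+ m)).
    exact: exprn_continuous.
  exact: cvgN.
- move=> n n0n; apply: crp_negbin; rewrite m0/=.
  have := hn0 n n0n; rewrite mulrC -ler_pdivlMr// => /le_lt_trans; apply.
  by rewrite ltr_pdivrMr// mul1r (lt_le_trans rn0)// rmono.
have -> : limn (series g) = mittag_leffler a (- l).
  congr (limn _); apply/funext => n; rewrite /series/= big_mkord.
  by apply: eq_bigr => k _; rewrite /g GammaD1 [a * _]mulrC.
move=> h _; apply: cvg_trans h; apply: near_eq_cvg; apply: nearW => n.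
apply: eq_bigr => j _; congr (_ * _).
by rewrite /m_ addrC subrK -mulrN expRM_natl expRN exprVn.
Qed.

End MittagLefflerLimit.

(** * Lebesgue measure on tuples and its invariances *)

Section ConsMeasure.
Variables (R : realType) (n : nat) (m : {sigma_finite_measure set (n.-tuple R) -> \bar R}).

Definition tcons (p : R * n.-tuple R) : n.+1.-tuple R := cons_tuple p.1 p.2.

Definition tuncons (t : n.+1.-tuple R) : R * n.-tuple R :=
  (tnth t ord0, [tuple of behead t]).

Lemma measurable_tcons : measurable_fun setT tcons.
Proof. exact: (measurable_cons measurable_fst measurable_snd). Qed.

Lemma measurable_tuncons : measurable_fun setT tuncons.
Proof.
by apply: measurable_fun_pair; [exact: measurable_tnth|exact: measurable_behead].
Qed.

Lemma tconsK : cancel tcons tuncons.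
Proof. by move=> [x t]; congr pair; apply: val_inj. Qed.

Lemma tunconsK : cancel tuncons tcons.
Proof. by move=> t; rewrite [RHS]tuple_eta; apply: val_inj. Qed.

(** Iterating this image of a product measure realises the iterated integral [iint] as integration
    against one sigma-finite measure, which Fubini and the convergence theorems require. *)
Definition cons_measure : set (n.+1.-tuple R) -> \bar R :=
  pushforward (@lebesgue_measure R \x m)%E tcons.

Let pm : {measure set (n.+1.-tuple R) -> \bar R} :=
  @measure_function_pushforward__canonical__measure_function_Measure _ _ _ _ _
    (@lebesgue_measure R \x m)%E tcons measurable_tcons.

HB.instance Definition _ := isMeasure.Build _ _ _ cons_measure
  (measure0 pm) (measure_ge0 pm) (@measure_semi_sigma_additive _ _ _ pm).

Let cons_measure_sigma_finite : sigma_finite setT cons_measure.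
Proof.
have /sigma_finiteP[F [TF ndF Foo]] := sigma_finiteT (@lebesgue_measure R).
have /sigma_finiteP[G [TG ndG Goo]] := sigma_finiteT m.
exists (fun k => tuncons @^-1` (F k `*` G k)).
  rewrite -preimage_bigcup (_ : \bigcup_k _ = setT) ?preimage_setT//.
  apply/seteqP; split=> // -[x y] _.
  have : (\bigcup_k F k) x by rewrite -TF.
  have : (\bigcup_k G k) y by rewrite -TG.
  move=> [k _ Gky] [i _ Fix]; exists (maxn i k) => //; split => /=.
    by move: x Fix; exact/subsetPset/ndF/leq_maxl.
  by move: y Gky; exact/subsetPset/ndG/leq_maxr.
move=> k; have [mF Fk] := Foo k; have [mG Gk] := Goo k; split.
  rewrite -[X in measurable X]setTI; apply: measurable_tuncons => //.
  exact: measurableX.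
rewrite /cons_measure /pushforward (_ : _ @^-1` _ = F k `*` G k).
  by rewrite product_measure1E// lte_mul_pinfty// ge0_fin_numE.
by apply/funext => p; rewrite /preimage /mkset tconsK.
Qed.

HB.instance Definition _ :=
  Measure_isSigmaFinite.Build _ _ _ cons_measure cons_measure_sigma_finite.

End ConsMeasure.

(** The point mass in dimension 0 matches the base case of [iint], which evaluates at the empty
    tuple. *)
Fixpoint lebn (R : realType) (n : nat) : {sigma_finite_measure set (n.-tuple R) -> \bar R} :=
  if n is n'.+1 then cons_measure (lebn R n') else \d_([tuple] : 0.-tuple R).

Section Lebn.
Variable R : realType.
Local Open Scope ereal_scope.
Implicit Types n : nat.

Lemma integral_lebn0 (f : 0.-tuple R -> \bar R) : \int[lebn R 0]_x f x = f [tuple].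
Proof.
rewrite /= integral_dirac//; first by rewrite diracT mul1e.
(* On a one-point space every preimage is empty or everything, so every function is measurable. *)
move=> _ B _; rewrite setTI.
have [fB|fB] := pselect (B (f [tuple])).
  rewrite (_ : _ @^-1` _ = setT)//; apply/seteqP; split => // x _ /=.
  by rewrite tuple0.
rewrite (_ : _ @^-1` _ = set0)//; apply/seteqP; split => // x /=.
by rewrite tuple0.
Qed.

Lemma ge0_integral_lebnS n (f : n.+1.-tuple R -> \bar R) :
  measurable_fun setT f -> (forall x, 0 <= f x) ->
  \int[lebn R n.+1]_x f x =
  \int[@lebesgue_measure R]_x \int[lebn R n]_t f (tcons (x, t)).
Proof.
move=> mf f0; rewrite /= /cons_measure ge0_integral_pushforward//; last first.
  exact: measurable_tcons.
rewrite preimage_setT fubini_tonelli1//; last by move=> x; exact: f0.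
by apply: measurableT_comp => //; exact: measurable_tcons.
Qed.

Lemma measurable_tcons1 n (x : R) : measurable_fun setT (fun t : n.-tuple R => tcons (x, t)).
Proof. by rewrite /tcons/=; apply: measurable_cons. Qed.

Lemma iintE n (f : n.-tuple R -> \bar R) :
  measurable_fun setT f -> (forall x, 0 <= f x) -> iint f = \int[lebn R n]_x f x.
Proof.
elim: n f => [|n IH] f mf f0; first by rewrite integral_lebn0.
rewrite ge0_integral_lebnS//=; apply: eq_integral => x _.
apply: IH => // ; apply: (measurableT_comp mf).
exact: measurable_cons.
Qed.

Lemma lebesgue_measureD (c : R) (A : set R) : measurable A ->
  pushforward (@lebesgue_measure R) (fun x : R => x + c : measurableTypeR R)%R A =
  lebesgue_measure A.
Proof.
have mD : measurable_fun setT (fun x : R => x + c : measurableTypeR R)%R.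
  by apply: measurable_funD.
move=> mA; apply/esym.
apply: (@lebesgue_measure_unique _ (@measure_function_pushforward__canonical__measure_function_Measure _ _ _ _ _
    (@lebesgue_measure R) _ mD)) => //= _ [[a b]] _ <-.
rewrite /pushforward.
rewrite (_ : _ @^-1` _ = `](a - c)%R, (b - c)%R]%classic); last first.
  by apply/seteqP; split => x /=; rewrite !in_itv/= ltrBlDr lerBrDr.
rewrite !lebesgue_measure_itv/= !lte_fin ltrD2r.
by case: ifP => // _; rewrite -!EFinD; congr EFin; ring.
Qed.

Lemma ge0_integral_subr (f : R -> \bar R) (y : R) :
  measurable_fun setT f -> (forall x, 0 <= f x) ->
  \int[@lebesgue_measure R]_x f (x - y)%R = \int[@lebesgue_measure R]_x f x.
Proof.
move=> mf f0.
have mD : measurable_fun setT (fun x : R => x - y : measurableTypeR R)%R.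
  by apply: measurable_funB.
transitivity (\int[pushforward (@lebesgue_measure R) (fun x : R => x - y : measurableTypeR R)%R]_x f x).
  by rewrite ge0_integral_pushforward.
by apply: eq_measure_integral => A mA _; exact: lebesgue_measureD.
Qed.

Lemma ge0_integral_oppr (f : R -> \bar R) :
  measurable_fun setT f -> (forall x, 0 <= f x) ->
  \int[@lebesgue_measure R]_x f (- x)%R = \int[@lebesgue_measure R]_x f x.
Proof.
move=> mf f0.
transitivity (\int[pushforward (@lebesgue_measure R) (-%R : _ -> measurableTypeR R)]_x f x).
  by rewrite ge0_integral_pushforward//; exact: oppr_measurable.
by apply: eq_measure_integral => A mA _; exact: lebesgue_measureN.
Qed.

Lemma measurable_vsub n :
  measurable_fun setT (fun p : n.-tuple R * n.-tuple R => vsub p.1 p.2).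
Proof.
apply/measurable_fun_tnthP => i /=.
rewrite (_ : _ \o _ = (fun p => tnth p.1 i - tnth p.2 i)%R); last first.
  by apply/funext => p /=; rewrite tnth_mktuple.
by apply: measurable_funB; apply: (measurableT_comp (measurable_tnth i)).
Qed.

Lemma measurable_vsub1 n (y : n.-tuple R) :
  measurable_fun setT (fun x => vsub x y).
Proof.
rewrite (_ : (fun x => _) = (fun p => vsub p.1 p.2) \o (fun x => (x, y)))//.
by apply: measurableT_comp; [exact: measurable_vsub|exact: measurable_fun_pair].
Qed.

Lemma measurable_vsub2 n (x : n.-tuple R) : measurable_fun setT (vsub x).
Proof.
rewrite (_ : vsub x = (fun p => vsub p.1 p.2) \o (fun y => (x, y)))//.
by apply: measurableT_comp; [exact: measurable_vsub|exact: measurable_fun_pair].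
Qed.

Lemma vsub_tcons n (x y : R) (s t : n.-tuple R) :
  vsub (tcons (x, s)) (tcons (y, t)) = tcons ((x - y)%R, vsub s t).
Proof.
apply: eq_from_tnth => i; rewrite tnth_mktuple.
by case: (unliftP ord0 i) => [j ->|->]; rewrite ?tnthS ?tnth0//= tnth_mktuple.
Qed.

Lemma ge0_integral_vsub n (f : n.-tuple R -> \bar R) (y : n.-tuple R) :
  measurable_fun setT f -> (forall x, 0 <= f x) ->
  \int[lebn R n]_x f (vsub x y) = \int[lebn R n]_x f x.
Proof.
elim: n f y => [|n IH] f y mf f0.
  by rewrite !integral_lebn0; congr f; rewrite tuple0.
rewrite -(tunconsK y); case: (tuncons y) => {}y t.
have mfy : measurable_fun setT (fun x => f (vsub x (tcons (y, t)))).
  exact: (measurableT_comp mf (measurable_vsub1 _)).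
rewrite (ge0_integral_lebnS mfy (fun x => f0 _)) (ge0_integral_lebnS mf f0).
have mc x : measurable_fun setT (fun t : n.-tuple R => f (tcons (x, t))).
  by apply: (measurableT_comp mf); exact: measurable_tcons1.
under eq_integral => x _.
  under eq_integral do rewrite vsub_tcons.
  rewrite (IH (fun u => f (tcons ((x - y)%R, u))))//; over.
rewrite (ge0_integral_subr (f := fun x => \int[lebn R n]_t0 f (tcons (x, t0))))//.
  apply: (measurable_fun_fubini_tonelli_F (f \o @tcons R n)) => //.
    by apply: measurableT_comp => //; exact: measurable_tcons.
  by move=> x; exact: f0.
by move=> x; apply: integral_ge0.
Qed.

Lemma ge0_integral_vsubl n (f : n.-tuple R -> \bar R) (x : n.-tuple R) :
  measurable_fun setT f -> (forall x, 0 <= f x) ->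
  \int[lebn R n]_y f (vsub x y) = \int[lebn R n]_y f y.
Proof.
elim: n f x => [|n IH] f x mf f0.
  by rewrite !integral_lebn0; congr f; rewrite tuple0.
rewrite -(tunconsK x); case: (tuncons x) => {}x t.
have mfx : measurable_fun setT (fun y => f (vsub (tcons (x, t)) y)).
  exact: (measurableT_comp mf (measurable_vsub2 _)).
rewrite (ge0_integral_lebnS mfx (fun y => f0 _)) (ge0_integral_lebnS mf f0).
have mc y : measurable_fun setT (fun t : n.-tuple R => f (tcons (y, t))).
  by apply: (measurableT_comp mf); exact: measurable_tcons1.
under eq_integral => y _.
  under eq_integral do rewrite vsub_tcons.
  rewrite (IH (fun u => f (tcons ((x - y)%R, u))))//; over.
pose g y := \int[lebn R n]_t0 f (tcons (y, t0)).
have mg : measurable_fun setT g.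
  apply: (measurable_fun_fubini_tonelli_F (f \o @tcons R n)) => //.
    by apply: measurableT_comp => //; exact: measurable_tcons.
  by move=> y; exact: f0.
have g0 y : 0 <= g y by apply: integral_ge0.
(* The substitution by x - y is a reflection combined with a translation. *)
rewrite -[RHS](ge0_integral_oppr mg g0).
have mgN : measurable_fun setT (fun y : R => g (- y)%R).
  exact: (measurableT_comp mg (@oppr_measurable R setT)).
rewrite -[RHS](ge0_integral_subr x mgN (fun y : R => g0 (- y)%R)).
by apply: eq_integral => y _; rewrite opprB.
Qed.

End Lebn.

(** * One-dimensional Gaussian integrals and their Fourier transform *)

Section GaussianFourier.
Variable R : realType.
Notation mu := (@lebesgue_measure R).
Implicit Types (c x z w : R).

Definition gexp c x : R := expR (- (c * x ^+ 2)).

Lemma gexp_ge0 c x : 0 <= gexp c x. Proof. exact: expR_ge0. Qed.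

Lemma continuous_gexp c : continuous (gexp c).
Proof.
move=> x; apply: (@continuous_comp _ _ _ (fun x => - (c * x ^+ 2)) expR); last exact: continuous_expR.
apply: (@continuousN _ R^o); apply: cvgM; first exact: cvg_cst.
exact: exprn_continuous.
Qed.

Lemma is_derive_gexp c x : is_derive x 1 (gexp c) (- (2 * c) * x * gexp c x).
Proof.
rewrite /gexp; apply: is_derive_eq; rewrite /GRing.scale/=.
by move: (expR _) => e; ring.
Qed.

Lemma measurable_gexp c : measurable_fun setT (gexp c).
Proof. by apply: continuous_measurable_fun; exact: continuous_gexp. Qed.

Lemma integral_gexp c : 0 < c ->
  (\int[mu]_x (gexp c x)%:E = (Num.sqrt (pi / c))%:E)%E.
Proof.
(* Up to normalisation this Gaussian is the normal density of variance 1 / (2 c). *)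
move=> c0; pose s := Num.sqrt (2 * c)^-1.
have c2 : 0 < (2 * c)^-1 by rewrite invr_gt0; lra.
have s0 : s != 0 by rewrite gt_eqF// sqrtr_gt0.
have s2 : s ^+ 2 = (2 * c)^-1 by rewrite sqr_sqrtr// ltW.
have := @integral_normal_pdf R 0 s.
have pE : normal_peak s = (Num.sqrt (pi / c))^-1.
  by rewrite /normal_peak s2; congr (Num.sqrt _)^-1; field; rewrite gt_eqF.
have p0 : 0 < Num.sqrt (pi / c) by rewrite sqrtr_gt0 divr_gt0// pi_gt0.
rewrite normal_pdfE//.
under eq_integral => x _.
  rewrite pE /normal_fun s2 subr0 EFinM.
  rewrite (_ : - x ^+ 2 / _ = - (c * x ^+ 2)); last by field; rewrite gt_eqF.
  over.
rewrite ge0_integralZl_EFin//; last first.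
  by apply/measurable_EFinP; exact: measurable_gexp.
move=> h; rewrite -[LHS]mul1e -(@divff _ (Num.sqrt (pi / c))) ?gt_eqF//.
by rewrite EFinM -muleA h mule1.
Qed.

Lemma integrable_gexp c : 0 < c -> mu.-integrable setT (EFin \o gexp c).
Proof.
move=> c0; apply/integrableP; split.
  by apply/measurable_EFinP; exact: measurable_gexp.
under eq_integral do rewrite /= ger0_norm ?gexp_ge0//.
by rewrite integral_gexp// ltry.
Qed.

Lemma integrable_norm_gexp c : 0 < c ->
  mu.-integrable setT (fun x => (`|x| * gexp c x)%:E).
Proof.
move=> c0; have c20 : 0 < c / 2 by lra.
have m : measurable_fun setT (fun x : R => `|x| * gexp c x).
  by apply: measurable_funM; [exact: normr_measurable|exact: measurable_gexp].
(* The domination is |x| <= 1 + x^2 <= (1 + 2 / c) (1 + c x^2 / 2) <= (1 + 2 / c) e^(c x^2 / 2),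
   which uses up half of the Gaussian. *)
apply: (@le_integrable _ _ _ mu setT measurableT _ (fun x => ((1 + 2 / c) * gexp (c / 2) x)%:E)).
- exact/measurable_EFinP.
- move=> x _ /=; rewrite lee_fin normrM normr_id (ger0_norm (gexp_ge0 _ _)).
  have c1 : 0 <= 1 + 2 / c by rewrite addr_ge0 ?divr_ge0 ?(ltW c0).
  rewrite (ger0_norm (mulr_ge0 c1 (gexp_ge0 (c / 2) x))).
  have -> : gexp c x = gexp (c / 2) x * gexp (c / 2) x.
    by rewrite /gexp -expRD; congr expR; field.
  rewrite mulrA ler_wpM2r ?gexp_ge0//.
  rewrite /gexp expRN ler_pdivrMr ?expR_gt0//.
  have h1 : `|x| <= 1 + x ^+ 2.
    by rewrite -real_normK ?num_real//; have := sqr_ge0 (`|x| - 1); have := normr_ge0 x; nra.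
  apply: (le_trans h1).
  apply: (@le_trans _ _ ((1 + 2 / c) * (1 + c / 2 * x ^+ 2))).
    have -> : (1 + 2 / c) * (1 + c / 2 * x ^+ 2) = 1 + x ^+ 2 + (2 / c + c / 2 * x ^+ 2).
      by field; rewrite gt_eqF.
    rewrite lerDl; apply: addr_ge0; first by rewrite divr_ge0 ?(ltW c0).
    by rewrite mulr_ge0 ?sqr_ge0 ?(ltW c20).
  rewrite ler_wpM2l ?addr_ge0 ?divr_ge0 ?(ltW c0)//.
  exact: expR_ge1Dx.
- by under eq_fun do rewrite EFinM; apply: integrableZl => //; exact: integrable_gexp.
Qed.

(** The fundamental theorem of calculus on growing symmetric intervals, with dominated convergence
    for the truncated integrals. *)
Lemma integral_derivative_eq0 (F f : R -> R) : continuous f ->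
  (forall x, is_derive x 1 F (f x)) -> mu.-integrable setT (EFin \o f) ->
  F n.+1%:R @[n --> \oo] --> (0 : R) -> F (- n.+1%:R) @[n --> \oo] --> (0 : R) ->
  (\int[mu]_x (f x)%:E = 0)%E.
Proof.
move=> cf Ff fi F1 F2.
pose f_ n := (EFin \o f) \_ (`[- n.+1%:R, n.+1%:R]%classic : set R).
have h : (\int[mu]_x f_ n x)%E @[n --> \oo] --> (\int[mu]_x (f x)%:E)%E.
  apply: (@dominated_cvg _ _ _ mu setT measurableT f_ _ (fun x => (`|f x|)%:E)).
  - move=> n; apply/(measurable_restrictT _ _).1 => //.
    by apply: measurable_funTS; exact: measurable_int fi.
  - move=> x _; apply: cvg_near_cst.
    exists (Num.bound `|x|) => // n /= xn; rewrite /f_ patchE mem_set//= in_itv/= -ler_norml.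
    apply: (@le_trans _ _ n%:R); last by rewrite ler_nat.
    by rewrite (le_trans (ltW (archi_boundP (normr_ge0 x))))// ler_nat.
  - by [].
  - exact: integrable_norm.
  - move=> n x _; rewrite /f_ patchE; case: ifPn => _ /=; first by [].
    by rewrite normr0 lee_fin.
have h0 : (\int[mu]_x f_ n x)%E @[n --> \oo] --> 0%E.
  under eq_fun => n.
    rewrite /f_ -integral_mkcond.
    rewrite (@continuous_FTC2 _ f F); first over.
    + by rewrite (@lt_trans _ _ 0)// oppr_lt0.
    + exact: continuous_subspaceT.
    + have cF x : {for x, continuous F}.
        by apply: differentiable_continuous; apply/derivable1_diffP; exact: ex_derive.
      split; first by move=> x _; exact: ex_derive.
        by apply/cvg_at_right_filter; exact: cF.
      by apply/cvg_at_left_filter; exact: cF.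
    + by move=> x _; rewrite derive1E derive_val.
  apply/fine_cvgP; split; first exact: nearW.
  by rewrite -[X in _ --> X](subr0 0); apply: cvgB.
rewrite -(cvg_lim (@ereal_hausdorff R) h).
exact: (cvg_lim (@ereal_hausdorff R) h0).
Qed.

Lemma cvg_gexp0 c (u : nat -> R) : 0 < c -> (forall n, n.+1%:R <= `|u n|) ->
  gexp c (u n) @[n --> \oo] --> (0 : R).
Proof.
move=> c0 hu.
apply: (@squeeze_cvgr _ _ _ _ (fun=> 0) (fun n => c^-1 * n.+1%:R^-1)).
- apply: nearW => n; rewrite gexp_ge0/= /gexp expRN -invfM.
  have u0 : 0 < `|u n| by apply: lt_le_trans (hu n).
  rewrite lef_pV2 ?posrE ?expR_gt0 ?mulr_gt0//.
  have u2 : n.+1%:R <= u n ^+ 2.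
    rewrite -real_normK ?num_real//; apply: (le_trans (hu n)).
    by rewrite expr2 -[leLHS]mulr1 ler_wpM2l// (le_trans _ (hu n))// ler1n.
  apply: (@le_trans _ _ (c * u n ^+ 2)); first by rewrite ler_wpM2l ?(ltW c0).
  by apply: le_trans (expR_ge1Dx _); rewrite lerDr.
- exact: cvg_cst.
- by rewrite -[X in _ --> X](mulr0 c^-1); apply: cvgMr; exact: cvg_harmonic.
Qed.

Lemma measurable_gexp_trig (t : R -> R) c : continuous t ->
  measurable_fun setT (fun w => gexp c w * t w).
Proof.
move=> ct; apply: measurable_funM; first exact: measurable_gexp.
exact: continuous_measurable_fun.
Qed.

Lemma integrable_gexp_bounded c (t : R -> R) : 0 < c -> measurable_fun setT t ->
  (forall x, `|t x| <= 1) -> mu.-integrable setT (fun w => (gexp c w * t w)%:E).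
Proof.
move=> c0 mt t1; apply: (le_integrable measurableT _ _ (integrable_gexp c0)).
  by apply/measurable_EFinP; apply: measurable_funM => //; exact: measurable_gexp.
move=> x _ /=; rewrite lee_fin normrM -[leRHS]mulr1.
by rewrite ler_wpM2l.
Qed.

Lemma continuous_cosM z : continuous (fun w : R => cos (z * w)).
Proof.
move=> w; apply: (@continuous_comp _ _ _ (fun w => z * w) cos).
  by apply: cvgM; [exact: cvg_cst|exact: cvg_id].
exact: continuous_cos.
Qed.

Lemma continuous_sinM z : continuous (fun w : R => sin (z * w)).
Proof.
move=> w; apply: (@continuous_comp _ _ _ (fun w => z * w) sin).
  by apply: cvgM; [exact: cvg_cst|exact: cvg_id].
exact: continuous_sin.
Qed.

(** The integrand is odd: reflection exchanges its positive and negative parts. *)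
Lemma integral_gexp_sin c z : 0 < c ->
  (\int[mu]_w (gexp c w * sin (z * w))%:E = 0)%E.
Proof.
move=> c0; have mg : measurable_fun setT (fun w => gexp c w * sin (z * w)).
  by apply: measurable_gexp_trig; exact: continuous_sinM.
rewrite integralE.
rewrite -(@ge0_integral_oppr R (fun w => (gexp c w * sin (z * w))%:E)^\+%E)//; last first.
  by apply: measurable_funepos; exact/measurable_EFinP.
rewrite [X in (X - _)%E](_ : _ = (\int[mu]_w ((fun w => (gexp c w * sin (z * w))%:E)^\- w)%E)%E).
  rewrite subee// ; apply: integrable_neg_fin_num => //.
  apply: integrable_gexp_bounded => //; last by move=> x; exact: sin_max.
  by apply: continuous_measurable_fun; exact: continuous_sinM.
apply: eq_integral => w _.
by rewrite funeposE funenegE /gexp sqrrN mulrN sinN mulrN EFinN.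
Qed.

Let psi c z := (\int[mu]_w (gexp c w * cos (z * w)))%R.

(** Differentiation under the integral produces the sine transform of w e^(-c w^2), and an
    integration by parts turns it back into [psi], which gives a linear differential equation in
    z. *)
Let psi_derive c z : 0 < c -> is_derive z 1 (psi c) (- (z / (2 * c)) * psi c z).
Proof.
move=> c0.
pose f z w := gexp c w * cos (z * w).
have derf z' w : is_derive z' 1 (f ^~ w) (- (w * gexp c w * sin (z' * w))).
  by apply: is_derive_eq; rewrite /GRing.scale/=; ring.
have d1 z' w : partial1of2 f z' w = - (w * gexp c w * sin (z' * w)).
  by rewrite partial1of2E derive_val.
have zI : z \in `]z - 1, z + 1[ by rewrite in_itv/=; apply/andP; split; lra.
have mcos z' : measurable_fun setT (fun w : R => cos (z' * w)).
  by apply: continuous_measurable_fun; exact: continuous_cosM.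
have msin z' : measurable_fun setT (fun w : R => sin (z' * w)).
  by apply: continuous_measurable_fun; exact: continuous_sinM.
have intf z' : z' \in `]z - 1, z + 1[ -> mu.-integrable setT (EFin \o f z').
  by move=> _; apply: integrable_gexp_bounded => // x; exact: cos_max.
have der z' (w : R) : z' \in `]z - 1, z + 1[ -> setT w -> derivable (f ^~ w) z' 1.
  by move=> _ _; exact: ex_derive.
have G0 w : 0 <= `|w| * gexp c w by rewrite mulr_ge0 ?gexp_ge0.
have Gub z' (w : R) : z' \in `]z - 1, z + 1[ -> setT w ->
    `|partial1of2 f z' w| <= `|w| * gexp c w.
  move=> _ _; rewrite d1 normrN !normrM (ger0_norm (gexp_ge0 _ _)).
  by rewrite -[leRHS]mulr1 ler_wpM2l// sin_max.
have hd := derivable_under_integral measurableT zI intf der G0 (integrable_norm_gexp c0) Gub.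
have he := differentiation_under_integral measurableT zI intf der G0 (integrable_norm_gexp c0) Gub.
apply: DeriveDef => //.
rewrite -derive1E; rewrite [LHS]he.
have intws : mu.-integrable setT (fun w => (w * gexp c w * sin (z * w))%:E).
  apply: (le_integrable measurableT _ _ (integrable_norm_gexp c0)).
    apply/measurable_EFinP; apply: measurable_funM => //.
      by apply: measurable_funM => //; exact: measurable_gexp.
    exact: msin.
  move=> w _ /=; rewrite lee_fin !normrM normr_id -[leRHS]mulr1.
  by rewrite ler_wpM2l// sin_max.
have intc : mu.-integrable setT (fun w => (gexp c w * cos (z * w))%:E).
  by apply: integrable_gexp_bounded => // x; exact: cos_max.
have cvg0 (u : nat -> R) : (forall n, n.+1%:R <= `|u n|) ->
    gexp c (u n) * sin (z * u n) @[n --> \oo] --> (0 : R).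
  move=> hu; apply/norm_cvg0P.
  apply: (@squeeze_cvgr _ _ _ _ (fun=> 0) (fun n => gexp c (u n))).
  - apply: nearW => n; rewrite normr_ge0 normrM (ger0_norm (gexp_ge0 _ _)).
    by rewrite -[leRHS]mulr1 ler_wpM2l ?gexp_ge0// sin_max.
  - exact: cvg_cst.
  - exact: cvg_gexp0.
(* [dF] is the derivative of [gexp c w * sin (z * w)], which vanishes at infinity; that its integral
   is 0 is the integration by parts. *)
pose dF w := (- (2 * c)) * (w * gexp c w * sin (z * w)) + z * (gexp c w * cos (z * w)).
have key : (\int[mu]_w (dF w)%:E = 0)%E.
  have h5 := @integral_derivative_eq0 (fun w => gexp c w * sin (z * w)) dF.
  apply h5.
  - move=> w; apply: cvgD; (apply: cvgM; first exact: cvg_cst).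
      apply: cvgM; last exact: continuous_sinM.
      by apply: cvgM; [exact: cvg_id|exact: continuous_gexp].
    by apply: cvgM; [exact: continuous_gexp|exact: continuous_cosM].
  - move=> w; have e1 := is_derive_gexp c w.
    have e2 : is_derive w 1 (fun w : R => sin (z * w)) (z * cos (z * w)).
      by apply: is_derive_eq; rewrite /GRing.scale/=; ring.
    have e3 := is_deriveM e1 e2.
    suff -> : dF w = gexp c w *: (z * cos (z * w)) +
      sin (z * w) *: (- (2 * c) * w * gexp c w) by exact: e3.
    rewrite /dF /GRing.scale/=.
    by move: (gexp c w) (sin _) (cos _) => g1 s1 c1; ring.
  - rewrite /comp/dF; under eq_fun do rewrite EFinD !(EFinM _ (_ * _)).
    by apply: integrableD => //; exact: integrableZl.
  - apply: cvg0 => n; exact: ler_norm.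
  - by apply: cvg0 => n; rewrite normrN; exact: ler_norm.
have fins := integrable_fin_num measurableT intws.
have finc := integrable_fin_num measurableT intc.
move: key; under eq_integral do rewrite /dF EFinD !(EFinM _ (_ * _)).
rewrite integralD//; [|exact: integrableZl|exact: integrableZl].
rewrite !integralZl// => key.
have {}key : - (2 * c) * (\int[mu]_w (w * gexp c w * sin (z * w))) + z * psi c z = 0.
  by apply: EFin_inj; rewrite EFinD !EFinM !fineK//; exact: key.
under eq_Rintegral do rewrite d1 -mulN1r.
rewrite RintegralZl// mulN1r.
move: key; move: (Rintegral _ _ _) (psi c z) => I p key.
have -> : I = z * p / (2 * c).
  have -> : z * p = 2 * c * I by lra.
  by field; rewrite gt_eqF.
by rewrite mulNr mulrAC.
Qed.

Let psi0 c : 0 < c -> psi c 0 = Num.sqrt (pi / c).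
Proof.
move=> c0; rewrite /psi /Rintegral.
under eq_integral do rewrite mul0r cos0 mulr1.
by rewrite integral_gexp.
Qed.

(** The product of [psi] with the reciprocal Gaussian e^(z^2 / (4 c)) has zero derivative, so it
    keeps its value at 0. *)
Let psiE c z : 0 < c -> psi c z = Num.sqrt (pi / c) * gexp (4 * c)^-1 z.
Proof.
move=> c0; pose h z := psi c z * expR (z ^+ 2 * (4 * c)^-1).
have hd x : is_derive x 1 h 0.
  have e1 := psi_derive x c0.
  have e2 : is_derive x 1 (fun x : R => expR (x ^+ 2 * (4 * c)^-1))
      (x / (2 * c) * expR (x ^+ 2 * (4 * c)^-1)).
    apply: is_derive_eq; rewrite /GRing.scale/=.
    by move: (expR _) => e; field; rewrite gt_eqF.
  have e3 := is_deriveM e1 e2.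
  suff -> : 0 = psi c x *: (x / (2 * c) * expR (x ^+ 2 * (4 * c)^-1)) +
    expR (x ^+ 2 * (4 * c)^-1) *: (- (x / (2 * c)) * psi c x) by exact: e3.
  by rewrite /GRing.scale/=; move: (expR _) (psi _ _) => e p; ring.
have := is_derive_0_is_cst z 0 hd.
rewrite /h psi0// expr0n/= mul0r expR0 mulr1 => <-.
by rewrite /gexp [_^-1 * _]mulrC -mulrA expRxMexpNx_1 mulr1.
Qed.

(** The one-dimensional heat kernel at time s. *)
Definition gk s x : R := (Num.sqrt (4 * pi * s))^-1 * gexp (4 * s)^-1 x.

Lemma gk_ge0 s x : 0 <= gk s x.
Proof. by rewrite mulr_ge0 ?invr_ge0 ?sqrtr_ge0 ?gexp_ge0. Qed.

Lemma measurable_gk s : measurable_fun setT (gk s).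
Proof. by apply: measurable_funM => //; exact: measurable_gexp. Qed.

Lemma integral_gk s : 0 < s -> (\int[mu]_x (gk s x)%:E = 1)%E.
Proof.
move=> s0; under eq_integral do rewrite EFinM.
have s4 : 0 < 4 * s by lra.
have p0 : 0 < pi :> R := pi_gt0 R.
rewrite ge0_integralZl_EFin//.
- rewrite integral_gexp ?invr_gt0// -EFinM invrK.
  rewrite (_ : pi * (4 * s) = 4 * pi * s); last by ring.
  by rewrite mulVf// gt_eqF// sqrtr_gt0 !mulr_gt0.
- by move=> x _; rewrite lee_fin gexp_ge0.
- by apply/measurable_EFinP; exact: measurable_gexp.
Qed.

Lemma integral_gexp_cos c z : 0 < c ->
  (\int[mu]_w (gexp c w * cos (z * w))%:E = (2 * pi * gk c z)%:E)%E.
Proof.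
move=> c0; rewrite -(@fineK _ (\int[mu]_w (gexp c w * cos (z * w))%:E)%E); last first.
  apply: integrable_fin_num => //; apply: integrable_gexp_bounded => //.
    by apply: continuous_measurable_fun; exact: continuous_cosM.
  by move=> x; exact: cos_max.
congr EFin; rewrite -[LHS]/(psi c z) psiE// /gk mulrA; congr (_ * _).
have p0 : 0 < pi :> R := pi_gt0 R.
have q0 : 0 < 4 * pi * c by rewrite !mulr_gt0.
apply: (@mulIf _ (Num.sqrt (4 * pi * c))); first by rewrite gt_eqF// sqrtr_gt0.
rewrite mulfVK ?gt_eqF ?sqrtr_gt0// -sqrtrM ?divr_ge0 ?ltW//.
rewrite (_ : pi / c * _ = (2 * pi) ^+ 2); last by field; rewrite gt_eqF.
by rewrite sqrtr_sqr ger0_norm// mulr_ge0// ltW.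
Qed.

End GaussianFourier.

(** * Heat kernels and the Gaussian Fourier transform in dimension n *)

Section GaussianFourierN.
Variable R : realType.
Implicit Types (n : nat) (c s : R).
Local Notation mu n := (lebn R n).

Lemma integral_lebnS n (f : n.+1.-tuple R -> \bar R) :
  (mu n.+1).-integrable setT f ->
  (\int[mu n.+1]_x f x =
   \int[@lebesgue_measure R]_x \int[mu n]_t f (tcons (x, t)))%E.
Proof.
move=> fi; have mf := measurable_int _ fi.
have mt := @measurable_tcons R n.
have fi' : ((@lebesgue_measure R) \x (mu n))%E.-integrable setT (f \o @tcons R n).
  apply/integrableP; split; first exact: measurableT_comp.
  case/integrableP : fi => _; rewrite /= /cons_measure ge0_integral_pushforward//.
  by apply: measurableT_comp.
rewrite /= /cons_measure integral_pushforward// preimage_setT.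
by rewrite -integral12_prod_meas1.
Qed.

Lemma integral_prod_tnth n (phi : R -> R) (K : R) :
  measurable_fun setT phi -> (forall x, 0 <= phi x) ->
  (\int[@lebesgue_measure R]_x (phi x)%:E = K%:E)%E ->
  (\int[mu n]_x (\prod_(i < n) phi (tnth x i))%:E = (K ^+ n)%:E)%E.
Proof.
move=> mphi phi0 phiK; elim: n => [|n IH].
  by rewrite integral_lebn0 big_ord0 expr0.
have mp m : measurable_fun setT (fun x : m.-tuple R => \prod_(i < m) phi (tnth x i)).
  apply: measurable_prod => i _; apply: measurableT_comp => //; exact: measurable_tnth.
have p0 m (x : m.-tuple R) : 0 <= \prod_(i < m) phi (tnth x i) by apply: prodr_ge0.
rewrite ge0_integral_lebnS; last 2 first.
- by apply/measurable_EFinP; exact: mp.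
- by move=> x; rewrite lee_fin.
transitivity (\int[@lebesgue_measure R]_x ((phi x)%:E * (K ^+ n)%:E))%E.
  apply: eq_integral => x _; rewrite -IH -ge0_integralZl_EFin//.
  - apply: eq_integral => t _; rewrite -EFinM; congr EFin.
    by rewrite big_ord_recl tnth0; congr (_ * _); apply: eq_bigr => i _; rewrite tnthS.
  - by move=> t _; rewrite lee_fin.
  - by apply/measurable_EFinP; exact: mp.
rewrite ge0_integralZr//.
- by rewrite phiK -EFinM exprS.
- exact/measurable_EFinP.
- by move=> x _; rewrite lee_fin.
- by rewrite lee_fin exprn_ge0// -lee_fin -phiK integral_ge0// => x _; rewrite lee_fin.
Qed.

(** The heat kernel of R^n. The product form makes its integrals factor; [gkNE] recovers the radial
    form. *)
Definition gkN n s (x : n.-tuple R) : R := \prod_(i < n) gk s (tnth x i).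

Lemma gkN_ge0 n s (x : n.-tuple R) : 0 <= gkN s x.
Proof. by apply: prodr_ge0 => i _; exact: gk_ge0. Qed.

Lemma measurable_gkN n s : measurable_fun setT (@gkN n s).
Proof.
apply: measurable_prod => i _; apply: measurableT_comp; first exact: measurable_gk.
exact: measurable_tnth.
Qed.

Lemma integral_gkN n s : 0 < s -> (\int[mu n]_x (gkN s x)%:E = 1)%E.
Proof.
move=> s0; rewrite (@integral_prod_tnth n (gk s) 1) ?expr1n//.
- exact: measurable_gk.
- exact: gk_ge0.
- exact: integral_gk.
Qed.

Definition gexpN n c (x : n.-tuple R) : R := expR (- (c * vnorm2 x)).

Lemma gexpN_ge0 n c (x : n.-tuple R) : 0 <= gexpN c x.
Proof. exact: expR_ge0. Qed.

Lemma gexpNE n c (x : n.-tuple R) : gexpN c x = \prod_(i < n) gexp c (tnth x i).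
Proof. by rewrite /gexpN /vnorm2 mulr_sumr -sumrN expR_sum. Qed.

Lemma gkNE n s (x : n.-tuple R) :
  gkN s x = (Num.sqrt (4 * pi * s)) ^- n * gexpN (4 * s)^-1 x.
Proof.
by rewrite /gkN /gk big_split/= prodr_const card_ord gexpNE exprVn.
Qed.

Lemma measurable_vdot n (z : n.-tuple R) : measurable_fun setT (@vdot R n z).
Proof.
rewrite /vdot; apply: measurable_sum => i.
by apply: measurable_funM => //; exact: measurable_tnth.
Qed.

Lemma measurable_vnorm2 n : measurable_fun setT (@vnorm2 R n).
Proof.
rewrite /vnorm2; apply: measurable_sum => i; apply: measurable_funX.
exact: measurable_tnth.
Qed.

Lemma measurable_gexpN n c : measurable_fun setT (@gexpN n c).
Proof.
apply: measurableT_comp => //; apply: measurableT_comp => //.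
by apply: measurable_funM => //; exact: measurable_vnorm2.
Qed.

Lemma integrable_gexpN n c : 0 < c -> (mu n).-integrable setT (EFin \o @gexpN n c).
Proof.
move=> c0; apply/integrableP; split.
  by apply/measurable_EFinP; exact: measurable_gexpN.
under eq_integral do rewrite /= ger0_norm ?gexpN_ge0// gexpNE.
rewrite (@integral_prod_tnth n (gexp c) (Num.sqrt (pi / c))) ?ltry//.
- exact: measurable_gexp.
- exact: gexp_ge0.
- exact: integral_gexp.
Qed.

Lemma vdot_tcons n (x y : R) (s t : n.-tuple R) :
  vdot (tcons (x, s)) (tcons (y, t)) = x * y + vdot s t.
Proof.
rewrite /vdot big_ord_recl !tnth0; congr (_ + _).
by apply: eq_bigr => i _; rewrite !tnthS.
Qed.

Lemma gexpN_tcons n c x (t : n.-tuple R) : gexpN c (tcons (x, t)) = gexp c x * gexpN c t.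
Proof.
by rewrite !gexpNE big_ord_recl tnth0; congr (_ * _); apply: eq_bigr => i _; rewrite tnthS.
Qed.

Lemma gkN_tcons n c x (t : n.-tuple R) : gkN c (tcons (x, t)) = gk c x * gkN c t.
Proof.
by rewrite /gkN big_ord_recl tnth0; congr (_ * _); apply: eq_bigr => i _; rewrite tnthS.
Qed.

Lemma integrable_gexpN_bounded n c (t : n.-tuple R -> R) : 0 < c ->
  measurable_fun setT t -> (forall x, `|t x| <= 1) ->
  (mu n).-integrable setT (fun w => (gexpN c w * t w)%:E).
Proof.
move=> c0 mt t1; apply: (le_integrable measurableT _ _ (integrable_gexpN n c0)).
  by apply/measurable_EFinP; apply: measurable_funM => //; exact: measurable_gexpN.
move=> x _ /=; rewrite lee_fin normrM -[leRHS]mulr1.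
by rewrite ler_wpM2l.
Qed.

Lemma measurable_cos_vdot n (z : n.-tuple R) : measurable_fun setT (fun w => cos (vdot z w)).
Proof.
apply: (measurableT_comp (continuous_measurable_fun (@continuous_cos R))).
exact: measurable_vdot.
Qed.

Lemma measurable_sin_vdot n (z : n.-tuple R) : measurable_fun setT (fun w => sin (vdot z w)).
Proof.
apply: (measurableT_comp (continuous_measurable_fun (@continuous_sin R))).
exact: measurable_vdot.
Qed.

(** Cosine and sine are treated together because the addition formulas mix them in the induction on
    n; every term with a sine vanishes by oddness in one variable. *)
Lemma integral_gexpN_trig n c (z : n.-tuple R) : 0 < c ->
  (\int[mu n]_w (gexpN c w * cos (vdot z w))%:E = ((2 * pi) ^+ n * gkN c z)%:E)%E /\
  (\int[mu n]_w (gexpN c w * sin (vdot z w))%:E = 0)%E.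
Proof.
move=> c0.
have ic m (u : m.-tuple R) := integrable_gexpN_bounded c0 (measurable_cos_vdot u) (fun=> cos_max _).
have isn m (u : m.-tuple R) := integrable_gexpN_bounded c0 (measurable_sin_vdot u) (fun=> sin_max _).
elim: n z => [|n IH] z.
  rewrite !integral_lebn0 /vdot !big_ord0 cos0 sin0 mulr0 mulr1 expr0 mul1r.
  by rewrite gexpNE /gkN !big_ord0.
rewrite !integral_lebnS ?ic ?isn// -(tunconsK z); case: (tuncons z) => {}z t.
have [IHc IHs] := IH t.
have e1 x : (\int[mu n]_w (gexpN c (tcons (x, w)) * cos (vdot (tcons (z, t)) (tcons (x, w))))%:E =
    (gexp c x * cos (z * x))%:E * ((2 * pi) ^+ n * gkN c t)%:E)%E.
  transitivity (\int[mu n]_w ((gexp c x * cos (z * x))%:E * (gexpN c w * cos (vdot t w))%:E -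
     (gexp c x * sin (z * x))%:E * (gexpN c w * sin (vdot t w))%:E))%E.
    apply: eq_integral => w _; rewrite -!EFinM -EFinB gexpN_tcons vdot_tcons cosD.
    by congr EFin; ring.
  rewrite integralB//; [|exact: integrableZl|exact: integrableZl].
  by rewrite !integralZl// IHc IHs mule0 sube0.
have e2 x : (\int[mu n]_w (gexpN c (tcons (x, w)) * sin (vdot (tcons (z, t)) (tcons (x, w))))%:E =
    (gexp c x * sin (z * x))%:E * ((2 * pi) ^+ n * gkN c t)%:E)%E.
  transitivity (\int[mu n]_w ((gexp c x * sin (z * x))%:E * (gexpN c w * cos (vdot t w))%:E +
     (gexp c x * cos (z * x))%:E * (gexpN c w * sin (vdot t w))%:E))%E.
    apply: eq_integral => w _; rewrite -!EFinM -EFinD gexpN_tcons vdot_tcons sinD.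
    by congr EFin; ring.
  rewrite integralD//; [|exact: integrableZl|exact: integrableZl].
  by rewrite !integralZl// IHc IHs mule0 adde0.
split.
  under eq_integral do rewrite e1.
  rewrite integralZr//; last first.
    apply: integrable_gexp_bounded => //; last by move=> x; exact: cos_max.
    by apply: continuous_measurable_fun; exact: continuous_cosM.
  by rewrite integral_gexp_cos// -EFinM gkN_tcons exprS; congr EFin; ring.
under eq_integral do rewrite e2.
rewrite integralZr//; last first.
  apply: integrable_gexp_bounded => //; last by move=> x; exact: sin_max.
  by apply: continuous_measurable_fun; exact: continuous_sinM.
by rewrite integral_gexp_sin// mul0e.
Qed.

End GaussianFourierN.

(** * Continuity of translations in L^1 of the line *)

Section TranslationContinuity.
Variable R : realType.
Local Open Scope ereal_scope.
Implicit Types n : nat.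
Local Notation leb := (@lebesgue_measure R).
Local Notation mu n := (lebn R n).

Lemma cvge0P (u : nat -> \bar R) : (forall k, 0 <= u k) ->
  u k @[k --> \oo] --> 0 <-> forall e : R, (0 < e)%R -> \forall k \near \oo, u k <= e%:E.
Proof.
move=> u0; split=> [uc e e0|H].
  have [uf /cvgrPdist_le/(_ _ e0) ue] := (fine_cvgP _ _).1 uc.
  near=> k; have uk : u k \is a fin_num by near: k.
  rewrite -(fineK uk) lee_fin -[leLHS]ger0_norm ?fine_ge0//.
  by rewrite -[X in `|X|%R]opprK normrN -sub0r; near: k.
apply/fine_cvgP; split.
  have := H 1%R ltr01; apply: filterS => k uk.
  by rewrite ge0_fin_numE// (le_lt_trans uk)// ltry.
apply/cvgrPdist_le => e e0; have := H e e0; apply: filterS => k uk.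
rewrite sub0r normrN ger0_norm ?fine_ge0// -lee_fin fineK//.
by rewrite ge0_fin_numE// (le_lt_trans uk)// ltry.
Unshelve. all: by end_near. Qed.

Definition tosc1 (f : R -> R) (h : R) : \bar R :=
  \int[leb]_x (`|f (x - h) - f x|%R)%:E.

Lemma measurable_shift (f : R -> R) (h : R) : measurable_fun setT f ->
  measurable_fun setT (fun x : R => f (x - h)%R).
Proof. by move=> mf; apply: measurableT_comp => //; apply: measurable_funB. Qed.

(** The error f - g enters at x and at x - h, and translation invariance gives both the same
    integral, hence the factor 2. This carries convergence over to L^1 limits. *)
Lemma tosc1_le (f g : R -> R) (h : R) : measurable_fun setT f -> measurable_fun setT g ->
  tosc1 f h <= tosc1 g h + 2%:E * \int[leb]_x (`|f x - g x|%R)%:E.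
Proof.
move=> mf mg.
have mfg : measurable_fun setT (fun x => (`|f x - g x|%R)%:E).
  by apply/measurable_EFinP; apply: measurableT_comp => //; exact: measurable_funB.
have e : 2%:E * \int[leb]_x (`|f x - g x|%R)%:E =
   \int[leb]_x (`|f (x - h) - g (x - h)|%R)%:E + \int[leb]_x (`|f x - g x|%R)%:E.
  rewrite (@ge0_integral_subr _ (fun x => (`|f x - g x|%R)%:E) h)//.
  by rewrite (_ : 2%:E = 1 + 1)// ge0_muleDl ?lee01// mul1e.
have mfh := measurable_shift h mf; have mgh := measurable_shift h mg.
have m1 : measurable_fun setT (fun x : R => (`|f (x - h) - g (x - h)|%R)%:E).
  by apply/measurable_EFinP; apply: measurableT_comp => //; exact: measurable_funB.
have m2 : measurable_fun setT (fun x : R => (`|g (x - h) - g x|%R)%:E).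
  by apply/measurable_EFinP; apply: measurableT_comp => //; exact: measurable_funB.
rewrite e /tosc1 -ge0_integralD// -ge0_integralD//; last 2 first.
- by move=> x _; rewrite adde_ge0.
- exact: emeasurable_funD.
apply: ge0_le_integral => //.
- by apply/measurable_EFinP; apply: measurableT_comp => //; exact: measurable_funB.
- by apply: emeasurable_funD => //; exact: emeasurable_funD.
move=> x _; rewrite -!EFinD lee_fin.
rewrite (_ : f (x - h) - f x = (g (x - h) - g x) +
   ((f (x - h) - g (x - h)) - (f x - g x)))%R; last by ring.
by apply: (le_trans (ler_normD _ _)); rewrite lerD2l ler_normB.
Qed.

Lemma tosc1_ub (f : R -> R) (h : R) : measurable_fun setT f ->
  tosc1 f h <= 2%:E * \int[leb]_x (`|f x|%R)%:E.
Proof.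
move=> mf; have := @tosc1_le f (fun=> 0%R) h mf (measurable_cst _).
rewrite {2}/tosc1; under [X in X + _]eq_integral do rewrite subrr normr0.
rewrite integral0 add0e; under [X in _ * X]eq_integral do rewrite subr0.
by [].
Qed.

Let tosc1_compact (F : R -> R) (B : R) (m : nat) (h : nat -> R) :
  continuous F -> (forall x, `|F x| <= B)%R -> (forall x, (m%:R < `|x|)%R -> F x = 0%R) ->
  (forall k, `|h k| <= 1)%R -> h k @[k --> \oo] --> (0 : R)%R ->
  tosc1 F (h k) @[k --> \oo] --> 0.
Proof.
move=> cF FB Fm h1 h0.
rewrite -[X in _ --> X](@integral0 _ _ _ leb setT).
pose I : set R := `[- m.+1%:R, m.+1%:R]%classic%R.
have mF : measurable_fun setT F by exact: continuous_measurable_fun.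
(* As |h k| <= 1, the function and its translates all vanish outside [-(m + 1), m + 1], where 2 B is
   an integrable bound. *)
apply: (@dominated_cvg _ _ _ leb setT measurableT _ _ (fun x => (2 * B * \1_I x)%:E)).
- move=> k; apply/measurable_EFinP; apply: measurableT_comp => //.
  by apply: measurable_funB => //; exact: measurable_shift.
- move=> x _; apply/fine_cvgP; split; first exact: nearW.
  rewrite -[X in _ --> X](normr0 R); apply: cvg_norm => /=.
  rewrite -(subrr (F x)); apply: cvgB; last exact: cvg_cst.
  apply: (continuous_cvg _ (cF x)).
  by rewrite -[X in _ --> X]subr0; apply: cvgB => //; exact: cvg_cst.
- by [].
- rewrite /=; under eq_fun do rewrite EFinM.
  apply: integrableZl => //; exact: integrable_indic_itv.
- move=> k x _ /=; rewrite lee_fin normr_id indicE.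
  have [xI|xI] := boolP (x \in I).
    by rewrite mulr1 (le_trans (ler_normB _ _))// mulr_natl mulr2n lerD.
  have mx : (m.+1%:R < `|x|)%R.
    rewrite ltNge; apply: contra xI => xm; rewrite inE /I /= in_itv/=.
    by rewrite -ler_norml.
  rewrite !Fm ?subrr ?normr0 ?mulr0//; first by rewrite (lt_trans _ mx)// ltr_nat.
  have h1k := h1 k.
  rewrite -(natr1 m) in mx.
  have : (`|x| <= `|x - h k| + `|h k|)%R by rewrite -[in leLHS](subrK (h k) x) ler_normD.
  by lra.
Qed.

(** Density of compactly supported continuous functions. Approximation on a bounded interval
    controls nothing outside of it, so a cut-off is applied to f before and to the approximant
    after. *)
Lemma tosc1_cvg (f : R -> R) (h : nat -> R) : leb.-integrable setT (EFin \o f) ->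
  (forall k, `|h k| <= 1)%R -> h k @[k --> \oo] --> (0 : R)%R ->
  tosc1 f (h k) @[k --> \oo] --> 0.
Proof.
move=> fi h1 h0.
have mf : measurable_fun setT f by apply/measurable_EFinP; exact: measurable_int fi.
have t0 g k : 0 <= tosc1 g (h k) by apply: integral_ge0 => x _; rewrite lee_fin.
suff H (e : R) : (0 < e)%R -> exists g : R -> R, [/\ measurable_fun setT g,
    tosc1 g (h k) @[k --> \oo] --> 0 & \int[leb]_x (`|f x - g x|%R)%:E <= e%:E].
  apply/cvge0P => // e e0.
  have e4 : (0 < e / 4)%R by rewrite divr_gt0.
  have [g [mg g0 fg]] := H _ e4.
  have e2 : (0 < e / 2)%R by rewrite divr_gt0.
  have := (cvge0P (t0 g)).1 g0 _ e2; apply: filterS => k gk.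
  apply: (le_trans (tosc1_le (h k) mf mg)).
  apply: (le_trans (leeD gk (lee_wpmul2l _ fg))); first by rewrite lee_fin.
  by rewrite -EFinM -EFinD lee_fin; lra.
move=> e0; have e2 : (0 < e / 2)%R by rewrite divr_gt0.
(* A continuous cut-off: 1 for |x| <= m, linear over the next unit, 0 beyond m + 1. *)
pose psi (m : nat) (x : R) : R := Num.min 1%R (Num.max 0%R (m.+1%:R - `|x|)%R).
have psi01 m x : (0 <= psi m x <= 1)%R.
  by rewrite /psi le_min ler01 le_max lexx ge_min lexx.
have psi_in m x : (`|x| <= m%:R)%R -> psi m x = 1%R.
  move=> xm; rewrite /psi min_l// le_max; apply/orP; right.
  by rewrite lerBrDr -natr1 addrC lerD2r.
have psi_out m x : (m.+1%:R < `|x|)%R -> psi m x = 0%R.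
  move=> xm; rewrite /psi max_l ?min_r// subr_le0; exact: ltW.
have cpsi m : continuous (psi m).
  move=> x; rewrite (_ : psi m = ((fun=> 1%R) \min
    ((fun=> 0%R) \max (fun x : R => (m.+1%:R - `|x|)%R : R^o)) : R -> R^o)%R)//.
  apply: continuous_min; first exact: cvg_cst.
  apply: continuous_max; first exact: cvg_cst.
  by apply: cvgB; [exact: cvg_cst|exact: norm_continuous].
have mpsi m : measurable_fun setT (psi m) by exact: continuous_measurable_fun.
have mfp m : measurable_fun setT (fun x => f x * psi m x)%R.
  exact: measurable_funM mf (mpsi m).
have md m : measurable_fun setT (fun x => (`|f x - f x * psi m x|%R)%:E).
  apply/measurable_EFinP; apply: measurableT_comp; first by [].
  exact: measurable_funB mf (mfp m).
have [m hm] : exists m, \int[leb]_x (`|f x - f x * psi m x|%R)%:E <= (e / 2)%:E.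
  have : (\int[leb]_x (`|f x - f x * psi m x|%R)%:E) @[m --> \oo] --> 0.
    rewrite -[X in _ --> X](@integral0 _ _ _ leb setT).
    apply: (@dominated_cvg _ _ _ leb setT measurableT _ _ (fun x => (`|f x|%R)%:E)).
    - by move=> k; exact: md.
    - move=> x _; apply: cvg_near_cst.
      exists (Num.bound `|x|%R) => // n /= xn; rewrite psi_in ?mulr1 ?subrr ?normr0//.
      by rewrite (le_trans (ltW (archi_boundP (normr_ge0 x))))// ler_nat.
    - by [].
    - exact: integrable_norm.
    - move=> k x _ /=; rewrite lee_fin normr_id -{1}[f x]mulr1 -mulrBr normrM.
      rewrite -[leRHS]mulr1 ler_wpM2l// ger0_norm; case/andP: (psi01 k x) => p0 p1; lra.
  move/cvge0P => H; have [|N _ HN] := H _ _ e2.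
    by move=> k; apply: integral_ge0 => x _; rewrite lee_fin.
  by exists N; apply: HN => /=.
pose E : set R := `[- m.+1%:R, m.+1%:R]%classic%R.
have mE : measurable E by exact: measurable_itv.
have Eoo : leb E < +oo by rewrite lebesgue_measure_itv/=; case: ifP => _; rewrite -?EFinB ltry.
have fiE : leb.-integrable E (EFin \o f) by apply: integrableS fi.
have [g_ [cg gi /cvge0P H]] := approximation_continuous_integrable mE Eoo fiE.
have [|N _ HN] := H _ _ e2; first by move=> k; apply: integral_ge0.
have {HN} := HN N (leqnn N); set g := g_ N => fg.
pose F x := (g x * psi m x)%R.
have cF : continuous F by move=> x; apply: cvgM; [exact: cg|exact: cpsi].
have F0 x : (m.+1%:R < `|x|)%R -> F x = 0%R by move=> xm; rewrite /F psi_out// mulr0.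
have [B FB] : exists B, forall x, (`|F x| <= B)%R.
  have mm : (- m.+1%:R <= m.+1%:R :> R)%R by rewrite (@le_trans _ _ 0%R)// oppr_le0.
  have cnF : {within `[(- m.+1%:R)%R, m.+1%:R%R], continuous (fun x => `|F x|%R)}.
    by apply: continuous_subspaceT => x; apply: cvg_norm; exact: cF.
  have [c _ hc] := EVT_max mm cnF.
  exists `|F c|%R => x; have [xm|xm] := leP `|x|%R m.+1%:R.
    by apply: hc; rewrite in_itv/= -ler_norml.
  by rewrite F0// normr0.
have mg : measurable_fun setT g by apply: continuous_measurable_fun; exact: cg.
have mF : measurable_fun setT F by exact: continuous_measurable_fun.
exists F; split=> //; first exact: (@tosc1_compact F B m.+1).
have m2 : measurable_fun setT (fun x => (`|f x * psi m x - F x|%R)%:E).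
  apply/measurable_EFinP; apply: measurableT_comp; first by [].
  exact: measurable_funB (mfp m) mF.
have h2 : \int[leb]_x (`|f x * psi m x - F x|%R)%:E <= (e / 2)%:E.
  apply: le_trans fg; rewrite [leRHS]integral_mkcond.
  apply: ge0_le_integral => //.
  - apply/(measurable_restrictT _ _).1 => //.
    apply: measurableT_comp => //; apply/measurable_EFinP.
    by apply: measurable_funTS; apply: measurable_funB.
  move=> x _; rewrite patchE; case: ifPn => xE.
    rewrite lee_fin /F -mulrBl normrM -[leRHS]mulr1 ler_wpM2l//.
    by case/andP: (psi01 m x) => p0 p1; rewrite ger0_norm.
  rewrite F0 ?psi_out ?mulr0 ?subrr ?normr0//.
    by rewrite ltNge; apply: contra xE => xm; rewrite inE /E /= in_itv/= -ler_norml.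
  by rewrite ltNge; apply: contra xE => xm; rewrite inE /E /= in_itv/= -ler_norml.
have -> : e = (e / 2 + e / 2)%R by lra.
rewrite EFinD; apply: le_trans (leeD hm h2).
rewrite -ge0_integralD//; last exact: md.
apply: ge0_le_integral => //.
- by apply/measurable_EFinP; apply: measurableT_comp => //; exact: measurable_funB.
- by apply: emeasurable_funD; [exact: md|exact: m2].
by move=> x _; rewrite -EFinD lee_fin ler_distD.
Qed.

End TranslationContinuity.

(** * Continuity of translations in L^1 of R^n *)

Section TranslationContinuityN.
Variable R : realType.
Local Open Scope ereal_scope.
Implicit Types n : nat.
Local Notation leb := (@lebesgue_measure R).
Local Notation mu n := (lebn R n).

Definition toscN n (f : n.-tuple R -> R) (y : n.-tuple R) : \bar R :=
  \int[mu n]_x (`|f (vsub x y) - f x|%R)%:E.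

Lemma toscN_ge0 n (f : n.-tuple R -> R) y : 0 <= toscN f y.
Proof. by apply: integral_ge0 => x _; rewrite lee_fin. Qed.

Lemma toscN_ub n (f : n.-tuple R -> R) (y : n.-tuple R) : measurable_fun setT f ->
  toscN f y <= 2%:E * \int[mu n]_x (`|f x|%R)%:E.
Proof.
move=> mf.
have mn : measurable_fun setT (fun x => (`|f x|%R)%:E).
  by apply/measurable_EFinP; apply: measurableT_comp.
have mfy : measurable_fun setT (fun x => f (vsub x y)).
  by apply: measurableT_comp => //; exact: measurable_vsub1.
have mny : measurable_fun setT (fun x => (`|f (vsub x y)|%R)%:E).
  by apply/measurable_EFinP; apply: measurableT_comp.
have -> : 2%:E * \int[mu n]_x (`|f x|%R)%:E =
   \int[mu n]_x (`|f (vsub x y)|%R)%:E + \int[mu n]_x (`|f x|%R)%:E.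
  rewrite (@ge0_integral_vsub _ _ (fun x => (`|f x|%R)%:E) y)//.
  by rewrite (_ : 2%:E = 1 + 1)// ge0_muleDl ?lee01// mul1e.
rewrite -ge0_integralD//; apply: ge0_le_integral => //.
- by apply/measurable_EFinP; apply: measurableT_comp => //; exact: measurable_funB.
- exact: emeasurable_funD.
by move=> x _; rewrite -EFinD lee_fin ler_normB.
Qed.

Section Step.
Variables (n : nat) (f : n.+1.-tuple R -> R).
Hypothesis fi : (mu n.+1).-integrable setT (EFin \o f).

Let F (p : R * n.-tuple R) : R := f (tcons p).

Let mf : measurable_fun setT f.
Proof. by apply/measurable_EFinP; exact: measurable_int fi. Qed.

Let mF : measurable_fun setT F.
Proof. by apply: measurableT_comp => //; exact: measurable_tcons. Qed.

Let Fi : (leb \x mu n).-integrable setT (EFin \o F).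
Proof.
apply/integrableP; split; first exact/measurable_EFinP.
case/integrableP : fi => _; rewrite /= /cons_measure ge0_integral_pushforward//.
- exact: measurable_tcons.
- by apply/measurable_EFinP; apply: measurableT_comp.
Qed.

Let mshift (h : R) (s : n.-tuple R) :
  measurable_fun setT (fun p : R * n.-tuple R => (p.1 - h, vsub p.2 s)%R).
Proof.
apply: measurable_fun_pair.
  by apply: measurable_funB => //; exact: measurable_fst.
by apply: (measurableT_comp (measurable_vsub1 s)); exact: measurable_snd.
Qed.

Let mdiff (g1 g2 : R * n.-tuple R -> R) : measurable_fun setT g1 -> measurable_fun setT g2 ->
  measurable_fun setT (fun p => (`|g1 p - g2 p|%R)%:E).
Proof.
move=> m1 m2; apply/measurable_EFinP; apply: measurableT_comp; first by [].
exact: measurable_funB m1 m2.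
Qed.

(** The shift is made one coordinate at a time. In the first term the remaining coordinates are
    already shifted by [s], which translation invariance in t undoes. *)
Lemma toscN_step (h : R) (s : n.-tuple R) : toscN f (tcons (h, s)) <=
  \int[mu n]_t tosc1 (fun x => F (x, t)) h + \int[leb]_x toscN (fun t => F (x, t)) s.
Proof.
have mFs : measurable_fun setT (fun p : R * n.-tuple R => F (p.1 - h, vsub p.2 s)%R).
  exact: measurableT_comp mF (mshift h s).
have mFh : measurable_fun setT (fun p : R * n.-tuple R => F (p.1 - h, p.2)%R).
  apply: (measurableT_comp mF); apply: measurable_fun_pair; last exact: measurable_snd.
  by apply: measurable_funB => //; exact: measurable_fst.
have mF1 : measurable_fun setT (fun p : R * n.-tuple R => F (p.1, vsub p.2 s)).
  apply: (measurableT_comp mF); apply: measurable_fun_pair; first exact: measurable_fst.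
  by apply: (measurableT_comp (measurable_vsub1 s)); exact: measurable_snd.
have m1 := mdiff mFs mF1; have m2 := mdiff mF1 mF; have m3 := mdiff mFs mF.
have m4 := mdiff mFh mF.
have -> : toscN f (tcons (h, s)) =
    \int[leb \x mu n]_p (`|F (p.1 - h, vsub p.2 s) - F p|%R)%:E.
  rewrite /toscN ge0_integral_lebnS.
  - rewrite (@fubini_tonelli1 _ _ _ _ _ leb (mu n) _ m3 (fun=> normr_ge0 _)).
    apply: eq_integral => x _; apply: eq_integral => t _.
    by rewrite vsub_tcons.
  - apply/measurable_EFinP; apply: measurableT_comp; first by [].
    apply: measurable_funB => //.
    by apply: measurableT_comp => //; exact: measurable_vsub1.
  - by move=> x; rewrite lee_fin.
have -> : \int[mu n]_t tosc1 (fun x => F (x, t)) h =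
    \int[leb \x mu n]_p (`|F (p.1 - h, vsub p.2 s) - F (p.1, vsub p.2 s)|%R)%:E.
  rewrite fubini_tonelli1//.
  transitivity (\int[leb]_x \int[mu n]_t (`|F (x - h, t)%R - F (x, t)|%R)%:E).
    have := @fubini_tonelli _ _ _ _ _ leb (mu n)
      (fun p : R * n.-tuple R => (`|F (p.1 - h, p.2)%R - F p|%R)%:E).
    by move=> <-// p; rewrite lee_fin.
  apply: eq_integral => x _; apply/esym.
  apply: (@ge0_integral_vsub _ _ (fun t => (`|F (x - h, t)%R - F (x, t)|%R)%:E) s).
    exact: (measurableT_comp m4 (pair1_measurable x)).
  by move=> t; rewrite lee_fin.
have -> : \int[leb]_x toscN (fun t => F (x, t)) s =
    \int[leb \x mu n]_p (`|F (p.1, vsub p.2 s) - F p|%R)%:E.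
  by rewrite fubini_tonelli1.
rewrite -ge0_integralD//; apply: ge0_le_integral => //.
- exact: emeasurable_funD.
by move=> p _; rewrite -EFinD lee_fin ler_distD.
Qed.

(** Almost every slice of an integrable function is integrable, so both terms of [toscN_step] tend
    to 0 slice by slice, dominated by twice the norm of the slice. *)
Lemma toscN_step_cvg (h : nat -> R) (s : nat -> n.-tuple R) :
  (forall g : n.-tuple R -> R, (mu n).-integrable setT (EFin \o g) ->
    toscN g (s k) @[k --> \oo] --> 0) ->
  (forall k, `|h k| <= 1)%R -> h k @[k --> \oo] --> (0 : R)%R ->
  toscN f (tcons (h k, s k)) @[k --> \oo] --> 0.
Proof.
move=> IH h1 h0.
have nF : measurable_fun setT (fun p => (`|F p|%R)%:E).
  by apply/measurable_EFinP; apply: measurableT_comp.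
have nFi : \int[leb \x mu n]_p (`|F p|%R)%:E < +oo by case/integrableP : Fi.
have A1 : (\int[mu n]_t tosc1 (fun x => F (x, t)) (h k)) @[k --> \oo] --> 0.
  have [] := @dominated_convergence _ _ _ (mu n) setT measurableT
    (fun k t => tosc1 (fun x => F (x, t)) (h k)) (cst 0)
    (fun t => 2%:E * \int[leb]_x (`|F (x, t)|%R)%:E).
  - move=> k.
    apply: (@measurable_fun_fubini_tonelli_G _ _ _ _ _ leb (fun p : R * n.-tuple R => (`|F (p.1 - h k, p.2)%R - F p|%R)%:E)).
      apply: mdiff => //.
      apply: (measurableT_comp mF); apply: measurable_fun_pair; last exact: measurable_snd.
      by apply: measurable_funB => //; exact: measurable_fst.
    by move=> x; rewrite lee_fin.
  - exact: measurable_cst.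
  - have := ae_integrable2 Fi; apply: filterS => t ti _; exact: tosc1_cvg.
  - apply: integrableZl => //; apply/integrableP; split.
      by apply: (@measurable_fun_fubini_tonelli_G _ _ _ _ _ leb (fun p => (`|F p|%R)%:E)) => // x; rewrite lee_fin.
    under eq_integral do rewrite gee0_abs ?integral_ge0//.
    by have := @fubini_tonelli2 _ _ _ _ _ leb (mu n) (fun p => (`|F p|%R)%:E) nF (fun=> normr_ge0 _); move=> e; apply: le_lt_trans nFi; rewrite e.
  - apply: aeW => t k _; rewrite gee0_abs; last by apply: integral_ge0.
    by apply: tosc1_ub; exact: (measurableT_comp mF (pair2_measurable t)).
  by move=> _ _; rewrite integral0.
have A2 : (\int[leb]_x toscN (fun t => F (x, t)) (s k)) @[k --> \oo] --> 0.
  have [] := @dominated_convergence _ _ _ leb setT measurableT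
    (fun k x => toscN (fun t => F (x, t)) (s k)) (cst 0)
    (fun x => 2%:E * \int[mu n]_t (`|F (x, t)|%R)%:E).
  - move=> k.
    apply: (@measurable_fun_fubini_tonelli_F _ _ _ _ _ (mu n) (fun p : R * n.-tuple R => (`|F (p.1, vsub p.2 (s k)) - F p|%R)%:E)).
      apply: mdiff => //.
      apply: (measurableT_comp mF); apply: measurable_fun_pair; first exact: measurable_fst.
      by apply: (measurableT_comp (measurable_vsub1 (s k))); exact: measurable_snd.
    by move=> x; rewrite lee_fin.
  - exact: measurable_cst.
  - by have := ae_integrable1 Fi; apply: filterS => x xi _; exact: IH.
  - apply: integrableZl => //; apply/integrableP; split.
      by apply: (@measurable_fun_fubini_tonelli_F _ _ _ _ _ (mu n) (fun p => (`|F p|%R)%:E)) => // x; rewrite lee_fin.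
    under eq_integral do rewrite gee0_abs ?integral_ge0//.
    by have := @fubini_tonelli1 _ _ _ _ _ leb (mu n) (fun p => (`|F p|%R)%:E) nF (fun=> normr_ge0 _); move=> e; apply: le_lt_trans nFi; rewrite e.
  - apply: aeW => x k _; rewrite gee0_abs; last exact: toscN_ge0.
    by apply: toscN_ub; exact: (measurableT_comp mF (pair1_measurable x)).
  by move=> _ _; rewrite integral0.
apply: (@squeeze_cvge _ _ _ _ (cst 0) _ (fun k =>
  \int[mu n]_t tosc1 (fun x => F (x, t)) (h k) + \int[leb]_x toscN (fun t => F (x, t)) (s k))).
- by apply: nearW => k; rewrite toscN_ge0/= toscN_step.
- exact: cvg_cst.
- by rewrite -[X in _ --> X]add0e; apply: cvgeD.
Qed.

End Step.

Lemma toscN_cvg n (f : n.-tuple R -> R) (y : nat -> n.-tuple R) :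
  (mu n).-integrable setT (EFin \o f) ->
  (forall k i, `|tnth (y k) i| <= 1)%R ->
  (forall i, tnth (y k) i @[k --> \oo] --> (0 : R)%R) ->
  toscN f (y k) @[k --> \oo] --> 0.
Proof.
elim: n f y => [|n IH] f y fi y1 y0.
  rewrite /toscN; under eq_fun do rewrite integral_lebn0 (tuple0 (vsub _ _)) subrr normr0.
  exact: cvg_cst.
have yE k : y k = tcons (tuncons (y k)) by rewrite tunconsK.
under eq_fun do rewrite yE.
apply: (@toscN_step_cvg n f fi (fun k => (tuncons (y k)).1) (fun k => (tuncons (y k)).2)).
- move=> g gi; apply: IH => // [k i|i].
    by have := y1 k (lift ord0 i); rewrite [y k in X in X -> _]yE tnthS.
  by have := y0 (lift ord0 i); under eq_fun do rewrite yE tnthS.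
- by move=> k; exact: y1.
- exact: y0.
Qed.

End TranslationContinuityN.

(** * Convergence in L^1 of Gaussian mollifications *)

Lemma measurable_integral_snd d1 d2 (T1 : measurableType d1) (T2 : measurableType d2) (R : realType)
  (m : {sigma_finite_measure set T2 -> \bar R}) (f : T1 * T2 -> \bar R) :
  measurable_fun setT f -> measurable_fun setT (fun x => \int[m]_y f (x, y))%E.
Proof.
move=> mf; under eq_fun do rewrite integralE.
apply: emeasurable_funB.
  rewrite (_ : (fun x => _) = fun x => \int[m]_y (f^\+)%E (x, y))%E; last first.
    by apply/funext => x; apply: eq_integral => y _; rewrite !funeposE.
  apply: measurable_fun_fubini_tonelli_F; last by move=> p; exact: funepos_ge0.
  exact: measurable_funepos.
rewrite (_ : (fun x => _) = fun x => \int[m]_y (f^\-)%E (x, y))%E; last first.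
  by apply/funext => x; apply: eq_integral => y _; rewrite !funenegE.
apply: measurable_fun_fubini_tonelli_F; last by move=> p; exact: funeneg_ge0.
exact: measurable_funeneg.
Qed.

Section Mollification.
Variable R : realType.
Local Open Scope ereal_scope.
Implicit Types n : nat.
Local Notation mu n := (lebn R n).

Lemma vnorm2_ge0 n (x : n.-tuple R) : (0 <= vnorm2 x)%R.
Proof. by apply: sumr_ge0 => i _; exact: sqr_ge0. Qed.

Lemma sqr_tnth_le_vnorm2 n (x : n.-tuple R) i : (tnth x i ^+ 2 <= vnorm2 x)%R.
Proof.
rewrite /vnorm2 (bigD1 i)//= lerDl; apply: sumr_ge0 => j _; exact: sqr_ge0.
Qed.

(** From sequential continuity to a uniform radius: otherwise a sequence of bad shifts would tend to
    0. *)
Lemma toscN_small n (f : n.-tuple R -> R) (e : R) :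
  (mu n).-integrable setT (EFin \o f) -> (0 < e)%R ->
  exists2 r : R, (0 < r)%R & forall y, (vnorm2 y <= r)%R -> toscN f y <= e%:E.
Proof.
move=> fi e0; apply: contrapT => H.
have {}H k : exists y : n.-tuple R, (vnorm2 y <= k.+1%:R^-1)%R /\ ~ toscN f y <= e%:E.
  apply: contrapT => nH; apply: H; exists (k.+1%:R^-1)%R; first by rewrite invr_gt0 ltr0n.
  by move=> y yk; apply: contrapT => ne; apply: nH; exists y.
have [y hy] := choice H.
have yk k i : (tnth (y k) i ^+ 2 <= k.+1%:R^-1)%R.
  by apply: le_trans (sqr_tnth_le_vnorm2 _ _) _; exact: (hy k).1.
have : toscN f (y k) @[k --> \oo] --> 0.
  apply: toscN_cvg => // [k i|i].
    rewrite -(@ler_pXn2r _ 2)// ?nnegrE// expr1n real_normK ?num_real//.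
    by rewrite (le_trans (yk k i))// invf_le1// ler1n.
  apply/cvgr0Pnorm_le => d d0.
  have d2 : (0 < d ^+ 2)%R by rewrite exprn_gt0.
  near=> k; rewrite -(@ler_pXn2r _ 2)// ?nnegrE ?(ltW d0)// real_normK ?num_real//.
  apply: (le_trans (yk k i)); near: k.
  have := near_infty_natSinv_lt (PosNum d2); apply: filterS => k /= kd; exact: ltW.
move/cvge0P => h; have [|N _ HN] := h _ _ e0; first by move=> k; exact: toscN_ge0.
by have := (hy N).2; apply; apply: HN => /=.
Unshelve. all: by end_near. Qed.

Lemma integral_vsubl n (f : n.-tuple R -> \bar R) (x : n.-tuple R) :
  measurable_fun setT f -> \int[mu n]_y f (vsub x y) = \int[mu n]_y f y.
Proof.
move=> mf; rewrite integralE [RHS]integralE; congr (_ - _).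
  by rewrite -(ge0_integral_vsubl (f := f^\+) x)//; [apply: eq_integral => z _; rewrite !funeposE|exact: measurable_funepos].
by rewrite -(ge0_integral_vsubl (f := f^\-) x)//; [apply: eq_integral => z _; rewrite !funenegE|exact: measurable_funeneg].
Qed.

Lemma integrable_vsub n (f : n.-tuple R -> R) (y : n.-tuple R) :
  (mu n).-integrable setT (EFin \o f) -> (mu n).-integrable setT (EFin \o (fun x => f (vsub x y))).
Proof.
case/integrableP => mf fi; apply/integrableP; split.
  exact: (measurableT_comp mf (measurable_vsub1 y)).
by rewrite (ge0_integral_vsub (f := fun x => `|(EFin \o f) x|))//; exact: measurableT_comp.
Qed.

Lemma integrable_vsubl n (f : n.-tuple R -> R) (x : n.-tuple R) :
  (mu n).-integrable setT (EFin \o f) -> (mu n).-integrable setT (EFin \o (fun y => f (vsub x y))).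
Proof.
case/integrableP => mf fi; apply/integrableP; split.
  exact: (measurableT_comp mf (measurable_vsub2 x)).
by rewrite (ge0_integral_vsubl (f := fun x => `|(EFin \o f) x|))//; exact: measurableT_comp.
Qed.

Lemma vsubK n (x y : n.-tuple R) : vsub x (vsub x y) = y.
Proof. by apply: eq_from_tnth => i; rewrite !tnth_mktuple subKr. Qed.

Lemma gexpN_le1 n (c : R) (x : n.-tuple R) : (0 <= c)%R -> (gexpN c x <= 1)%R.
Proof.
by move=> c0; rewrite /gexpN -expR0 ler_expR oppr_le0 mulr_ge0 ?vnorm2_ge0.
Qed.

Lemma gkN_le n (s : R) (x : n.-tuple R) : (0 < s)%R ->
  (gkN s x <= Num.sqrt (4 * pi * s) ^- n)%R.
Proof.
move=> s0; rewrite gkNE -[leRHS]mulr1 ler_wpM2l ?invr_ge0 ?exprn_ge0 ?sqrtr_ge0//.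
by rewrite gexpN_le1// invr_ge0 mulr_ge0// ltW.
Qed.

(** Half of the Gaussian exponent is kept as an explicit factor, small away from the origin, while
    [gkN (2 * s)] still has mass 1. *)
Lemma gkN_double n (s : R) (x : n.-tuple R) : (0 < s)%R ->
  (gkN s x = Num.sqrt 2 ^+ n * gkN (2 * s) x * gexpN (8 * s)^-1 x)%R.
Proof.
move=> s0; rewrite !gkNE (_ : 4 * pi * (2 * s) = 2 * (4 * pi * s))%R; last by ring.
rewrite [in RHS]sqrtrM// exprMn.
rewrite (_ : gexpN (4 * s)^-1 x = gexpN (4 * (2 * s))^-1 x * gexpN (8 * s)^-1 x)%R; last first.
  rewrite /gexpN -expRD; congr expR; field; lra.
have : (Num.sqrt 2 ^+ n != 0 :> R)%R by rewrite expf_neq0// gt_eqF// sqrtr_gt0.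
move: (Num.sqrt 2 ^+ n)%R => q q0; rewrite [(q * _)^-1%R]invfM.
move: (Num.sqrt _ ^- n)%R (gexpN (8 * s)^-1 x) (gexpN _ x) => r g1 g2; by field.
Qed.

Lemma integrable_gkN n (s : R) : (0 < s)%R -> (mu n).-integrable setT (EFin \o @gkN R n s).
Proof.
move=> s0; apply/integrableP; split; first by apply/measurable_EFinP; exact: measurable_gkN.
under eq_integral do rewrite /= ger0_norm ?gkN_ge0//.
by rewrite integral_gkN// ltry.
Qed.

Lemma integrable_bounded n (b w : n.-tuple R -> R) (B : R) :
  measurable_fun setT b -> (forall x, `|b x| <= B)%R ->
  (mu n).-integrable setT (EFin \o w) ->
  (mu n).-integrable setT (EFin \o (fun x => b x * w x)%R).
Proof.
move=> mb bB wi; have mw := measurable_int _ wi.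
apply: (le_integrable measurableT _ _ (integrableZl measurableT B wi)).
  apply/measurable_EFinP; apply: measurable_funM => //.
  exact/measurable_EFinP.
move=> x _ /=; rewrite lee_fin !normrM ler_wpM2r//.
by rewrite (le_trans (bB x))// ler_norm.
Qed.

Definition moll n (e : R) (w : n.-tuple R -> R) (x : n.-tuple R) : R :=
  (\int[mu n]_(z in setT) (gkN e (vsub x z) * w z))%R.

Lemma mollE n (e : R) (w : n.-tuple R -> R) (x : n.-tuple R) : measurable_fun setT w ->
  moll e w x = (\int[mu n]_(y in setT) (gkN e y * w (vsub x y)))%R.
Proof.
move=> mw; rewrite /moll /Rintegral; congr fine.
rewrite -(integral_vsubl x); first by apply: eq_integral => y _; rewrite vsubK.
apply/measurable_EFinP; apply: measurable_funM => //.
by apply: (measurableT_comp (measurable_gkN _)); exact: measurable_vsub2.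
Qed.

Lemma measurable_moll n (e : R) (w : n.-tuple R -> R) : measurable_fun setT w ->
  measurable_fun setT (moll e w).
Proof.
move=> mw; apply: measurableT_comp => //.
apply: (@measurable_integral_snd _ _ _ _ _ (mu n)
  (fun p : n.-tuple R * n.-tuple R => (gkN e (vsub p.1 p.2) * w p.2)%:E)).
apply/measurable_EFinP; apply: measurable_funM.
  by apply: (measurableT_comp (measurable_gkN _)); exact: measurable_vsub.
by apply: (measurableT_comp mw); exact: measurable_snd.
Qed.

(** As the kernel has mass 1, the difference is an average of translation increments, and Tonelli
    exchanges the two integrals. *)
Lemma moll_dist n (e : R) (w : n.-tuple R -> R) : (0 < e)%R ->
  (mu n).-integrable setT (EFin \o w) ->
  \int[mu n]_x (`|moll e w x - w x|%R)%:E <= \int[mu n]_y ((gkN e y)%:E * toscN w y).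
Proof.
move=> e0 wi.
have mw : measurable_fun setT w by apply/measurable_EFinP; exact: measurable_int wi.
have mgw : measurable_fun setT (fun p : n.-tuple R * n.-tuple R =>
    (`|gkN e p.2 * (w (vsub p.1 p.2) - w p.1)|%R)%:E).
  apply/measurable_EFinP; apply: measurableT_comp; first by [].
  apply: measurable_funM.
    by apply: (measurableT_comp (measurable_gkN _)); exact: measurable_snd.
  apply: measurable_funB; last by apply: (measurableT_comp mw); exact: measurable_fst.
  by apply: (measurableT_comp mw); exact: measurable_vsub.
have -> : \int[mu n]_y ((gkN e y)%:E * toscN w y) =
    \int[mu n]_x \int[mu n]_y (`|gkN e y * (w (vsub x y) - w x)|%R)%:E.
  rewrite (@fubini_tonelli _ _ _ _ _ (mu n) (mu n) (fun p : n.-tuple R * n.-tuple R =>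
    (`|gkN e p.2 * (w (vsub p.1 p.2) - w p.1)|%R)%:E))//.
  apply: eq_integral => y _ /=; rewrite /toscN -ge0_integralZl//.
  - by apply: eq_integral => x _; rewrite -EFinM normrM (ger0_norm (gkN_ge0 _ _)).
  - apply/measurable_EFinP; apply: measurableT_comp; first by [].
    by apply: measurable_funB => //; apply: measurableT_comp => //; exact: measurable_vsub1.
  - by rewrite lee_fin gkN_ge0.
apply: ge0_le_integral => //.
- apply/measurable_EFinP; apply: measurableT_comp; first by [].
  by apply: measurable_funB => //; exact: measurable_moll.
- exact: (@measurable_integral_snd _ _ _ _ _ (mu n) _ mgw).
move=> x _.
have gi := integrable_gkN n e0.
have wxi : (mu n).-integrable setT (EFin \o (fun y => gkN e y * w (vsub x y))%R).
  apply: (@integrable_bounded _ _ (fun y => w (vsub x y)) (Num.sqrt (4 * pi * e) ^- n)%R).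
  - exact: measurable_gkN.
  - by move=> y; rewrite ger0_norm ?gkN_ge0// gkN_le.
  - exact: integrable_vsubl.
have gwi : (mu n).-integrable setT (EFin \o (fun y => gkN e y * w x)%R).
  rewrite (_ : EFin \o _ = fun y => (gkN e y)%:E * (w x)%:E)//; exact: integrableZr.
have -> : (moll e w x - w x = \int[mu n]_(y in setT) (gkN e y * (w (vsub x y) - w x)))%R.
  have wE : (\int[mu n]_(y in setT) (gkN e y * w x) = w x)%R.
    rewrite RintegralZr// /Rintegral /= integral_gkN//= mul1r//.
  rewrite mollE// -{1}wE -RintegralB//; apply: eq_Rintegral => y _.
  by rewrite mulrBr.
have di : (mu n).-integrable setT (EFin \o (fun y => gkN e y * (w (vsub x y) - w x))%R).
  rewrite (_ : EFin \o _ = (EFin \o (fun y => gkN e y * w (vsub x y))%R) \-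
    (EFin \o (fun y => gkN e y * w x)%R)); first exact: integrableB.
  by apply/funext => y; rewrite /= mulrBr EFinB.
rewrite EFin_normr_Rintegral//; apply: le_abse_integral => //.
exact: measurable_int di.
Qed.

Lemma moll_dist_small n (w : n.-tuple R -> R) (d : R) :
  (mu n).-integrable setT (EFin \o w) -> (0 < d)%R ->
  exists2 e : R, (0 < e)%R & \int[mu n]_x (`|moll e w x - w x|%R)%:E <= d%:E.
Proof.
move=> wi d0; have mw : measurable_fun setT w by apply/measurable_EFinP; exact: measurable_int wi.
have d2 : (0 < d / 2)%R by lra.
have [r r0 hr] := toscN_small wi d2.
pose K := fine (2%:E * \int[mu n]_x (`|w x|%R)%:E).
have toK y : toscN w y <= K%:E.
  rewrite /K fineK; first exact: toscN_ub.
  by rewrite fin_numM// integrable_fin_num//; exact: integrable_norm.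
have K0 : (0 <= K)%R by rewrite fine_ge0// mule_ge0// integral_ge0.
pose q : R := (Num.sqrt 2 ^+ n)%R.
have q0 : (0 <= q)%R by rewrite exprn_ge0// sqrtr_ge0.
(* This scale turns the tail constant K q (8 e / r) into (d / 2) K q / (K q + 1), which is at most d
   / 2; the added 1 covers K = 0. *)
pose e := (d * r / (16 * (K * q + 1)))%R.
have Kq : (0 <= K * q)%R by rewrite mulr_ge0.
have e0 : (0 < e)%R by rewrite divr_gt0 ?mulr_gt0//; lra.
have eE : e = (d * r / (16 * (K * q + 1)))%R by [].
clearbody e.
have er : (0 <= 8 * e / r)%R by rewrite divr_ge0// ltW// mulr_gt0.
exists e => //; apply: (le_trans (moll_dist e0 wi)).
(* For |y|^2 <= r the modulus is at most d / 2; beyond, e^(-t) <= 1 / t at t = |y|^2 / (8 e) gives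
   the factor 8 e / r. Adding the two bounds avoids splitting the domain of integration. *)
have key y : (gkN e y)%:E * toscN w y <= ((d / 2) * gkN e y + (K * q * (8 * e / r)) * gkN (2 * e) y)%:E.
  have [yr|yr] := leP (vnorm2 y) r.
    apply: (@le_trans _ _ ((gkN e y)%:E * (d / 2)%:E)).
      by apply: lee_wpmul2l; [rewrite lee_fin gkN_ge0|exact: hr].
    by rewrite -EFinM lee_fin mulrC lerDl mulr_ge0 ?gkN_ge0// mulr_ge0.
  apply: (@le_trans _ _ ((gkN e y)%:E * K%:E)).
    by apply: lee_wpmul2l; [rewrite lee_fin gkN_ge0|exact: toK].
  rewrite -EFinM lee_fin ler_wpDl ?mulr_ge0 ?gkN_ge0 ?(ltW d0)//.
  rewrite gkN_double// -/q.
  have : (gexpN (8 * e)^-1 y <= 8 * e / r)%R.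
    rewrite /gexpN expRN -[leRHS]invrK lef_pV2 ?posrE ?expR_gt0 ?invr_gt0 ?divr_gt0 ?mulr_gt0//.
    rewrite invf_div; apply: (le_trans _ (expR_ge1Dx _)).
    rewrite (_ : r / (8 * e) = (8 * e)^-1 * r)%R; last by rewrite mulrC.
    have : ((8 * e)^-1 * r <= (8 * e)^-1 * vnorm2 y)%R.
      by rewrite ler_wpM2l ?(ltW yr)// invr_ge0 mulr_ge0// ltW.
    lra.
  move: (gexpN _ _) (8 * e / r)%R => g B gB.
  have : (0 <= K * q * gkN (2 * e) y)%R by rewrite !mulr_ge0 ?gkN_ge0.
  move: (gkN _ _) => k hk.
  rewrite (_ : q * k * g * K = (K * q * k) * g)%R; last by ring.
  by rewrite (_ : K * q * B * k = (K * q * k) * B)%R; [rewrite ler_wpM2l|ring].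
apply: (@le_trans _ _ (\int[mu n]_y ((d / 2) * gkN e y + (K * q * (8 * e / r)) * gkN (2 * e) y)%:E)).
  apply: ge0_le_integral => //.
  - by move=> y _; rewrite mule_ge0 ?lee_fin ?gkN_ge0// toscN_ge0.
  - apply: emeasurable_funM; first by apply/measurable_EFinP; exact: measurable_gkN.
    apply: (@measurable_fun_fubini_tonelli_G _ _ _ _ _ (mu n) (fun p : n.-tuple R * n.-tuple R =>
       (`|w (vsub p.1 p.2) - w p.1|%R)%:E)) => //.
    apply/measurable_EFinP; apply: measurableT_comp; first by [].
    apply: measurable_funB; last by apply: (measurableT_comp mw); exact: measurable_fst.
    by apply: (measurableT_comp mw); exact: measurable_vsub.
  - apply/measurable_EFinP; apply: measurable_funD; apply: measurable_funM => //; exact: measurable_gkN.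
have e20 : (0 < 2 * e)%R by lra.
have c0 : (0 <= K * q * (8 * e / r))%R by rewrite mulr_ge0.
under eq_integral do rewrite EFinD [((d / 2) * _)%:E]EFinM [(K * q * _ * _)%:E]EFinM.
rewrite ge0_integralD//; last 4 first.
- by move=> y _; rewrite mule_ge0 ?lee_fin ?gkN_ge0// ltW.
- by apply: emeasurable_funM => //; apply/measurable_EFinP; exact: measurable_gkN.
- by move=> y _; rewrite -!EFinM lee_fin mulr_ge0 ?gkN_ge0.
- by apply: emeasurable_funM => //; apply/measurable_EFinP; exact: measurable_gkN.
rewrite !ge0_integralZl//; last 5 first.
- by apply/measurable_EFinP; exact: measurable_gkN.
- by move=> y _; rewrite lee_fin gkN_ge0.
- by apply/measurable_EFinP; exact: measurable_gkN.
- by move=> y _; rewrite lee_fin gkN_ge0.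
- by rewrite lee_fin ltW.
rewrite !integral_gkN// !mule1 -EFinD lee_fin.
have -> : (K * q * (8 * e / r) = d / 2 * (K * q / (K * q + 1)))%R.
  by rewrite eE; field; apply/andP; split; rewrite gt_eqF//; lra.
have : (K * q / (K * q + 1) <= 1)%R by rewrite ler_pdivrMr ?mul1r; lra.
move: (_ / _)%R => z z1; have : (d / 2 * z <= d / 2 * 1)%R by rewrite ler_wpM2l// ltW.
lra.
Qed.

End Mollification.

(** * Fatou's lemma for p-th powers and almost everywhere convergence *)

Section LpFatou.
Context d (T : measurableType d) (R : realType) (mu : {measure set T -> \bar R}).
Local Open Scope ereal_scope.
Implicit Types f : nat -> T -> R.

Lemma cvg_powR (u : nat -> R) (l p : R) : (0 < p)%R -> (forall k, 0 <= u k)%R ->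
  u k @[k --> \oo] --> l -> (u k `^ p)%R @[k --> \oo] --> (l `^ p)%R.
Proof.
move=> p0 u0 ul.
have l0 : (0 <= l)%R.
  rewrite -(cvg_lim _ ul)//; apply: limr_ge; last exact: nearW.
  by apply/cvg_ex; exists l.
(* Powers go through the logarithm, which cannot be used at the limit 0; there the terms are
   eventually at most e^(1/p) for each threshold e. *)
have [{}l0|lz] := ltP 0%R l; last first.
  have le0 : l = 0%R by apply/eqP; rewrite eq_le lz l0.
  rewrite le0 powR0 ?gt_eqF//.
  apply/cvgr0Pnorm_le => e e0.
  have e1 : (0 < e `^ p^-1)%R by rewrite powR_gt0.
  move: ul; rewrite le0 => /cvgr0Pnorm_le /(_ _ e1); apply: filterS => k.
  rewrite !ger0_norm ?powR_ge0// => uk.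
  have -> : e = ((e `^ p^-1) `^ p)%R by rewrite -powRrM mulVf ?powRr1 ?(ltW e0)// gt_eqF.
  by apply: ge0_ler_powR => //; rewrite ?nnegrE ?(ltW p0)// ltW.
have -> : (l `^ p = expR (p * ln l))%R by rewrite /powR gt_eqF.
have : (expR (p * ln (u k)))%R @[k --> \oo] --> (expR (p * ln l))%R.
  apply: (continuous_cvg _ (@continuous_expR R _)).
  by apply: cvgMr; apply: (continuous_cvg _ (continuous_ln l0)).
apply: cvg_trans; apply: near_eq_cvg.
have : \forall k \near \oo, (0 < u k)%R.
  move/cvgrPdist_lt : ul => /(_ _ l0); apply: filterS => k; rewrite ltr_norml; lra.
by apply: filterS => k uk; rewrite /powR gt_eqF.
Qed.

Lemma limn_einf_ub (u : nat -> \bar R) (B : \bar R) : (forall k, u k <= B) -> limn_einf u <= B.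
Proof.
move=> uB; rewrite limn_einf_lim; apply: lime_le; first exact: is_cvg_einfs.
apply: nearW => k; apply: (le_trans _ (uB k)); apply: ereal_inf_lbound.
by exists k => //=.
Qed.

Lemma measurable_fun_limn_einf (f : nat -> T -> \bar R) : (forall k, measurable_fun setT (f k)) ->
  measurable_fun setT (fun x => limn_einf (f ^~ x)).
Proof.
move=> mf; rewrite /limn_einf; apply: measurableT_comp => //.
apply: (measurable_fun_limn_esup (f := fun k x => - f k x)) => k.
exact: measurableT_comp.
Qed.

(** Almost everywhere the lower limit of the powers is the power of the limit, so Fatou's lemma
    passes the bound on. *)
Lemma le_integral_powR_cvg f (g : T -> R) (p : R) (B : \bar R) : (0 < p)%R ->
  (forall k, measurable_fun setT (f k)) -> measurable_fun setT g ->
  {ae mu, forall x, f k x @[k --> \oo] --> g x} ->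
  (forall k, \int[mu]_x (`|f k x| `^ p)%:E <= B) ->
  \int[mu]_x (`|g x| `^ p)%:E <= B.
Proof.
move=> p0 mf mg fg fB.
have mp (h : T -> R) : measurable_fun setT h -> measurable_fun setT (fun x => (`|h x| `^ p)%:E).
  move=> mh; apply/measurable_EFinP; have mn : measurable_fun setT (fun x => `|h x|%R) by exact: measurableT_comp.
  exact: (measurableT_comp (@measurable_powR R p) mn).
apply: (@le_trans _ _ (\int[mu]_x limn_einf (fun k => (`|f k x| `^ p)%:E))).
  have -> // : \int[mu]_x (`|g x| `^ p)%:E = \int[mu]_x limn_einf (fun k => (`|f k x| `^ p)%:E).
  apply: ge0_ae_eq_integral => //.
  - exact: mp.
  - by apply: (measurable_fun_limn_einf (f := fun k x => (`|f k x| `^ p)%:E)) => k; exact: mp.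
  - move=> x _; rewrite limn_einf_lim; apply: lime_ge; first exact: is_cvg_einfs.
    apply: nearW => k; apply: le_ereal_inf_tmp => _ [j _ <-]; by rewrite lee_fin powR_ge0.
  apply: filterS fg => x fgx _.
  have h : (`|f k x| `^ p)%:E @[k --> \oo] --> (`|g x| `^ p)%:E.
    apply: cvg_EFin; first exact: nearW.
    by apply: (@cvg_powR (fun k => `|f k x|%R)) => //; exact: cvg_norm.
  rewrite is_cvg_limn_einfE; first by apply/esym/cvg_lim.
  by apply/cvg_ex; eexists; exact: h.
apply: le_trans (limn_einf_ub fB).
apply: (@fatou _ _ _ mu setT measurableT (fun k x => (`|f k x| `^ p)%:E)) => [k|k x _]; first exact: mp.
by rewrite lee_fin powR_ge0.
Qed.

(** The L^1 distances are summable, so the sum of the pointwise distances is integrable and hence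
    almost everywhere finite; there its terms tend to 0. *)
Lemma ae_cvg_L1 f (g : T -> R) :
  (forall k, measurable_fun setT (f k)) -> measurable_fun setT g ->
  (forall k, \int[mu]_x (`|f k x - g x|%R)%:E <= (1 / (2 ^ (k + 1))%:R)%:E) ->
  {ae mu, forall x, f k x @[k --> \oo] --> g x}.
Proof.
move=> mf mg fB.
have md k : measurable_fun setT (fun x => (`|f k x - g x|%R)%:E).
  by apply/measurable_EFinP; apply: measurableT_comp => //; exact: measurable_funB.
pose S x := \sum_(k <oo) (`|f k x - g x|%R)%:E.
have S0 x : 0 <= S x by apply: nneseries_ge0.
have Si : mu.-integrable setT S.
  apply/integrableP; split; first exact: ge0_emeasurable_sum.
  under eq_integral do rewrite gee0_abs//.
  rewrite integral_nneseries//.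
  apply: (@le_lt_trans _ _ (\sum_(k <oo) (1 / (2 ^ (k + 1))%:R)%:E)).
    by apply: lee_nneseries => [k _ _|k _]; [exact: integral_ge0|exact: fB].
  by rewrite (cvg_lim _ (@cvg_geometric_eseries_half R 1 0))// ltry.
have := integrable_ae measurableT Si; apply: filterS => x /(_ I) Sx.
have h := @nneseries_tail_cvg R (fun k => (`|f k x - g x|%R)%:E) xpredT.
have {}h : (\sum_(N <= k <oo) (`|f k x - g x|%R)%:E) @[N --> \oo] --> 0.
  have Soo : S x < +oo by rewrite -ge0_fin_numE.
  exact: (h Soo (fun k _ => normr_ge0 _)).
have : (`|f k x - g x|%R)%:E @[k --> \oo] --> 0.
  apply: (@squeeze_cvge _ _ _ _ (cst 0) _ (fun N => \sum_(N <= k <oo) (`|f k x - g x|%R)%:E)) => //.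
    apply: nearW => N; rewrite lee_fin normr_ge0/=.
    have := @nneseries_lim_ge R (fun k => (`|f k x - g x|%R)%:E) xpredT N N.+1.
    by rewrite big_nat1; apply.
  exact: cvg_cst.
move/(cvge0P (u := fun k => (`|f k x - g x|%R)%:E)) => {}h; apply/cvgrPdist_le => e e0.
have hge0 k : 0 <= (`|f k x - g x|%R)%:E by rewrite lee_fin.
by have := h hge0 e e0; apply: filterS => k; rewrite lee_fin distrC.
Qed.

End LpFatou.

(** * Pointwise increments of Gaussians and heat kernels *)

Section HeatKernelIncrement.
Variable R : realType.
Implicit Types (n : nat) (s d : R).

(** Coordinatewise, from (r a + b)^2 / r >= 0 and (r a - b)^2 / r >= 0. *)
Lemma vdot_amgm n (z y : n.-tuple R) (r : R) : 0 < r ->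
  `|2 * vdot z y| <= r * vnorm2 z + r^-1 * vnorm2 y.
Proof.
move=> r0; rewrite /vdot /vnorm2 !mulr_sumr -big_split/=.
apply: (le_trans (ler_norm_sum _ _ _)); apply: ler_sum => i _.
move: (tnth z i) (tnth y i) => a b.
have ra : r^-1 * (r * a + b) ^+ 2 = r * a ^+ 2 + r^-1 * b ^+ 2 + 2 * (a * b) by field; rewrite gt_eqF.
have rb : r^-1 * (r * a - b) ^+ 2 = r * a ^+ 2 + r^-1 * b ^+ 2 - 2 * (a * b) by field; rewrite gt_eqF.
have : 0 <= r^-1 * (r * a + b) ^+ 2 by rewrite mulr_ge0 ?sqr_ge0// invr_ge0 ltW.
have : 0 <= r^-1 * (r * a - b) ^+ 2 by rewrite mulr_ge0 ?sqr_ge0// invr_ge0 ltW.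
rewrite ra rb => h1 h2; rewrite ler_norml; apply/andP; split; lra.
Qed.

Lemma vnorm2_vsub n (x y : n.-tuple R) :
  vnorm2 (vsub x y) = vnorm2 x - 2 * vdot x y + vnorm2 y.
Proof.
rewrite /vnorm2 /vdot mulr_sumr -sumrB -big_split/=; apply: eq_bigr => i _.
by rewrite tnth_mktuple; ring.
Qed.

Lemma vdot_vsubr n (x y : n.-tuple R) : vdot (vsub x y) y = vdot x y - vnorm2 y.
Proof.
rewrite /vnorm2 /vdot -sumrB; apply: eq_bigr => i _.
by rewrite tnth_mktuple; ring.
Qed.

(** If A <= B, the increment is e^(-A) (1 - e^(-(B - A))) <= e^(-A) (B - A), and half of the
    exponential absorbs the factor A + 2 through A + 2 <= 2 e^(A / 2). *)
Lemma expR_diff_le (A B r : R) : 0 <= A -> 0 <= B -> 0 <= r ->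
  B - A <= r * (A + 2) -> A - B <= r * (B + 2) ->
  `|expR (- B) - expR (- A)| <= 2 * r * (expR (- (A / 2)) + expR (- (B / 2))).
Proof.
wlog AB : A B / A <= B.
  move=> H A0 B0 r0 h1 h2; have [AB|AB] := leP A B; first exact: H.
  by rewrite distrC [X in _ * X]addrC; apply: H => //; exact: ltW.
move=> A0 B0 r0 h1 _.
rewrite ler0_norm; last by rewrite subr_le0 ler_expR; lra.
have e1 : 1 - (B - A) <= expR (- (B - A)) by apply: le_trans (expR_ge1Dx _); lra.
have -> : - (expR (- B) - expR (- A)) = expR (- A) * (1 - expR (- (B - A))).
  by rewrite mulrBr mulr1 -expRD (_ : - A + - (B - A) = - B); ring.
have h3 : 1 - expR (- (B - A)) <= r * (A + 2) by lra.
apply: (@le_trans _ _ (expR (- A) * (r * (A + 2)))); first by rewrite ler_wpM2l ?expR_ge0.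
have h4 : A + 2 <= 2 * expR (A / 2) by have := expR_ge1Dx (A / 2); lra.
apply: (@le_trans _ _ (expR (- A) * (r * (2 * expR (A / 2))))).
  by rewrite ler_wpM2l ?expR_ge0// ler_wpM2l.
rewrite (_ : expR (- A) * _ = 2 * r * (expR (- A) * expR (A / 2))); last by ring.
rewrite -expRD (_ : - A + A / 2 = - (A / 2)); last by field.
by rewrite ler_wpM2l ?mulr_ge0// lerDl expR_ge0.
Qed.

(** With A = c |x|^2, B = c |x - y|^2 and r = sqrt(c |y|^2) < 1, expanding the square and
    [vdot_amgm] with weight r bound both differences as [expR_diff_le] requires. For r >= 1 the
    triangle inequality suffices. *)
Lemma gexpN_diff n (c : R) (x y : n.-tuple R) : 0 < c ->
  `|gexpN c (vsub x y) - gexpN c x| <= 2 * Num.min 1 (Num.sqrt (c * vnorm2 y)) *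
    (gexpN (c / 2) x + gexpN (c / 2) (vsub x y)).
Proof.
move=> c0; rewrite /gexpN.
have hE (z : n.-tuple R) : - (c / 2 * vnorm2 z) = - (c * vnorm2 z / 2) by field.
rewrite !hE; set A := c * vnorm2 x; set B := c * vnorm2 (vsub x y).
have A0 : 0 <= A by rewrite mulr_ge0 ?vnorm2_ge0// ltW.
have B0 : 0 <= B by rewrite mulr_ge0 ?vnorm2_ge0// ltW.
set v := c * vnorm2 y; have v0 : 0 <= v by rewrite mulr_ge0 ?vnorm2_ge0// ltW.
have [v1|v1] := leP 1 (Num.sqrt v).
  have le2 (C : R) : 0 <= C -> expR (- C) <= expR (- (C / 2)) by move=> C0; rewrite ler_expR; lra.
  apply: (le_trans (ler_normB _ _)); rewrite !ger0_norm ?expR_ge0//.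
  have := le2 _ A0; have := le2 _ B0; have := expR_ge0 (- (A / 2)); have := expR_ge0 (- (B / 2)); lra.
(* The weight r has to be positive, so y = 0 is treated apart. *)
have [/eqP vz|vz] := boolP (v == 0).
  have y0 : vnorm2 y = 0 by apply/eqP; move/eqP: vz; rewrite mulf_eq0 gt_eqF.
  have -> : B = A.
    rewrite /B /A; congr (_ * _); apply: eq_bigr => i _; rewrite tnth_mktuple.
    have : tnth y i ^+ 2 <= 0 by rewrite -y0 sqr_tnth_le_vnorm2.
    move=> h; have : tnth y i ^+ 2 == 0 by rewrite eq_le h sqr_ge0.
    by rewrite sqrf_eq0 => /eqP ->; rewrite subr0.
  by rewrite subrr normr0 !mulr_ge0 ?addr_ge0 ?expR_ge0 ?sqrtr_ge0.
have r0 : 0 < Num.sqrt v by rewrite sqrtr_gt0 lt_neqAle eq_sym vz.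
have vv : v = Num.sqrt v ^+ 2 by rewrite sqr_sqrtr.
move: (Num.sqrt v) r0 v1 vv => r r0 r1 vv.
(* The term |y|^2 of the expanded square contributes r^2, and r < 1 makes it linear in r. *)
have rr : r ^+ 2 <= r by rewrite expr2 -[leRHS]mulr1 ler_wpM2l ?(ltW r0) ?(ltW r1).
have key (z : n.-tuple R) : `|2 * (c * vdot z y)| <= r * (c * vnorm2 z) + r.
  have := vdot_amgm z y r0; rewrite !ler_norml => /andP[h1 h2].
  have e1 : c * (r * vnorm2 z + r^-1 * vnorm2 y) = r * (c * vnorm2 z) + r.
    rewrite mulrDr; congr (_ + _); first by ring.
    by rewrite mulrCA -/v vv expr2 mulrA mulVf ?mul1r// gt_eqF.
  rewrite -e1; apply/andP; split.
    by rewrite mulrCA -mulrN ler_pM2l.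
  by rewrite mulrCA ler_pM2l.
have BA : B = A - 2 * (c * vdot x y) + v by rewrite /B vnorm2_vsub /A /v; ring.
have AB : A = B + 2 * (c * vdot (vsub x y) y) + v.
  by rewrite /B vdot_vsubr vnorm2_vsub /A /v; ring.
apply: expR_diff_le => //; first exact: ltW.
  by have := key x; rewrite ler_norml -/A => /andP[]; lra.
by have := key (vsub x y); rewrite ler_norml -/B => /andP[]; lra.
Qed.

(** For v >= 1 the power is at least 1; for v < 1 an exponent below 1/2 gives more than the square
    root. *)
Lemma min1_sqrt_le (v d : R) : 0 <= v -> 0 <= d <= 2^-1 ->
  Num.min 1 (Num.sqrt v) <= v `^ d.
Proof.
move=> v0 /andP[d0 d1].
have [v1|v1] := leP 1 v.
  by rewrite ge_min -[leLHS](powRr0 v) ler_powR.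
rewrite ge_min; apply/orP; right.
move: v0; rewrite le_eqVlt => /predU1P[<-|v0]; first by rewrite sqrtr0 powR_ge0.
by rewrite -(powR12_sqrt (ltW v0)) ger_powR// v0 (ltW v1).
Qed.

(** Halving the Gaussian exponent is doubling the time; 2^(n/2) is the ratio of the two
    normalisations. *)
Lemma gkN_diff n s d (x y : n.-tuple R) : 0 < s -> 0 <= d <= 2^-1 ->
  `|gkN s (vsub x y) - gkN s x| <= 2 * Num.sqrt 2 ^+ n * (vnorm2 y `^ d * s `^ (- d)) *
    (gkN (2 * s) x + gkN (2 * s) (vsub x y)).
Proof.
move=> s0 d01; have s4 : 0 < (4 * s)^-1 by rewrite invr_gt0; lra.
have vy := vnorm2_ge0 y; have /andP[d0 _] := d01.
have h := gexpN_diff x y s4.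
have hm : Num.min 1 (Num.sqrt ((4 * s)^-1 * vnorm2 y)) <= vnorm2 y `^ d * s `^ (- d).
  apply: (le_trans (min1_sqrt_le _ d01)); first by rewrite mulr_ge0// ltW.
  rewrite mulrC powRM ?(ltW s4)//; apply: ler_wpM2l; first exact: powR_ge0.
  rewrite powRN -powRV; last exact: ltW.
  apply: ge0_ler_powR => //; rewrite ?nnegrE ?invr_ge0 ?(ltW s0)//; first lra.
  by rewrite lef_pV2 ?posrE//; lra.
have q0 : 0 < Num.sqrt (4 * pi * s) ^- n.
  by rewrite invr_gt0 exprn_gt0// sqrtr_gt0 mulr_gt0// mulr_gt0// pi_gt0.
rewrite !gkNE -mulrBr normrM (gtr0_norm q0).
have -> : 4 * pi * (2 * s) = 2 * (4 * pi * s) by ring.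
have -> : Num.sqrt (2 * (4 * pi * s)) ^- n = (Num.sqrt 2 ^+ n)^-1 * Num.sqrt (4 * pi * s) ^- n.
  by rewrite sqrtrM// exprMn invfM.
have -> : (4 * (2 * s))^-1 = (4 * s)^-1 / 2 by field; rewrite gt_eqF.
have q2 : Num.sqrt 2 ^+ n != 0 :> R by rewrite expf_neq0// gt_eqF// sqrtr_gt0.
set g1 := gexpN (_ / 2) x in h *; set g2 := gexpN (_ / 2) (vsub x y) in h *.
have g12 : 0 <= g1 + g2 by rewrite addr_ge0 ?gexpN_ge0.
move: (Num.sqrt 2 ^+ n) q2 (Num.sqrt _ ^- n) q0 => q2 q20 q q0.
set P := _ `^ d * _ in hm *.
have -> : 2 * q2 * P * (q2^-1 * q * g1 + q2^-1 * q * g2) = q * (2 * P * (g1 + g2)) by field.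
rewrite ler_pM2l//; apply: (le_trans h); apply: ler_wpM2r => //.
by rewrite ler_wpM2l.
Qed.

End HeatKernelIncrement.

(** * Fourier inversion and mixtures of heat kernels *)

Section Subordination.
Variable R : realType.
Implicit Types (n : nat) (a e : R).
Local Notation mu n := (lebn R n).

Lemma vdotC n (x y : n.-tuple R) : vdot x y = vdot y x.
Proof. by apply: eq_bigr => i _; rewrite mulrC. Qed.

Lemma vdot_vsubl n (x z w : n.-tuple R) : vdot (vsub x z) w = vdot w x - vdot w z.
Proof.
by rewrite /vdot -sumrB; apply: eq_bigr => i _; rewrite tnth_mktuple; ring.
Qed.

(** Fubini for Z(z) e^(-e |w|^2) cos((x - z) . w): integrating in w first gives the heat kernel at x
    - z; integrating in z first gives m, as the sine part of the addition formula has zero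
    integral. *)
Lemma moll_fourier n e (Z : n.-tuple R -> R) (m : n.-tuple R -> R) (x : n.-tuple R) : 0 < e ->
  (mu n).-integrable setT (EFin \o Z) ->
  (forall w, \int[mu n]_z (Z z * cos (vdot w z))%:E = (m w)%:E)%E ->
  (forall w, \int[mu n]_z (Z z * sin (vdot w z))%:E = 0)%E ->
  (\int[mu n]_w (gexpN e w * cos (vdot w x) * m w)%:E = ((2 * pi) ^+ n * moll e Z x)%:E)%E.
Proof.
move=> e0 Zi Zc Zs.
have mZ : measurable_fun setT Z by apply/measurable_EFinP; exact: measurable_int Zi.
have mcos : measurable_fun setT (@cos R) by exact: continuous_measurable_fun (@continuous_cos R).
have msin : measurable_fun setT (@sin R) by exact: continuous_measurable_fun (@continuous_sin R).
have hz z : (\int[mu n]_w (Z z * (gexpN e w * cos (vdot (vsub x z) w)))%:E =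
    ((2 * pi) ^+ n)%:E * (gkN e (vsub x z) * Z z)%:E)%E.
  under eq_integral do rewrite EFinM.
  have ic := integrable_gexpN_bounded e0 (measurable_cos_vdot (vsub x z)) (fun w => cos_max _).
  by rewrite (integralZl measurableT ic) (integral_gexpN_trig _ e0).1 -!EFinM; congr EFin; ring.
have hw w : (\int[mu n]_z (Z z * (gexpN e w * cos (vdot (vsub x z) w)))%:E =
    (gexpN e w * cos (vdot w x) * m w)%:E)%E.
  have Zb (t : R -> R) : measurable_fun setT t -> (forall u, `|t u| <= 1) ->
      (mu n).-integrable setT (fun z => (Z z * t (vdot w z))%:E).
    move=> mt t1; have := @integrable_bounded R n (fun z => t (vdot w z)) Z 1.
    rewrite (_ : EFin \o _ = fun z => (Z z * t (vdot w z))%:E); last first.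
      by apply/funext => z /=; rewrite mulrC.
    by apply; [exact: (measurableT_comp mt (measurable_vdot _))|move=> z; exact: t1|exact: Zi].
  transitivity (\int[mu n]_z ((gexpN e w * cos (vdot w x))%:E * (Z z * cos (vdot w z))%:E +
     (gexpN e w * sin (vdot w x))%:E * (Z z * sin (vdot w z))%:E))%E.
    apply: eq_integral => z _; rewrite vdot_vsubl cosB -!EFinM -EFinD; congr EFin; ring.
  have ci := Zb _ mcos (@cos_max R); have si := Zb _ msin (@sin_max R).
  have ci2 := integrableZl measurableT (gexpN e w * cos (vdot w x)) ci.
  have si2 := integrableZl measurableT (gexpN e w * sin (vdot w x)) si.
  rewrite (integralD measurableT ci2 si2).
  by rewrite (integralZl measurableT ci) (integralZl measurableT si) Zc Zs mule0 adde0 -EFinM.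
have mgx : measurable_fun setT (fun z => gkN e (vsub x z)).
  exact: (measurableT_comp (measurable_gkN _) (measurable_vsub2 _)).
have gB z : `|gkN e (vsub x z)| <= Num.sqrt (4 * pi * e) ^- n.
  by rewrite ger0_norm ?gkN_ge0// gkN_le.
have gZi : (mu n).-integrable setT (fun z => (gkN e (vsub x z) * Z z)%:E).
  exact: (integrable_bounded mgx gB Zi).
pose f (p : n.-tuple R * n.-tuple R) := (Z p.1 * (gexpN e p.2 * cos (vdot (vsub x p.1) p.2)))%:E.
have m1 := @measurable_fst _ _ (n.-tuple R) (n.-tuple R).
have m2 := @measurable_snd _ _ (n.-tuple R) (n.-tuple R).
have mf : measurable_fun setT f.
  apply/measurable_EFinP; apply: measurable_funM; first exact: (measurableT_comp mZ m1).
  apply: measurable_funM; first exact: (measurableT_comp (measurable_gexpN e) m2).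
  apply: (measurableT_comp mcos); apply: measurable_sum => i.
  apply: measurable_funM; last exact: (measurableT_comp (measurable_tnth i) m2).
  apply: (measurableT_comp (measurable_tnth i)).
  exact: (measurableT_comp (measurable_vsub2 x) m1).
have fi : (mu n \x mu n)%E.-integrable setT f.
  apply/(integrable12ltyP _ _ mf).
  apply: (@le_lt_trans _ _ (\int[mu n]_z (`|Z z|%:E * \int[mu n]_w (gexpN e w)%:E)))%E.
    apply: ge0_le_integral => //.
    - by move=> z _; apply: integral_ge0.
    - have h := @measurable_fun_fubini_tonelli_F _ _ _ _ _ (mu n) (fun p => `|f p|)%E.
      by apply: h => //; exact: measurableT_comp.
    - apply: emeasurable_funM => //; apply/measurable_EFinP; exact: measurableT_comp.
    move=> z _; rewrite -ge0_integralZl//; last 2 first.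
    - by apply/measurable_EFinP; exact: measurable_gexpN.
    - by move=> w _; rewrite lee_fin gexpN_ge0.
    apply: ge0_le_integral => //.
    - by apply: measurableT_comp => //; exact: (measurableT_comp mf (pair1_measurable z)).
    - by apply: emeasurable_funM => //; apply/measurable_EFinP; exact: measurable_gexpN.
    move=> w _; rewrite /f /= -EFinM lee_fin normrM ler_wpM2l// normrM.
    by rewrite (ger0_norm (gexpN_ge0 _ _)) -[leRHS]mulr1 ler_wpM2l ?gexpN_ge0 ?cos_max.
  rewrite ge0_integralZr//.
  - rewrite lte_mul_pinfty//.
    + exact: integral_ge0.
    + by rewrite ge0_fin_numE ?integral_ge0//; case/integrableP : Zi.
    + have /integrableP[_] := integrable_gexpN n e0; congr (_ < _)%E.
      by apply: eq_integral => w _; rewrite /= ger0_norm ?gexpN_ge0.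
  - by apply/measurable_EFinP; exact: measurableT_comp.
  - by apply: integral_ge0 => w _; rewrite lee_fin gexpN_ge0.
have := Fubini fi; rewrite /f /= => fub.
rewrite -(eq_integral _ _ (fun w _ => hw w)) -fub (eq_integral _ _ (fun z _ => hz z)).
rewrite (integralZl measurableT gZi) EFinM; congr (_ * _)%E.
by rewrite /moll /Rintegral (fineK (integrable_fin_num measurableT gZi)).
Qed.

Lemma gexpNM n (c b : R) (w : n.-tuple R) : gexpN c w * expR (- (vnorm2 w * b)) = gexpN (c + b) w.
Proof. by rewrite /gexpN -expRD; congr expR; ring. Qed.

Lemma cvg_mulIl (c l : R) (u : nat -> R) : c != 0 ->
  c * u k @[k --> \oo] --> c * l -> u k @[k --> \oo] --> l.
Proof.
move=> c0 h.
have : c^-1 * (c * u k) @[k --> \oo] --> c^-1 * (c * l) by apply: cvgM h; exact: cvg_cst.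
by under eq_fun do rewrite mulKf//; rewrite mulKf.
Qed.

(** On the Fourier side the mixture is e^(-e |w|^2) times the Laplace transform of the table count
    at |w|^2 T / (k + 1)^a. So [crp_mittag_leffler] gives the pointwise limit, and the Gaussian
    dominates because the weights sum to 1. *)
Lemma moll_crp n a e T (Z : n.-tuple R -> R) (x : n.-tuple R) : 0 < a < 1 -> 0 < e -> 0 <= T ->
  (mu n).-integrable setT (EFin \o Z) ->
  (forall w, \int[mu n]_z (Z z * cos (vdot w z))%:E = (mittag_leffler a (- (vnorm2 w * T)))%:E)%E ->
  (forall w, \int[mu n]_z (Z z * sin (vdot w z))%:E = 0)%E ->
  (\sum_(j < k.+1) crp a k j * gkN (e + j.+1%:R * (T / k.+1%:R `^ a)) x)
    @[k --> \oo] --> moll e Z x.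
Proof.
move=> a01 e0 T0 Zi Zc Zs; have /andP[a0 a1] := a01.
have ca k j : 0 <= crp a k j by apply: crp_ge0; rewrite !ltW.
have hlim := moll_fourier x e0 Zi Zc Zs.
pose tau k := T / k.+1%:R `^ a.
have tau0 k : 0 <= tau k by rewrite divr_ge0 ?powR_ge0.
pose f k (w : n.-tuple R) := \sum_(j < k.+1)
   crp a k j * (gexpN (e + j.+1%:R * tau k) w * cos (vdot x w)).
have ec k (j : 'I_k.+1) : 0 < e + j.+1%:R * tau k by rewrite ltr_wpDr ?mulr_ge0.
have fij k (j : 'I_k.+1) : (mu n).-integrable setT
    (fun w => (gexpN (e + j.+1%:R * tau k) w * cos (vdot x w))%:E).
  by apply: integrable_gexpN_bounded => //; [exact: measurable_cos_vdot|move=> w; exact: cos_max].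
have fE k w : f k w = (\sum_(j < k.+1) crp a k j * expR (- (j.+1%:R * (vnorm2 w * T / k.+1%:R `^ a)))) *
    (gexpN e w * cos (vdot x w)).
  rewrite /f mulr_suml; apply: eq_bigr => j _; rewrite -gexpNM /tau.
  rewrite (_ : vnorm2 w * (j.+1%:R * (T / k.+1%:R `^ a)) = j.+1%:R * (vnorm2 w * T / k.+1%:R `^ a)); last by ring.
  by move: (expR _) => z; ring.
have fi k : (\int[mu n]_w (f k w)%:E =
   ((2 * pi) ^+ n * \sum_(j < k.+1) crp a k j * gkN (e + j.+1%:R * tau k) x)%:E)%E.
  rewrite /f; under eq_integral do rewrite -sumEFin.
  rewrite integral_sum//; last first.
    move=> j; under eq_fun do rewrite EFinM; exact: integrableZl.
  rewrite mulr_sumr -sumEFin; apply: eq_bigr => j _.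
  under eq_integral do rewrite EFinM.
  by rewrite integralZl// (integral_gexpN_trig _ (ec k j)).1 -EFinM; congr EFin; ring.
have cv : ((\int[mu n]_w (f k w)%:E)%E @[k --> \oo] --> ((2 * pi) ^+ n * moll e Z x)%:E)%E.
  rewrite -hlim.
  apply: (@dominated_cvg _ _ _ (mu n) setT measurableT _ _ (fun w => (gexpN e w)%:E)).
  - move=> k; apply/measurable_EFinP; apply: measurable_sum => j.
    apply: measurable_funM => //; apply: measurable_funM; first exact: measurable_gexpN.
    exact: measurable_cos_vdot.
  - move=> w _; apply: cvg_EFin; first exact: nearW.
    under eq_fun do rewrite fE; rewrite mulrC vdotC.
    apply: cvgMl; apply: crp_mittag_leffler => //.
    by rewrite mulr_ge0 ?vnorm2_ge0.
  - by [].
  - exact: integrable_gexpN.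
  - move=> k w _ /=; rewrite lee_fin fE normrM.
    rewrite (_ : `|gexpN e w * _| = gexpN e w * `|cos (vdot x w)|); last first.
      by rewrite normrM ger0_norm ?gexpN_ge0.
    rewrite -[leRHS]mul1r; apply: ler_pM => //; first by rewrite mulr_ge0 ?gexpN_ge0.
      rewrite ger0_norm; last by apply: sumr_ge0 => j _; rewrite mulr_ge0 ?expR_ge0.
      rewrite -[leRHS](crp_sum a k); apply: ler_sum => j _.
      rewrite -[leRHS]mulr1 ler_wpM2l// -expR0 ler_expR oppr_le0.
      by rewrite mulr_ge0// divr_ge0 ?powR_ge0// mulr_ge0 ?vnorm2_ge0.
    by rewrite -[leRHS]mulr1 ler_wpM2l ?gexpN_ge0 ?cos_max.
have p0 : (2 * pi) ^+ n != 0 :> R by rewrite expf_neq0// mulf_neq0// gt_eqF// pi_gt0.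
apply: (cvg_mulIl p0).
by move: cv; under eq_fun do rewrite fi; move/fine_cvg; under eq_fun do rewrite /=.
Qed.

End Subordination.

(** * An integral form of Minkowski's inequality *)

Section IntegralMinkowski.
Context d1 d2 (X : measurableType d1) (Y : measurableType d2) (R : realType).
Variables (mx : {sigma_finite_measure set X -> \bar R})
  (my : {sigma_finite_measure set Y -> \bar R}).

(** The convex function u^p lies above its tangent at C. For p > 1 this is Young's inequality with
    exponents p and p / (p - 1); p = 1 is separate because the conjugate exponent is then
    infinite. *)
Lemma young_powR (p C u : R) : 1 <= p -> 0 <= C -> 0 <= u ->
  p * C `^ (p - 1) * u <= u `^ p + (p - 1) * C `^ p.
Proof.
rewrite le_eqVlt => /predU1P[<-|p1] C0 u0.
  by rewrite subrr powRr0 mul0r addr0 !mul1r powRr1.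
have p0 : 0 < p by lra.
have pp : 0 < p - 1 by lra.
have := @conjugate_powR R u (C `^ (p - 1)) p (p / (p - 1)) u0 (powR_ge0 _ _) p0 (divr_gt0 p0 pp).
have -> : p^-1 + (p / (p - 1))^-1 = 1 by field; rewrite !gt_eqF.
rewrite -powRrM (_ : (p - 1) * (p / (p - 1)) = p); last by field; rewrite gt_eqF.
move=> /(_ erefl) /(ler_wpM2l (ltW p0)).
move: (C `^ p) (u `^ p) (C `^ (p - 1)) => a b c h.
have e : p * (b / p + a / (p / (p - 1))) = b + (p - 1) * a by field; rewrite !gt_eqF.
by move: h; rewrite e; lra.
Qed.

(* Young's inequality at the point C = c x / b replaces Jensen's inequality for the
   measure q / b, which is a probability only when the mass bound is attained. *)
Lemma integral_minkowski (I : finType) (q : I -> Y -> R) (phi : I -> X * Y -> R)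
    (c : X -> R) (p b : R) : 1 <= p -> 0 < b ->
  (forall i, measurable_fun setT (q i)) -> (forall i y, 0 <= q i y) ->
  (forall i, measurable_fun setT (phi i)) -> (forall i z, 0 <= phi i z) ->
  (forall x, (c x)%:E = \int[my]_y (\sum_i q i y * phi i (x, y))%:E)%E ->
  (\int[my]_y (\sum_i q i y)%:E <= b%:E)%E ->
  (forall i y, \int[mx]_x (phi i (x, y) `^ p)%:E <= 1)%E ->
  (\int[mx]_x (c x `^ p)%:E <= (b `^ p)%:E)%E.
Proof.
move=> p1 b0 mq q0 mphi phi0 cE qb phip.
have p0 : 0 < p by lra.
have c0 x : 0 <= c x.
  by rewrite -lee_fin cE; apply: integral_ge0 => y _; rewrite lee_fin sumr_ge0// => i _; rewrite mulr_ge0.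
pose f (z : X * Y) := (\sum_i q i z.2 * phi i z `^ p)%:E.
have f0 z : (0 <= f z)%E by rewrite lee_fin sumr_ge0// => i _; rewrite mulr_ge0 ?powR_ge0.
have mpp i : measurable_fun setT (fun z => phi i z `^ p).
  exact: (measurableT_comp (@measurable_powR R p) (mphi i)).
have mf : measurable_fun setT f.
  apply/measurable_EFinP; apply: measurable_sum => i; apply: measurable_funM => //.
  by apply: (measurableT_comp (mq i)); exact: measurable_snd.
have mqs : measurable_fun setT (fun y => (\sum_i q i y)%:E).
  by apply/measurable_EFinP; exact: measurable_sum.
have mc : measurable_fun setT c.
  apply/measurable_EFinP; rewrite (_ : EFin \o c = fun x => \int[my]_y (\sum_i q i y * phi i (x, y))%:E)%E; last first.
    by apply/funext => x /=; rewrite cE.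
  apply: (@measurable_integral_snd _ _ _ _ _ my (fun z => (\sum_i q i z.2 * phi i z)%:E)).
  apply/measurable_EFinP; apply: measurable_sum => i; apply: measurable_funM => //.
  by apply: (measurableT_comp (mq i)); exact: measurable_snd.
have key x : ((c x `^ p)%:E <= (b `^ (p - 1))%:E * \int[my]_y f (x, y))%E.
  pose C := c x / b; have C0 : 0 <= C by rewrite divr_ge0// ltW.
  have cC : c x = b * C by rewrite /C mulrCA divff ?mulr1// gt_eqF.
  have mqp : measurable_fun setT (fun y => (\sum_i q i y * phi i (x, y))%:E).
    apply/measurable_EFinP; apply: measurable_sum => i; apply: measurable_funM => //.
    exact: (measurableT_comp (mphi i) (pair1_measurable x)).
  have h : ((p * C `^ (p - 1) * c x)%:E <= \int[my]_y f (x, y) + ((p - 1) * C `^ p * b)%:E)%E.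
    apply: (@le_trans _ _ (\int[my]_y f (x, y) + ((p - 1) * C `^ p)%:E * \int[my]_y (\sum_i q i y)%:E))%E; last first.
      by rewrite leeD2l// (EFinM _ b) lee_wpmul2l// lee_fin mulr_ge0 ?powR_ge0//; lra.
    rewrite EFinM cE -ge0_integralZl//; last 2 first.
    - by move=> y _; rewrite lee_fin sumr_ge0// => i _; rewrite mulr_ge0.
    - by rewrite lee_fin mulr_ge0 ?powR_ge0// ltW.
    rewrite -ge0_integralZl//; last 2 first.
    - by move=> y _; rewrite lee_fin sumr_ge0.
    - by rewrite lee_fin mulr_ge0 ?powR_ge0//; lra.
    have mfx : measurable_fun setT (fun y => f (x, y)) by exact: (measurableT_comp mf (pair1_measurable x)).
    rewrite -ge0_integralD//; last 2 first.
    - by move=> y _; rewrite -EFinM lee_fin !mulr_ge0 ?powR_ge0 ?sumr_ge0//; lra.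
    - exact: emeasurable_funM.
    apply: ge0_le_integral => //.
    - by move=> y _; rewrite -EFinM lee_fin !mulr_ge0 ?powR_ge0 ?sumr_ge0 ?(ltW p0)// => i _; rewrite mulr_ge0.
    - exact: emeasurable_funM.
    - by apply: emeasurable_funD => //; exact: emeasurable_funM.
    move=> y _; rewrite /f -!EFinM -EFinD lee_fin !mulr_sumr -big_split/=; apply: ler_sum => i _.
    have := ler_wpM2l (q0 i y) (young_powR p1 C0 (phi0 i (x, y))).
    move: (C `^ _) (C `^ p) (phi i _ `^ _) => r1 r2 r3; lra.
  (* As c x = b C, the terms with factors p and p - 1 differ by exactly b C^p. *)
  have {}h : ((b * C `^ p)%:E <= \int[my]_y f (x, y))%E.
    move: h; have : (0 <= \int[my]_y f (x, y))%E by exact: integral_ge0.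
    case: (\int[my]_y f (x, y))%E => [r||]; [|by move=> _ _; rewrite leey|by []].
    move=> _; rewrite -EFinD !lee_fin cC -(@mulr_powRB1 _ C p)//.
    move: (C `^ _) => z; lra.
  apply: (@le_trans _ _ ((b `^ (p - 1))%:E * (b * C `^ p)%:E))%E.
    rewrite -EFinM lee_fin cC powRM ?(ltW b0)// -(@mulr_powRB1 _ b p) ?(ltW b0)//.
    by rewrite mulrA [b * _]mulrC.
  by rewrite lee_wpmul2l// lee_fin powR_ge0.
apply: (@le_trans _ _ (\int[mx]_x ((b `^ (p - 1))%:E * \int[my]_y f (x, y))))%E.
  apply: ge0_le_integral => //.
  - by move=> x _; rewrite lee_fin powR_ge0.
  - by apply/measurable_EFinP; exact: (measurableT_comp (@measurable_powR R p) mc).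
  - by apply: emeasurable_funM => //; exact: measurable_integral_snd.
rewrite ge0_integralZl//; last 3 first.
- exact: measurable_integral_snd.
- by move=> x _; exact: integral_ge0.
- by rewrite lee_fin powR_ge0.
rewrite -(@mulr_powRB1 _ b p) ?(ltW b0)// mulrC EFinM lee_wpmul2l ?lee_fin ?powR_ge0//.
rewrite (@fubini_tonelli _ _ _ _ _ mx my f)//; apply: le_trans qb.
apply: ge0_le_integral => //.
- by move=> y _; exact: integral_ge0.
- exact: measurable_fun_fubini_tonelli_G.
move=> y _; rewrite /f /=; under eq_integral do rewrite -sumEFin.
rewrite ge0_integral_sum//.
- rewrite -sumEFin; apply: lee_sum => i _.
  under eq_integral do rewrite EFinM.
  rewrite ge0_integralZl//.
  + by rewrite -[leRHS]mule1 lee_wpmul2l// lee_fin.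
  + by apply/measurable_EFinP; exact: (measurableT_comp (mpp i) (pair2_measurable y)).
  + by move=> x _; rewrite lee_fin powR_ge0.
  + by rewrite lee_fin.
- move=> i; apply/measurable_EFinP; apply: measurable_funM => //.
  exact: (measurableT_comp (mpp i) (pair2_measurable y)).
- by move=> i x _; rewrite lee_fin mulr_ge0 ?powR_ge0.
Qed.

End IntegralMinkowski.

(** * L^p norms of heat kernels *)

Section GaussianLp.
Variable R : realType.
Local Notation mu n := (lebn R n).

Lemma gkN_le_powR n (s : R) (x : n.-tuple R) : 0 < s -> gkN s x <= s `^ (- (n%:R / 2)).
Proof.
move=> s0; apply: (le_trans (gkN_le x s0)).
have -> : s `^ (- (n%:R / 2)) = Num.sqrt s ^- n.
  rewrite powRN -(powR12_sqrt (ltW s0)) -powR_mulrn ?powR_ge0// -powRrM.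
  by congr ((_ `^ _)^-1); field.
rewrite lef_pV2 ?posrE ?exprn_gt0 ?sqrtr_gt0//; last first.
  by rewrite mulr_gt0// mulr_gt0// pi_gt0.
apply: lerXn2r; rewrite ?nnegrE ?sqrtr_ge0// ler_wsqrtr//.
have := pi_ge2 R => hp; rewrite -[leLHS]mul1r ler_pM2r//; lra.
Qed.

(** Interpolation between the uniform bound s^(-n/2) and the unit mass: g^p <= (sup g)^(p - 1) g. *)
Lemma integral_gkN_powR n (s p : R) : 0 < s -> 1 <= p ->
  (\int[mu n]_x (gkN s x `^ p)%:E <= ((s `^ (- (n%:R / 2 * (1 - p^-1)))) `^ p)%:E)%E.
Proof.
move=> s0 p1; have p0 : 0 < p by lra.
have -> : (s `^ (- (n%:R / 2 * (1 - p^-1)))) `^ p = (s `^ (- (n%:R / 2))) `^ (p - 1).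
  by rewrite -!powRrM; congr (_ `^ _); field; rewrite gt_eqF.
rewrite -[leRHS]mule1 -(integral_gkN n s0) -ge0_integralZl//; last 3 first.
- by apply/measurable_EFinP; exact: measurable_gkN.
- by move=> x _; rewrite lee_fin gkN_ge0.
- by rewrite lee_fin powR_ge0.
apply: ge0_le_integral => //.
- by move=> x _; rewrite lee_fin powR_ge0.
- apply/measurable_EFinP; apply: (measurableT_comp (@measurable_powR R p)).
  exact: measurable_gkN.
- by apply: emeasurable_funM => //; apply/measurable_EFinP; exact: measurable_gkN.
move=> x _; rewrite -EFinM lee_fin -(mulr_powRB1 (gkN_ge0 s x) p0) mulrC.
rewrite ler_wpM2r ?gkN_ge0// ge0_ler_powR ?nnegrE ?gkN_ge0 ?powR_ge0 ?gkN_le_powR//.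
by rewrite subr_ge0.
Qed.

Lemma powR_add_le (p x y : R) : 1 <= p -> 0 <= x -> 0 <= y ->
  (x + y) `^ p <= 2 `^ p * (x `^ p + y `^ p).
Proof.
move=> p1 x0 y0; have p0 : 0 <= p by lra.
wlog xy : x y x0 y0 / x <= y.
  by move=> H; have [xy|/ltW yx] := leP x y; [exact: H|rewrite addrC [_ `^ p + _]addrC; exact: H].
apply: (@le_trans _ _ ((2 * y) `^ p)).
  by rewrite ge0_ler_powR ?nnegrE ?mulr_ge0 ?addr_ge0//; lra.
by rewrite powRM// ler_wpM2l ?powR_ge0// lerDr powR_ge0.
Qed.

End GaussianLp.

(** * L^p and uniform bounds for increments of the approximating mixtures *)

Section CrpIncrement.
Variable R : realType.
Local Notation mu n := (lebn R n).
Variables (n k : nat) (a e T d th : R) (u0 : n.-tuple R -> R).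
Hypothesis a01 : 0 < a < 1.
Hypothesis e0 : 0 < e.
Hypothesis T0 : 0 < T.
Hypothesis d0 : 0 <= d.
Hypothesis d1 : d <= 2^-1.
Hypothesis th0 : 0 <= th.
Hypothesis thd : th + d < 1.
Hypothesis u0i : (mu n).-integrable setT (EFin \o u0).
Hypothesis u0_ge0 : forall y, 0 <= u0 y.

Let mu0 : measurable_fun setT u0.
Proof. by apply/measurable_EFinP; exact: measurable_int u0i. Qed.

Let crp0 j : 0 <= crp a k j.
Proof. by case/andP: a01 => *; apply: crp_ge0; rewrite !ltW. Qed.

(* The heat-kernel times of the mixture that approximates Z at time T^(1/a), mollified at scale e. *)
Definition crps (j : nat) : R := e + j.+1%:R * (T / k.+1%:R `^ a).
Local Notation s := crps.

Lemma crps_gt0 j : 0 < s j.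
Proof. by rewrite ltr_wpDr// mulr_ge0// divr_ge0 ?powR_ge0// ltW. Qed.

(** Dropping [e] from the times only increases the negative powers, and (k + 1)^a then cancels
    against the decay of the negative moment: the bound is uniform in k and e. *)
Lemma crps_negmoment (r : R) : 0 <= r < 1 ->
  \sum_(j < k.+1) crp a k j * s j `^ (- r) <= (1 - r)^-1 * T `^ (- r).
Proof.
move=> r01; have /andP[r0 r1] := r01.
have ka : 0 < k.+1%:R `^ a by rewrite powR_gt0.
apply: (@le_trans _ _ (\sum_(j < k.+1) crp a k j * j.+1%:R `^ (- r) * (T / k.+1%:R `^ a) `^ (- r))).
  apply: ler_sum => j _; rewrite -mulrA; apply: ler_wpM2l => //.
  rewrite -powRM ?ler0n ?divr_ge0 ?(ltW T0) ?(ltW ka)// !powRN.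
  have h : 0 < j.+1%:R * (T / k.+1%:R `^ a) by rewrite mulr_gt0// divr_gt0.
  rewrite lef_pV2 ?posrE ?powR_gt0 ?crps_gt0//.
  by rewrite ge0_ler_powR ?nnegrE ?(ltW h) ?(ltW (crps_gt0 _))// /crps lerDr ltW.
rewrite -mulr_suml; apply: (@le_trans _ _ ((1 - r)^-1 * k.+1%:R `^ (- (a * r)) * (T / k.+1%:R `^ a) `^ (- r))).
  apply: ler_wpM2r; first exact: powR_ge0.
  by apply: crp_negmoment => //; case/andP: a01 => *; rewrite !ltW.
rewrite -mulrA ler_wpM2l ?invr_ge0 ?subr_ge0 ?(ltW r1)//.
rewrite powRM ?invr_ge0 ?(ltW T0) ?(ltW ka)// powRV ?(ltW ka)// [(_ `^ a) `^ _]powRN -powRrM powRN invrK.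
by rewrite mulrCA mulVf ?mulr1// gt_eqF// powR_gt0.
Qed.

(* The Hoelder gain d is only used for |y|^2 <= T, so that the weight is bounded
   and tends to 0 as T grows, without any moment assumption on u0. *)
Definition incr_weight (y : n.-tuple R) : R :=
  if vnorm2 y <= T then (vnorm2 y / T) `^ d else 1.

(* [q j] carries the size of the increment and [phi j] its profile in x, normalised
   so that the L^p norm of [x |-> phi j (x, y)] is at most 1. *)
Let kap j (y : n.-tuple R) : R := if vnorm2 y <= T then vnorm2 y `^ d * s j `^ (- d) else 1.
Let q (j : 'I_k.+1) (y : n.-tuple R) : R :=
  u0 y * (crp a k j * (8 * Num.sqrt 2 ^+ n) * kap j y * s j `^ (- th)).
Let phi (j : 'I_k.+1) (z : n.-tuple R * n.-tuple R) : R :=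
  (4 * s j `^ (- th))^-1 * (gkN (2 * s j) z.1 + gkN (2 * s j) (vsub z.1 z.2)).

Let kap_ge0 j y : 0 <= kap j y.
Proof. by rewrite /kap; case: ifP => _ //; rewrite mulr_ge0 ?powR_ge0. Qed.

Let q_ge0 j y : 0 <= q j y.
Proof. by rewrite !mulr_ge0 ?powR_ge0 ?exprn_ge0 ?sqrtr_ge0. Qed.

Let phi_ge0 j z : 0 <= phi j z.
Proof. by rewrite !mulr_ge0 ?addr_ge0 ?gkN_ge0// invr_ge0 mulr_ge0 ?powR_ge0. Qed.

Lemma incr_weight_ge0 y : 0 <= incr_weight y.
Proof. by rewrite /incr_weight; case: ifP => _ //; rewrite powR_ge0. Qed.

Lemma incr_weight_le1 y : incr_weight y <= 1.
Proof.
rewrite /incr_weight; case: ifPn => // yT.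
rewrite -(powRr0 (vnorm2 y / T)); have v0 := vnorm2_ge0 y.
have [vz|vz] := eqVneq (vnorm2 y) 0.
  rewrite vz mul0r; have [->//|dn] := eqVneq d 0.
  by rewrite powR0// powR_ge0.
have vp : 0 < vnorm2 y by rewrite lt_neqAle eq_sym vz.
by apply: ger_powR => //; rewrite divr_gt0//= ler_pdivrMr// mul1r.
Qed.

Lemma measurable_incr_weight : measurable_fun setT incr_weight.
Proof.
apply: measurable_fun_ifT => //.
  by apply: measurable_fun_ler => //; exact: measurable_vnorm2.
apply: (measurableT_comp (@measurable_powR R d)); apply: measurable_funM => //.
exact: measurable_vnorm2.
Qed.

Let mkap j : measurable_fun setT (kap j).
Proof.
apply: measurable_fun_ifT => //.
  by apply: measurable_fun_ler => //; exact: measurable_vnorm2.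
apply: measurable_funM => //; apply: (measurableT_comp (@measurable_powR R d)).
exact: measurable_vnorm2.
Qed.

Let mq j : measurable_fun setT (q j).
Proof.
apply: measurable_funM => //; apply: measurable_funM => //.
by apply: measurable_funM => //; exact: mkap.
Qed.

Let mphi j : measurable_fun setT (phi j).
Proof.
apply: measurable_funM => //; apply: measurable_funD.
  by apply: (measurableT_comp (measurable_gkN _)); exact: measurable_fst.
by apply: (measurableT_comp (measurable_gkN _)); exact: measurable_vsub.
Qed.

(** The 8 is the 2 of [gkN_diff] times the 4 that normalises [phi]; the last factor is the negative
    moment constant of order th + d. *)
Definition incr_const : R := 8 * Num.sqrt 2 ^+ n * (1 - th - d)^-1.

Let sum_q y : \sum_j q j y <= incr_const * T `^ (- th) * (u0 y * incr_weight y).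
Proof.
rewrite /q -mulr_sumr [leRHS]mulrCA; apply: ler_wpM2l => //.
(* Both cases of the weight become one formula with exponent r = d or r = 0; the moment constant is
   largest for r = d. *)
pose r : R := if vnorm2 y <= T then d else 0.
have r0 : 0 <= r by rewrite /r; case: ifP.
have rd : r <= d by rewrite /r; case: ifP.
have kapE j : kap j y = vnorm2 y `^ r * s j `^ (- r).
  by rewrite /kap /r; case: ifP => // _; rewrite oppr0 !powRr0 mulr1.
have wE : incr_weight y = vnorm2 y `^ r * T `^ (- r).
  rewrite /incr_weight /r; case: ifP => _; last by rewrite oppr0 !powRr0 mulr1.
  by rewrite powRM ?vnorm2_ge0 ?invr_ge0 ?(ltW T0)// powRV ?(ltW T0)// powRN.
clearbody r.
have -> : \sum_(j < k.+1) crp a k j * (8 * Num.sqrt 2 ^+ n) * kap j y * s j `^ (- th) =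
    8 * Num.sqrt 2 ^+ n * vnorm2 y `^ r * \sum_(j < k.+1) crp a k j * s j `^ (- (th + r)).
  rewrite mulr_sumr; apply: eq_bigr => j _.
  have -> : s j `^ (- (th + r)) = s j `^ (- th) * s j `^ (- r).
    by rewrite opprD powRD//; apply/implyP => _; rewrite gt_eqF// crps_gt0.
  rewrite kapE.
  by move: (_ `^ r) (_ `^ (- r)) (_ `^ (- th)) => *; ring.
apply: (@le_trans _ _ (8 * Num.sqrt 2 ^+ n * vnorm2 y `^ r * ((1 - (th + r))^-1 * T `^ (- (th + r))))).
  apply: ler_wpM2l; first by rewrite !mulr_ge0 ?powR_ge0 ?exprn_ge0 ?sqrtr_ge0.
  by apply: crps_negmoment; rewrite addr_ge0//= (le_lt_trans _ thd)// lerD2l.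
rewrite wE.
have -> : T `^ (- (th + r)) = T `^ (- th) * T `^ (- r).
  by rewrite opprD powRD//; apply/implyP => _; rewrite gt_eqF.
have h : (1 - (th + r))^-1 <= (1 - th - d)^-1.
  by rewrite -addrA -opprD lef_pV2 ?posrE ?subr_gt0 ?(le_lt_trans _ thd) ?lerB ?lerD2l.
rewrite /incr_const; move: (_^-1) (_^-1) h => z1 z2 z12.
have : 0 <= 8 * Num.sqrt 2 ^+ n * vnorm2 y `^ r * T `^ (- th) * T `^ (- r).
  by rewrite !mulr_ge0 ?powR_ge0 ?exprn_ge0 ?sqrtr_ge0.
move: (Num.sqrt _ ^+ n) (_ `^ r) (_ `^ (- th)) (_ `^ (- r)) => b1 b2 b3 b4 hb.
have := ler_wpM2l hb z12; lra.
Qed.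

Definition crp_incr (x y : n.-tuple R) : R :=
  \sum_(j < k.+1) crp a k j * (gkN (s j) (vsub x y) - gkN (s j) x).

Let incr_le x y : `|u0 y * crp_incr x y| <= \sum_j q j y * phi j (x, y).
Proof.
rewrite normrM (ger0_norm (u0_ge0 y)) /crp_incr.
apply: (@le_trans _ _ (u0 y * \sum_(j < k.+1) crp a k j * (2 * Num.sqrt 2 ^+ n * kap j y *
    (gkN (2 * s j) x + gkN (2 * s j) (vsub x y))))).
  apply: ler_wpM2l => //; apply: (le_trans (ler_norm_sum _ _ _)); apply: ler_sum => j _.
  rewrite normrM (ger0_norm (crp0 j)); apply: ler_wpM2l => //.
  rewrite /kap; case: ifP => _; first by apply: gkN_diff; [exact: crps_gt0|rewrite d0 d1].
  (* Where |y|^2 > T the increment bound is used with Hoelder exponent 0. *)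
  have := @gkN_diff R n (s j) 0 x y (crps_gt0 j); rewrite oppr0 !powRr0 mulr1; apply.
  by rewrite lexx/= invr_ge0.
rewrite mulr_sumr; apply: ler_sum => j _; rewrite /q /phi /=.
have : s j `^ (- th) != 0 by rewrite gt_eqF// powR_gt0// crps_gt0.
move: (_ `^ (- th)) (_ + _) (kap j y) (Num.sqrt _ ^+ n) (u0 y) => b1 b2 b3 b4 b5 b10.
by rewrite le_eqVlt; apply/orP; left; apply/eqP; field.
Qed.

Let phi_bound (j : 'I_k.+1) z :
  0 <= phi j z <= (4 * s j `^ (- th))^-1 * (2 * (2 * s j) `^ (- (n%:R / 2))).
Proof.
rewrite phi_ge0/=; apply: ler_wpM2l; first by rewrite invr_ge0 mulr_ge0 ?powR_ge0.
have s2 : 0 < 2 * s j by rewrite mulr_gt0// crps_gt0.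
by have := gkN_le_powR z.1 s2; have := gkN_le_powR (vsub z.1 z.2) s2; lra.
Qed.

Let kap_le (j : nat) y : kap j y <= (T * (s j)^-1) `^ d + 1.
Proof.
rewrite /kap; case: ifP => yT; last by rewrite lerDr powR_ge0.
rewrite ler_wpDr// powRM ?invr_ge0 ?(ltW T0) ?(ltW (crps_gt0 _))//.
rewrite powRV ?(ltW (crps_gt0 _))// powRN ler_wpM2r ?invr_ge0 ?powR_ge0//.
by rewrite ge0_ler_powR ?nnegrE ?vnorm2_ge0// ltW.
Qed.

Let qphi_integrable x :
  (mu n).-integrable setT (fun y => (\sum_j q j y * phi j (x, y))%:E).
Proof.
under eq_fun do rewrite -sumEFin.
apply: integrable_sum => // j _.
pose B := ((4 * s j `^ (- th))^-1 * (2 * (2 * s j) `^ (- (n%:R / 2)))) *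
  (crp a k j * (8 * Num.sqrt 2 ^+ n) * ((T * (s j)^-1) `^ d + 1) * s j `^ (- th)).
rewrite (_ : (fun y => _) = EFin \o (fun y =>
   (phi j (x, y) * (crp a k j * (8 * Num.sqrt 2 ^+ n) * kap j y * s j `^ (- th))) * u0 y)); last first.
  by apply/funext => y /=; congr EFin; rewrite /q; ring.
apply: (@integrable_bounded _ _ _ u0 B) => //.
  apply: measurable_funM.
    exact: (measurableT_comp (mphi j) (pair1_measurable x)).
  by apply: measurable_funM => //; apply: measurable_funM => //; exact: mkap.
move=> y; have /andP[p1 p2] := phi_bound j (x, y).
have w0 : 0 <= crp a k j * (8 * Num.sqrt 2 ^+ n) * kap j y * s j `^ (- th).
  by rewrite !mulr_ge0 ?powR_ge0 ?exprn_ge0 ?sqrtr_ge0.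
rewrite ger0_norm; last exact: mulr_ge0.
rewrite /B; apply: ler_pM => //.
apply: ler_wpM2r; first exact: powR_ge0.
apply: ler_wpM2l; first by rewrite !mulr_ge0 ?exprn_ge0 ?sqrtr_ge0.
exact: kap_le.
Qed.

Let c x := (\int[mu n]_(y in setT) (\sum_j q j y * phi j (x, y)))%R.

Let cE x : (c x)%:E = (\int[mu n]_y (\sum_j q j y * phi j (x, y))%:E)%E.
Proof. by rewrite /c /Rintegral fineK//; exact: integrable_fin_num. Qed.

Lemma measurable_crp_incr :
  measurable_fun setT (fun z : n.-tuple R * n.-tuple R => crp_incr z.1 z.2).
Proof.
apply: measurable_sum => j; apply: measurable_funM => //; apply: measurable_funB.
  by apply: (measurableT_comp (measurable_gkN _)); exact: measurable_vsub.
by apply: (measurableT_comp (measurable_gkN _)); exact: measurable_fst.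
Qed.

Let incr_integrable x : (mu n).-integrable setT (fun y => (u0 y * crp_incr x y)%:E).
Proof.
apply: (le_integrable measurableT _ _ (qphi_integrable x)).
  apply/measurable_EFinP; apply: measurable_funM => //.
  exact: (measurableT_comp measurable_crp_incr (pair1_measurable x)).
move=> y _; rewrite lee_fin; apply: (le_trans (incr_le x y)); exact: ler_norm.
Qed.

Definition conv_incr (x : n.-tuple R) : R := (\int[mu n]_(y in setT) (u0 y * crp_incr x y))%R.

Let conv_incr_le x : `|conv_incr x| <= c x.
Proof.
rewrite -lee_fin cE (EFin_normr_Rintegral measurableT (incr_integrable x)).
apply: (le_trans (le_abse_integral _ _ _)) => //; first exact: measurable_int (incr_integrable x).
apply: ge0_le_integral => //.
- by apply: measurableT_comp => //; exact: measurable_int (incr_integrable x).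
- exact: measurable_int (qphi_integrable x).
by move=> y _; rewrite lee_fin incr_le.
Qed.

Variable b : R.
Hypothesis b0 : 0 < b.
Hypothesis ub : (\int[mu n]_y (incr_const * T `^ (- th) * (u0 y * incr_weight y))%:E <= b%:E)%E.

Let int_q : (\int[mu n]_y (\sum_j q j y)%:E <= b%:E)%E.
Proof.
apply: le_trans ub; apply: ge0_le_integral => //.
- by move=> y _; rewrite lee_fin sumr_ge0.
- by apply/measurable_EFinP; exact: measurable_sum.
- apply/measurable_EFinP; apply: measurable_funM => //; apply: measurable_funM => //.
  exact: measurable_incr_weight.
by move=> y _; rewrite lee_fin sum_q.
Qed.

Lemma measurable_conv_incr : measurable_fun setT conv_incr.
Proof.
apply: measurableT_comp => //.
apply: (@measurable_integral_snd _ _ _ _ _ (mu n) (fun z => (u0 z.2 * crp_incr z.1 z.2)%:E)).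
apply/measurable_EFinP; apply: measurable_funM; last exact: measurable_crp_incr.
by apply: (measurableT_comp mu0); exact: measurable_snd.
Qed.

Lemma conv_incr_Lp (p : R) : 1 <= p -> th = n%:R / 2 * (1 - p^-1) ->
  (\int[mu n]_x (`|conv_incr x| `^ p)%:E <= (b `^ p)%:E)%E.
Proof.
move=> p1 thE; have p0 : 0 < p by lra.
have mc : measurable_fun setT c.
  apply: measurableT_comp => //.
  apply: (@measurable_integral_snd _ _ _ _ _ (mu n) (fun z => (\sum_j q j z.2 * phi j z)%:E)).
  apply/measurable_EFinP; apply: measurable_sum => j; apply: measurable_funM => //.
  by apply: (measurableT_comp (mq j)); exact: measurable_snd.
apply: (@le_trans _ _ (\int[mu n]_x (c x `^ p)%:E)%E).
  apply: ge0_le_integral => //.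
  - apply/measurable_EFinP; apply: (measurableT_comp (@measurable_powR R p)).
    by apply: measurableT_comp => //; exact: measurable_conv_incr.
  - by apply/measurable_EFinP; exact: (measurableT_comp (@measurable_powR R p) mc).
  move=> x _; rewrite lee_fin ge0_ler_powR ?nnegrE ?(ltW p0)//.
  exact: le_trans (conv_incr_le x).
apply: (integral_minkowski p1 b0 mq q_ge0 mphi phi_ge0 cE int_q) => j y.
pose B := s j `^ (- th); have B0 : 0 < B by rewrite powR_gt0 ?crps_gt0.
have s2 : 0 < 2 * s j by rewrite mulr_gt0// crps_gt0.
have sB : (2 * s j) `^ (- th) <= B.
  rewrite /B !powRN lef_pV2 ?posrE ?powR_gt0 ?crps_gt0//.
  rewrite ge0_ler_powR ?nnegrE ?(ltW s2) ?(ltW (crps_gt0 _))//.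
  by have := crps_gt0 j; lra.
pose g (x : n.-tuple R) := gkN (2 * s j) x `^ p.
have mg : measurable_fun setT (fun x => (g x)%:E).
  apply/measurable_EFinP; apply: (measurableT_comp (@measurable_powR R p)); exact: measurable_gkN.
have mgy : measurable_fun setT (fun x => (g (vsub x y))%:E).
  exact: (measurableT_comp mg (measurable_vsub1 y)).
have ig : (\int[mu n]_x (g x)%:E <= (B `^ p)%:E)%E.
  apply: (le_trans (integral_gkN_powR n s2 p1)); rewrite lee_fin -thE.
  by rewrite ge0_ler_powR ?nnegrE ?powR_ge0 ?(ltW p0)// ltW.
have igy : (\int[mu n]_x (g (vsub x y))%:E <= (B `^ p)%:E)%E.
  have g0 (x : n.-tuple R) : (0 <= (g x)%:E)%E by rewrite lee_fin powR_ge0.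
  have h : (\int[mu n]_x (g (vsub x y))%:E = \int[mu n]_x (g x)%:E)%E := ge0_integral_vsub y mg g0.
  by rewrite h.
have mgg : measurable_fun setT (fun x => (g x)%:E + (g (vsub x y))%:E)%E := emeasurable_funD mg mgy.
have c0 : 0 <= ((4 * B)^-1) `^ p * 2 `^ p by rewrite mulr_ge0 ?powR_ge0.
apply: (@le_trans _ _ (\int[mu n]_x ((((4 * B)^-1) `^ p * 2 `^ p)%:E * ((g x)%:E + (g (vsub x y))%:E)))%E).
  apply: ge0_le_integral => //.
  - by move=> x _; rewrite lee_fin powR_ge0.
  - apply/measurable_EFinP; apply: (measurableT_comp (@measurable_powR R p)).
    exact: (measurableT_comp (mphi j) (pair2_measurable y)).
  - by apply: emeasurable_funM; [exact: measurable_cst|exact: mgg].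
  move=> x _; rewrite -EFinD -EFinM lee_fin.
  have -> : phi j (x, y) = (4 * B)^-1 * (gkN (2 * s j) x + gkN (2 * s j) (vsub x y)) by [].
  have B4 : 0 <= (4 * B)^-1 by rewrite invr_ge0 mulr_ge0// ltW.
  rewrite (powRM p B4 (addr_ge0 (gkN_ge0 _ _) (gkN_ge0 _ _))) -mulrA.
  apply: ler_wpM2l; first exact: powR_ge0.
  exact: (powR_add_le p1 (gkN_ge0 _ _) (gkN_ge0 _ _)).
have g0 (x : n.-tuple R) : (0 <= (g x)%:E)%E by rewrite lee_fin powR_ge0.
have gg0 (x : n.-tuple R) : setT x -> (0 <= (g x)%:E + (g (vsub x y))%:E)%E by rewrite adde_ge0.
rewrite (ge0_integralZl _ measurableT mgg gg0)//.
rewrite (ge0_integralD _ measurableT (fun x _ => g0 x) mg (fun x _ => g0 (vsub x y)) mgy).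
apply: (@le_trans _ _ ((((4 * B)^-1) `^ p * 2 `^ p)%:E * ((B `^ p)%:E + (B `^ p)%:E))%E).
  by apply: lee_wpmul2l; [rewrite lee_fin|exact: (leeD ig igy)].
rewrite -EFinD -EFinM lee_fin.
have h2 : 2 <= 2 `^ p :> R by rewrite -[leLHS](@powRr1 R 2)// ler_powR// ler1n.
(* The 4 splits as 2 times 2: one factor is the cost of [powR_add_le], the other bounds the two
   equal terms through 2 <= 2^p. *)
have e4 : ((4 * B)^-1) `^ p * 2 `^ p * (2 `^ p * B `^ p) = 1.
  rewrite -mulrA -!powRM ?mulr_ge0 ?invr_ge0 ?mulr_ge0 ?(ltW B0)//.
  by rewrite (_ : (4 * B)^-1 * (2 * (2 * B)) = 1) ?powR1//; field; rewrite gt_eqF.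
rewrite -[leRHS]e4; apply: ler_wpM2l; first exact: c0.
rewrite -[leLHS]mulr2n -[leLHS]mulr_natl; apply: ler_wpM2r => //; exact: powR_ge0.
Qed.

(** For infinite p each profile [phi j] is at most 1 pointwise, so only the integral of the sum of
    the [q j] is left. *)
Lemma conv_incr_sup x : th = n%:R / 2 -> `|conv_incr x| <= b.
Proof.
move=> thE; apply: (le_trans (conv_incr_le x)); rewrite -lee_fin cE.
apply: le_trans int_q; apply: ge0_le_integral => //.
- by move=> y _; rewrite lee_fin sumr_ge0// => j _; rewrite mulr_ge0.
- exact: measurable_int (qphi_integrable x).
- by apply/measurable_EFinP; exact: measurable_sum.
move=> y _; rewrite lee_fin; apply: ler_sum => j _.
rewrite -[leRHS]mulr1; apply: ler_wpM2l => //.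
have B0 : 0 < s j `^ (- th) by rewrite powR_gt0 ?crps_gt0.
have s2 : 0 < 2 * s j by rewrite mulr_gt0// crps_gt0.
have sB : (2 * s j) `^ (- (n%:R / 2)) <= s j `^ (- th).
  rewrite -thE !powRN lef_pV2 ?posrE ?powR_gt0 ?crps_gt0//.
  rewrite ge0_ler_powR ?nnegrE ?(ltW s2) ?(ltW (crps_gt0 _))//.
  by have := crps_gt0 j; lra.
have /andP[_ h] := phi_bound j (x, y); apply: (le_trans h).
rewrite ler_pdivrMl ?mulr_gt0//; lra.
Qed.

End CrpIncrement.

(** * The difference u - M Z as an average of increments of Z *)

Section ConvolutionIncrement.
Variable R : realType.
Local Notation mu n := (lebn R n).
Variables (n : nat) (u0 Z : n.-tuple R -> R).
Hypothesis u0i : (mu n).-integrable setT (EFin \o u0).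
Hypothesis Zi : (mu n).-integrable setT (EFin \o Z).

Let mu0 : measurable_fun setT u0.
Proof. by apply/measurable_EFinP; exact: measurable_int u0i. Qed.

Let mZ : measurable_fun setT Z.
Proof. by apply/measurable_EFinP; exact: measurable_int Zi. Qed.

Let W (p : n.-tuple R * n.-tuple R) : R := u0 p.2 * (Z (vsub p.1 p.2) - Z p.1).

Let mW : measurable_fun setT W.
Proof.
apply: measurable_funM; first by apply: (measurableT_comp mu0); exact: measurable_snd.
apply: measurable_funB; last by apply: (measurableT_comp mZ); exact: measurable_fst.
by apply: (measurableT_comp mZ); exact: measurable_vsub.
Qed.

Let mEW : measurable_fun setT (EFin \o W).
Proof. exact/measurable_EFinP. Qed.

Let Wi : (mu n \x mu n)%E.-integrable setT (EFin \o W).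
Proof.
apply/(integrable21ltyP _ _ mEW).
have mau : measurable_fun setT (fun y => `|u0 y|%:E).
  by apply/measurable_EFinP; exact: measurableT_comp.
have A0 : (0 <= \int[mu n]_z `|Z z|%:E)%E by exact: integral_ge0.
have Aoo : (\int[mu n]_z `|Z z|%:E < +oo)%E by case/integrableP : Zi.
apply: (@le_lt_trans _ _ (\int[mu n]_y (`|u0 y|%:E * (2%:E * \int[mu n]_z `|Z z|%:E)))%E).
  apply: ge0_le_integral => //.
  - by move=> y _; exact: integral_ge0.
  - apply: (@measurable_fun_fubini_tonelli_G _ _ _ _ _ (mu n) (fun p => `|(EFin \o W) p|)%E) => //.
    exact: measurableT_comp.
  - by apply: emeasurable_funM => //; exact: measurable_cst.
  move=> y _; apply: (@le_trans _ _ (`|u0 y|%:E * toscN Z y)%E); last first.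
    by apply: lee_wpmul2l => //; exact: toscN_ub.
  rewrite /toscN -ge0_integralZl//.
    rewrite le_eqVlt; apply/orP; left; apply/eqP; apply: eq_integral => x _.
    by rewrite /= /W /= normrM EFinM.
  apply/measurable_EFinP; apply: measurableT_comp => //; apply: measurable_funB => //.
  by apply: (measurableT_comp mZ); exact: measurable_vsub1.
rewrite ge0_integralZr//; last by rewrite mule_ge0.
rewrite lte_mul_pinfty ?integral_ge0//.
  by rewrite ge0_fin_numE ?integral_ge0//; case/integrableP : u0i.
by rewrite lte_mul_pinfty// ?lee_fin.
Qed.

(** This is u - M Z, almost everywhere by [conv_diffE], in a form where mollification and the
    increment bounds act under the integral. *)
Definition conv_diff (z : n.-tuple R) : R :=
  (\int[mu n]_(y in setT) (u0 y * (Z (vsub z y) - Z z)))%R.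
Local Notation w := conv_diff.

Lemma measurable_conv_diff : measurable_fun setT w.
Proof.
apply: measurableT_comp => //; exact: (@measurable_integral_snd _ _ _ _ _ (mu n) _ mEW).
Qed.

Lemma integrable_conv_diff : (mu n).-integrable setT (EFin \o w).
Proof.
have h := integrable_fubini_F Wi.
apply: (le_integrable measurableT _ _ h); first by apply/measurable_EFinP; exact: measurable_conv_diff.
move=> z _; rewrite /= /w /Rintegral.
rewrite (_ : fubini_F _ _ z = (\int[mu n]_y (u0 y * (Z (vsub z y) - Z z))%:E)%E)//.
by case: (\int[mu n]_y _)%E => [r| |]//=; rewrite ?normr0 ?leey.
Qed.

Let wE : {ae mu n, forall z, (w z)%:E = (\int[mu n]_y (W (z, y))%:E)%E}.
Proof.
have := ae_integrable1 Wi; apply: filterS => z zi.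
by rewrite /w /Rintegral fineK//; exact: integrable_fin_num zi.
Qed.

(** Splitting the integral of the increment needs an integrable slice, which Fubini provides for
    almost every z only. *)
Lemma conv_diffE : {ae mu n, forall z, w z =
  fine (\int[mu n]_y (Z (vsub z y) * u0 y)%:E)%E - fine (\int[mu n]_y (u0 y)%:E)%E * Z z}.
Proof.
have := ae_integrable1 Wi; apply: filterS => z zi.
have i2 : (mu n).-integrable setT (fun y => (u0 y * Z z)%:E).
  under eq_fun do rewrite EFinM; exact: integrableZr.
have i1 : (mu n).-integrable setT (fun y => (Z (vsub z y) * u0 y)%:E).
  rewrite (_ : (fun y => _) = (fun y => (W (z, y))%:E + (u0 y * Z z)%:E)%E); first exact: integrableD.
  by apply/funext => y; rewrite -EFinD /W /=; congr EFin; ring.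
rewrite -[fine (\int[mu n]_y (u0 y)%:E)%E * _](@RintegralZr _ _ _ (mu n) setT u0 (Z z))//.
rewrite -[fine _]/(\int[mu n]_(y in setT) (Z (vsub z y) * u0 y))%R -RintegralB//.
by apply: eq_Rintegral => y _; ring.
Qed.

Lemma moll_vsub e (y x : n.-tuple R) : moll e (fun z => Z (vsub z y)) x = moll e Z (vsub x y).
Proof.
have mZy : measurable_fun setT (fun z => Z (vsub z y)).
  exact: (measurableT_comp mZ (measurable_vsub1 y)).
rewrite !mollE//; apply: eq_Rintegral => z _; congr (_ * Z _).
by apply: eq_from_tnth => i; rewrite !tnth_mktuple; ring.
Qed.

(** Fubini moves the mollification under the integral in y, and [moll_vsub] moves it past the
    translation. *)
Lemma moll_conv_diff e x : 0 < e ->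
  moll e w x = (\int[mu n]_(y in setT) (u0 y * (moll e Z (vsub x y) - moll e Z x)))%R.
Proof.
move=> e0; pose B := Num.sqrt (4 * pi * e) ^- n : R.
have gB z : `|gkN e (vsub x z)| <= B by rewrite ger0_norm ?gkN_ge0// gkN_le.
have mg : measurable_fun setT (fun z => gkN e (vsub x z)).
  by apply: (measurableT_comp (measurable_gkN _)); exact: measurable_vsub2.
pose f (p : n.-tuple R * n.-tuple R) := (gkN e (vsub x p.1) * W p)%:E.
have mf : measurable_fun setT f.
  apply/measurable_EFinP; apply: measurable_funM => //.
  by apply: (measurableT_comp mg); exact: measurable_fst.
have fi : (mu n \x mu n)%E.-integrable setT f.
  apply: (le_integrable measurableT mf _ (integrableZl measurableT B Wi)).
  move=> p _; rewrite /f /= lee_fin !normrM ler_wpM2r//.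
  by rewrite (le_trans (gB _))// ler_norm.
have fub := Fubini fi.
have gi (h : n.-tuple R -> R) : (mu n).-integrable setT (EFin \o h) ->
    (mu n).-integrable setT (fun z => (gkN e (vsub x z) * h z)%:E).
  by move=> hi; exact: (integrable_bounded mg gB hi).
have lhs : (\int[mu n]_z \int[mu n]_y f (z, y) = \int[mu n]_z (gkN e (vsub x z) * w z)%:E)%E.
  have mgw : measurable_fun setT (fun z => (gkN e (vsub x z) * w z)%:E).
    by apply/measurable_EFinP; exact: measurable_funM mg measurable_conv_diff.
  have mff : measurable_fun setT (fun z => \int[mu n]_y f (z, y))%E.
    exact: (@measurable_integral_snd _ _ _ _ _ (mu n) f mf).
  apply: (ae_eq_integral _ _ measurableT mff mgw).
  apply: filterS2 wE (ae_integrable1 Wi) => z zE zi _.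
  rewrite EFinM zE /f /=; under eq_integral do rewrite EFinM.
  by rewrite integralZl.
have rhs y : (\int[mu n]_z f (z, y) = (u0 y * (moll e Z (vsub x y) - moll e Z x))%:E)%E.
  have Zyi := integrable_vsub y Zi.
  have i1 := gi _ Zyi; have i2 := gi _ Zi.
  transitivity (\int[mu n]_z ((u0 y)%:E * ((gkN e (vsub x z) * Z (vsub z y))%:E - (gkN e (vsub x z) * Z z)%:E)))%E.
    by apply: eq_integral => z _; rewrite /f /W /= -EFinB -EFinM; congr EFin; ring.
  rewrite (integralZl measurableT (integrableB measurableT i1 i2)) (integralB measurableT i1 i2).
  rewrite EFinM EFinB -moll_vsub; congr (_ * (_ - _))%E.
    by rewrite /moll /Rintegral (fineK (integrable_fin_num measurableT i1)).
  by rewrite /moll /Rintegral (fineK (integrable_fin_num measurableT i2)).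
rewrite {1}/moll /Rintegral -lhs fub; congr fine.
by apply: eq_integral => y _; exact: rhs.
Qed.

(** Dominated convergence in y: all times of the mixture are at least e, so both kernel values lie
    between 0 and e^(-n/2), and so does the size of their difference. *)
Lemma conv_incr_cvg (a e T : R) (x : n.-tuple R) : 0 < a < 1 -> 0 < e -> 0 <= T ->
  (forall w, \int[mu n]_z (Z z * cos (vdot w z))%:E = (mittag_leffler a (- (vnorm2 w * T)))%:E)%E ->
  (forall w, \int[mu n]_z (Z z * sin (vdot w z))%:E = 0)%E ->
  conv_incr k a e T u0 x @[k --> \oo] --> moll e w x.
Proof.
move=> a01 e0 T0 Zc Zs; have /andP[a0 a1] := a01.
rewrite (moll_conv_diff _ e0).
pose B := e `^ (- (n%:R / 2)).
have sg k j : 0 < crps k a e T j by rewrite ltr_wpDr// mulr_ge0// divr_ge0 ?powR_ge0.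
have gB k j (z : n.-tuple R) : gkN (crps k a e T j) z <= B.
  apply: (le_trans (gkN_le_powR z (sg k j))).
  rewrite /B !powRN lef_pV2 ?posrE ?powR_gt0 ?sg//.
  rewrite ge0_ler_powR ?nnegrE ?(ltW e0) ?(ltW (sg k j)) ?divr_ge0//.
  by rewrite /crps lerDl mulr_ge0// divr_ge0 ?powR_ge0.
have incB k y : `|crp_incr k a e T x y| <= B.
  apply: (le_trans (ler_norm_sum _ _ _)).
  apply: (@le_trans _ _ (\sum_(j < k.+1) crp a k j * B)).
    apply: ler_sum => j _; rewrite normrM (ger0_norm (crp_ge0 k j _)) ?(ltW a0) ?(ltW a1)//.
    apply: ler_wpM2l; first by rewrite crp_ge0// !ltW.
    have := gB k j (vsub x y); have := gB k j x.
    have := gkN_ge0 (crps k a e T j) (vsub x y); have := gkN_ge0 (crps k a e T j) x.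
    by rewrite ler_norml => h1 h2 h3 h4; apply/andP; split; lra.
  by rewrite -mulr_suml crp_sum mul1r.
have incc y : crp_incr k a e T x y @[k --> \oo] --> moll e Z (vsub x y) - moll e Z x.
  have c1 := moll_crp (x := vsub x y) a01 e0 T0 Zi Zc Zs.
  have c2 := moll_crp (x := x) a01 e0 T0 Zi Zc Zs.
  rewrite /crp_incr; under eq_fun do (under eq_bigr do rewrite mulrBr; rewrite sumrB).
  exact: cvgB c1 c2.
have mi k : measurable_fun setT (fun y => u0 y * crp_incr k a e T x y).
  apply: measurable_funM => //.
  exact: (measurableT_comp (measurable_crp_incr k a e T) (pair1_measurable x)).
have dc : ((\int[mu n]_y (u0 y * crp_incr k a e T x y)%:E)%E @[k --> \oo] -->
    (\int[mu n]_y (u0 y * (moll e Z (vsub x y) - moll e Z x))%:E)%E).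
  apply: (@dominated_cvg _ _ _ (mu n) setT measurableT _ _ (fun y => B%:E * `|u0 y|%:E)%E).
  - by move=> k; exact/measurable_EFinP.
  - move=> y _; apply: cvg_EFin; first exact: nearW.
    by apply: cvgMr; exact: incc.
  - by [].
  - by apply: integrableZl => //; exact: integrable_norm u0i.
  - by move=> k y _; rewrite -EFinM lee_fin normrM mulrC ler_wpM2r.
have li : (mu n).-integrable setT (fun y => (u0 y * (moll e Z (vsub x y) - moll e Z x))%:E).
  have mm : measurable_fun setT (fun y => moll e Z (vsub x y) - moll e Z x).
    apply: measurable_funB => //.
    by apply: (measurableT_comp (measurable_moll e mZ)); exact: measurable_vsub2.
  have lB y : `|moll e Z (vsub x y) - moll e Z x| <= B.
    have nc : `|crp_incr k a e T x y| @[k --> \oo] --> `|moll e Z (vsub x y) - moll e Z x|.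
      exact: cvg_norm (incc y).
    have il : lim (`|crp_incr k a e T x y| @[k --> \oo]) = `|moll e Z (vsub x y) - moll e Z x|.
      exact/cvg_lim.
    rewrite -il; apply: limr_le; last exact: nearW.
    by apply/cvg_ex; eexists; exact: nc.
  under eq_fun do rewrite mulrC; exact: (integrable_bounded mm lB u0i).
apply: fine_cvg; rewrite fineK//; exact: integrable_fin_num.
Qed.

End ConvolutionIncrement.

(** * Passage to the limit from the mixtures to the difference *)

Section LpBound.
Variable R : realType.
Local Notation mu n := (lebn R n).

(** The scales are chosen so that the L^1 errors are at most 2^(-(k + 1)), hence summable. *)
Lemma moll_ae_cvg n (w : n.-tuple R -> R) : (mu n).-integrable setT (EFin \o w) ->
  exists2 e_ : nat -> R, (forall k, 0 < e_ k) &
    {ae mu n, forall x, moll (e_ k) w x @[k --> \oo] --> w x}.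
Proof.
move=> wi; have mw : measurable_fun setT w by apply/measurable_EFinP; exact: measurable_int wi.
have h k : exists e : R, 0 < e /\
    (\int[mu n]_x (`|moll e w x - w x|)%:E <= (1 / (2 ^ (k + 1))%:R)%:E)%E.
  have [|e e0 he] := @moll_dist_small R n w (1 / (2 ^ (k + 1))%:R) wi; last by exists e.
  by rewrite divr_gt0// ltr0n expn_gt0.
have [e_ he] := choice h; exists e_; first by move=> k; exact: (he k).1.
apply: (@ae_cvg_L1 _ _ _ (mu n) (fun k => moll (e_ k) w)) => // k.
  exact: measurable_moll.
exact: (he k).2.
Qed.

Variables (n : nat) (u0 Z : n.-tuple R -> R).
Hypothesis u0i : (mu n).-integrable setT (EFin \o u0).
Hypothesis u0_ge0 : forall y, 0 <= u0 y.
Hypothesis Zi : (mu n).-integrable setT (EFin \o Z).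
Variables (a T d th b : R).
Hypothesis a01 : 0 < a < 1.
Hypothesis T0 : 0 < T.
Hypothesis Zc : forall w,
  (\int[mu n]_z (Z z * cos (vdot w z))%:E = (mittag_leffler a (- (vnorm2 w * T)))%:E)%E.
Hypothesis Zs : forall w, (\int[mu n]_z (Z z * sin (vdot w z))%:E = 0)%E.
Hypothesis d0 : 0 <= d.
Hypothesis d1 : d <= 2^-1.
Hypothesis th0 : 0 <= th.
Hypothesis thd : th + d < 1.
Hypothesis b0 : 0 < b.
Hypothesis ub : (\int[mu n]_y (incr_const n d th * T `^ (- th) * (u0 y * incr_weight T d y))%:E <= b%:E)%E.

Let wi := integrable_conv_diff u0i Zi.
Let mw := measurable_conv_diff u0i Zi.

Lemma conv_diff_Lp (p : R) : 1 <= p -> th = n%:R / 2 * (1 - p^-1) ->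
  (\int[mu n]_x (`|conv_diff u0 Z x| `^ p)%:E <= (b `^ p)%:E)%E.
Proof.
move=> p1 thE; have p0 : 0 < p by lra.
have [e_ e0 he] := moll_ae_cvg wi.
apply: (le_integral_powR_cvg p0 _ mw he) => k; first exact: measurable_moll.
apply: (@le_integral_powR_cvg _ _ _ (mu n) (fun j => conv_incr j a (e_ k) T u0)) => //.
- by move=> j; exact: measurable_conv_incr.
- exact: measurable_moll.
- by apply: aeW => x; apply: conv_incr_cvg => //; exact: ltW.
by move=> j; apply: (conv_incr_Lp j a01 (e0 k) T0 d0 d1 th0 thd u0i u0_ge0 b0 ub).
Qed.

(** Here the bounds are pointwise and pass to both limits directly, in place of Fatou's lemma. *)
Lemma conv_diff_sup : th = n%:R / 2 -> {ae mu n, forall x, `|conv_diff u0 Z x| <= b}.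
Proof.
move=> thE; have [e_ e0 he] := moll_ae_cvg wi.
have le_cvg (u : nat -> R) l : u k @[k --> \oo] --> l -> (forall k, `|u k| <= b) -> `|l| <= b.
  move=> ul uB.
  have nl : `|u k| @[k --> \oo] --> `|l| by exact: cvg_norm.
  have il : lim (`|u k| @[k --> \oo]) = `|l| by exact/cvg_lim.
  by rewrite -il; apply: limr_le; [apply/cvg_ex; eexists; exact: nl|exact: nearW].
apply: filterS he => x hx; apply: (le_cvg _ _ hx) => k.
apply: (le_cvg (fun j => conv_incr j a (e_ k) T u0 x)) => [|j].
  by apply: conv_incr_cvg => //; exact: ltW.
exact: (conv_incr_sup j a01 (e0 k) T0 d0 d1 th0 thd u0i u0_ge0 ub).
Qed.

End LpBound.

(** * Decay of the weighted mass of the initial datum *)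

Section IncrWeight.
Variable R : realType.
Local Notation mu n := (lebn R n).

(** Dominated convergence along the integers, then monotonicity of the weight in T to reach all
    large real T. *)
Lemma integral_incr_weight_cvg n (u0 : n.-tuple R -> R) (d e : R) : 0 < d ->
  (mu n).-integrable setT (EFin \o u0) -> (forall y, 0 <= u0 y) -> 0 < e ->
  exists2 T0 : R, 0 < T0 & forall T, T0 <= T ->
    (\int[mu n]_y (u0 y * incr_weight T d y)%:E <= e%:E)%E.
Proof.
move=> d0 u0i u00 e0.
have mu0 : measurable_fun setT u0 by apply/measurable_EFinP; exact: measurable_int u0i.
have mwt T : measurable_fun setT (fun y => (u0 y * incr_weight T d y)%:E).
  by apply/measurable_EFinP; apply: measurable_funM => //; exact: measurable_incr_weight.
have cv : ((\int[mu n]_y (u0 y * incr_weight k.+1%:R d y)%:E)%E @[k --> \oo] --> 0)%E.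
  rewrite -[X in _ --> X](@integral0 _ _ _ (mu n) setT).
  apply: (@dominated_cvg _ _ _ (mu n) setT measurableT _ _ (fun y => (u0 y)%:E)).
  - by move=> k; exact: mwt.
  - move=> y _; apply: cvg_EFin; first exact: nearW.
    rewrite -[X in _ --> X](mulr0 (u0 y)); apply: cvgMr.
    apply/cvgr0Pnorm_le => r r0.
    have c0 : 0 < r `^ d^-1 by rewrite powR_gt0.
    near=> k; rewrite ger0_norm ?incr_weight_ge0// /incr_weight.
    (* From this k on, both |y|^2 <= k + 1, which selects the power branch, and |y|^2 / (k + 1) <=
       r^(1/d) hold. *)
    have vk : vnorm2 y / r `^ d^-1 + vnorm2 y <= k.+1%:R.
      apply: (@le_trans _ _ k%:R); last by rewrite ler_nat.
      by near: k; exact: nbhs_infty_ger.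
    have v0 := vnorm2_ge0 y; have v1 : 0 <= vnorm2 y / r `^ d^-1 by rewrite divr_ge0// ltW.
    rewrite ifT; last by lra.
    have -> : r = (r `^ d^-1) `^ d by rewrite -powRrM mulVf ?powRr1 ?(ltW r0)// gt_eqF.
    rewrite ge0_ler_powR ?nnegrE ?divr_ge0 ?(ltW d0) ?(ltW c0)//.
    by rewrite ler_pdivrMr// mulrC -ler_pdivrMr//; lra.
  - by [].
  - exact: u0i.
  - move=> k y _; rewrite lee_fin ger0_norm; last by rewrite mulr_ge0 ?incr_weight_ge0.
    by rewrite -[leRHS]mulr1 ler_wpM2l// incr_weight_le1// ltW.
have [|N _ /(_ N (leqnn N))/= HN] := (cvge0P _).1 cv _ e0.
  by move=> k; apply: integral_ge0 => y _; rewrite lee_fin mulr_ge0 ?incr_weight_ge0.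
exists N.+1%:R; first exact: ltr0Sn.
move=> T NT; apply: (le_trans _ HN).
apply: (ge0_le_integral _ measurableT _ (mwt T) (mwt N.+1%:R)) => y _.
  by rewrite lee_fin mulr_ge0 ?incr_weight_ge0.
(* The weight is nonincreasing in T: it is 1 while T < |y|^2, and a negative power of T times a
   constant afterwards. *)
rewrite lee_fin ler_wpM2l// {1}/incr_weight; case: ifP => yT; last first.
  by rewrite /incr_weight; case: ifP => // yN; move: yT; rewrite (le_trans yN NT).
rewrite /incr_weight; case: ifP => yN; last first.
  have := @incr_weight_le1 R n T d; rewrite /incr_weight.
  have T0 : 0 < T by rewrite (lt_le_trans _ NT).
  by move=> h; have := h T0 (ltW d0) y; rewrite yT.
have T0 : 0 < T by rewrite (lt_le_trans _ NT).
rewrite ge0_ler_powR ?nnegrE ?divr_ge0 ?vnorm2_ge0 ?(ltW d0) ?(ltW T0)//.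
by rewrite ler_wpM2l ?vnorm2_ge0// lef_pV2 ?posrE.
Unshelve. all: by end_near. Qed.

End IncrWeight.

(** * The integrals and norms of the statement in terms of the measure on tuples *)

Section Norms.
Variable R : realType.
Local Notation mu n := (lebn R n).

Lemma sint_integral n (f : n.-tuple R -> R) : measurable_fun setT f ->
  sint f = (\int[mu n]_x (f x)%:E)%E.
Proof.
move=> mf.
have m0 : measurable_fun setT (fun _ : n.-tuple R => 0 : R) by exact: measurable_cst.
have mp : measurable_fun setT (fun x => (Num.max (f x) 0)%:E).
  by apply/measurable_EFinP; exact: (measurable_maxr mf m0).
have mn : measurable_fun setT (fun x => (Num.max (- f x) 0)%:E).
  apply/measurable_EFinP; apply: (measurable_maxr _ m0); exact: measurableT_comp.
have max0 (r : R) : (0 <= (Num.max r 0)%:E)%E by rewrite lee_fin le_max lexx orbT.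
rewrite /sint (iintE mp (fun x => max0 _)) (iintE mn (fun x => max0 _)).
rewrite [RHS]integralE; congr (_ - _)%E.
  by apply: eq_integral => x _; rewrite funeposE EFin_max.
by apply: eq_integral => x _; rewrite funenegE EFin_max EFinN.
Qed.

Lemma integrable_RNP n (f : n.-tuple R -> R) :
  integrable_RN f -> (mu n).-integrable setT (EFin \o f).
Proof.
move=> [mf fi]; apply/integrableP; split; first exact/measurable_EFinP.
rewrite iintE// in fi; apply/measurable_EFinP; exact: measurableT_comp.
Qed.

Lemma LpnormN_ge0 n (p : \bar R) (f : n.-tuple R -> R) : (0 <= LpnormN p f)%E.
Proof.
case: p => [r| |]//=; first exact: poweR_ge0.
(* A negative essential bound would force the whole space to be null, whereas the heat kernel at
   time 1 is at most 1 and has mass 1. *)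
apply: le_ereal_inf_tmp => M /= M0; rewrite leNgt; apply/negP => Mlt.
move: M0; rewrite (_ : (fun x => _) = cst 1%E); last first.
  by apply/funext => x; rewrite (lt_le_trans Mlt)// lee_fin.
rewrite iintE//.
move=> h; have : (\int[mu n]_x (gkN 1 x)%:E <= \int[mu n]_x (cst 1%E x))%E.
  apply: ge0_le_integral => //.
  - by move=> x _; rewrite lee_fin gkN_ge0.
  - by apply/measurable_EFinP; exact: measurable_gkN.
  - by move=> x _; rewrite lee_fin; have := gkN_le_powR x (@ltr01 R); rewrite powR1.
by rewrite h integral_gkN// lee_fin ler10.
Qed.

Lemma LpnormN_le n (p b : R) (f : n.-tuple R -> R) : measurable_fun setT f -> 0 < p -> 0 <= b ->
  (\int[mu n]_x (`|f x| `^ p)%:E <= (b `^ p)%:E)%E -> (LpnormN p%:E f <= b%:E)%E.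
Proof.
move=> mf p0 b0 h; rewrite /LpnormN iintE; last 2 first.
- apply/measurable_EFinP.
  have mn : measurable_fun setT (fun x => `|f x|) by exact: measurableT_comp.
  exact: (measurableT_comp (@measurable_powR R p) mn).
- by move=> x; rewrite lee_fin powR_ge0.
have -> : b%:E = poweR (b `^ p)%:E p^-1.
  by rewrite poweR_EFin -powRrM mulfV ?powRr1// gt_eqF.
apply: gt0_ler_poweR => //; rewrite ?invr_ge0 ?(ltW p0)//.
  by rewrite in_itv/= leey andbT integral_ge0// => x _; rewrite lee_fin powR_ge0.
by rewrite in_itv/= leey andbT lee_fin powR_ge0.
Qed.

Lemma esssupN_le n (b : R) (f : n.-tuple R -> R) : measurable_fun setT f ->
  {ae mu n, forall x, `|f x| <= b} -> (LpnormN +oo%E f <= b%:E)%E.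
Proof.
move=> mf fb; apply: ereal_inf_lbound => /=.
have mi : measurable_fun setT (fun x => if (b%:E < `|f x|%:E)%E then 1%E else 0%E : \bar R).
  apply: measurable_fun_ifT => //; under eq_fun do rewrite lte_fin.
  by apply: measurable_fun_ltr => //; exact: measurableT_comp.
rewrite iintE//; last by move=> x; case: ifP.
rewrite -[RHS](@integral0 _ _ _ (mu n) setT).
apply: ge0_ae_eq_integral => //.
- by move=> x _; case: ifP.
- by apply: filterS fb => x fx _; rewrite lte_fin ltNge fx.
Qed.

Lemma cvge0_pinfty (f : R -> \bar R) : (forall t, 0 <= f t)%E ->
  (forall e : R, 0 < e -> exists A : R, forall t, A < t -> (f t <= e%:E)%E) -> f t @[t --> +oo] --> 0%E.
Proof.
move=> f0 H; apply/cvge_pinftyP => v voo; apply/cvge0P => // e e0.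
have [A HA] := H e e0.
have vA : \forall k \near \oo, A < v k.
  exact: (voo [set x | A < x] (nbhs_pinfty_gt (num_real A))).
by apply: filterS vA => k; exact: HA.
Qed.

End Norms.

(** * Decay of the difference in L^p and the conclusion *)

Section Decay.
Variables (R : realType) (N : nat) (a : R) (Z : N.-tuple R -> R -> R) (u0 : N.-tuple R -> R).
Local Notation mu n := (lebn R n).
Hypothesis a01 : 0 < a < 1.
Hypothesis fZ : is_fundamental_solution a Z.
Hypothesis iu0 : integrable_RN u0.
Hypothesis u0_ge0 : forall y, 0 <= u0 y.

Let u0i := integrable_RNP iu0.
Let mu0 := iu0.1.

Let f t x := mild_solution Z u0 x t - fine (sint u0) * Z x t.

Let Zi t : 0 < t -> (mu N).-integrable setT (EFin \o Z^~ t).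
Proof. by move=> t0; apply: integrable_RNP; exact: (fZ t0).1. Qed.

Let mZ t : 0 < t -> measurable_fun setT (Z^~ t).
Proof. by move=> t0; exact: (fZ t0).1.1. Qed.

Let mild_integral t x : 0 < t ->
  mild_solution Z u0 x t = fine (\int[mu N]_y (Z (vsub x y) t * u0 y)%:E)%E.
Proof.
move=> t0; rewrite /mild_solution sint_integral//; apply: measurable_funM => //.
by apply: (measurableT_comp (mZ t0)); exact: measurable_vsub2.
Qed.

Let mf t : 0 < t -> measurable_fun setT (f t).
Proof.
move=> t0; apply: measurable_funB; last by apply: measurable_funM => //; exact: mZ.
rewrite (_ : (fun x => _) = fun x => fine (\int[mu N]_y (Z (vsub x y) t * u0 y)%:E)%E); last first.
  by apply/funext => x; rewrite mild_integral.
apply: measurableT_comp => //.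
apply: (@measurable_integral_snd _ _ _ _ _ (mu N) (fun z => (Z (vsub z.1 z.2) t * u0 z.2)%:E)).
apply/measurable_EFinP; apply: measurable_funM.
  by apply: (measurableT_comp (mZ t0)); exact: measurable_vsub.
by apply: (measurableT_comp mu0); exact: measurable_snd.
Qed.

Let ae_f t : 0 < t -> {ae mu N, forall x, conv_diff u0 (Z^~ t) x = f t x}.
Proof.
move=> t0; have := conv_diffE u0i (Zi t0); apply: filterS => x ->.
by rewrite /f mild_integral// sint_integral.
Qed.

(** The multiplier at time t is E_a(-|w|^2 t^a), so the mixture estimates apply with T = t^a. The
    cases of finite and infinite p use separate bounds, and both ignore the null set where
    [conv_diff] differs from u - M Z. *)
Lemma decay_bound (t d th b : R) (p : \bar R) : 0 < t -> 0 <= d -> d <= 2^-1 ->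
  0 <= th -> th + d < 1 -> (1 <= p)%E -> th = N%:R / 2 * one_minus_inv p -> 0 < b ->
  (\int[mu N]_y (incr_const N d th * (t `^ a) `^ (- th) *
     (u0 y * incr_weight (t `^ a) d y))%:E <= b%:E)%E ->
  (LpnormN p (f t) <= b%:E)%E.
Proof.
move=> t0 d0 d1 th0 thd p1 thE b0 ub.
have T0 : 0 < t `^ a by rewrite powR_gt0.
have [Zit Zf] := fZ t0.
have Zc w : (\int[mu N]_z (Z z t * cos (vdot w z))%:E =
    (mittag_leffler a (- (vnorm2 w * t `^ a)))%:E)%E.
  rewrite -mulNr -(Zf w).1 sint_integral//; apply: measurable_funM; first exact: mZ.
  exact: measurable_cos_vdot.
have Zs w : (\int[mu N]_z (Z z t * sin (vdot w z))%:E = 0)%E.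
  rewrite -(Zf w).2 sint_integral//; apply: measurable_funM; first exact: mZ.
  exact: measurable_sin_vdot.
case: p p1 thE => [p| |]//= p1 thE.
  rewrite lee_fin in p1; have p0 : 0 < p by lra.
  apply: (@LpnormN_le R N p b (f t)) => //; [exact: mf|exact: ltW|].
  apply: le_trans (conv_diff_Lp u0i u0_ge0 (Zi t0) a01 T0 Zc Zs d0 d1 th0 thd b0 ub p1 thE).
  rewrite le_eqVlt; apply/orP; left; apply/eqP; apply: ge0_ae_eq_integral => //.
  - apply/measurable_EFinP; apply: (measurableT_comp (@measurable_powR R p)).
    by apply: measurableT_comp => //; exact: mf.
  - apply/measurable_EFinP; apply: (measurableT_comp (@measurable_powR R p)).
    by apply: measurableT_comp => //; apply: measurable_conv_diff => //; exact: Zi.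
  - by apply: filterS (ae_f t0) => x -> _.
rewrite mulr1 in thE.
apply: (@esssupN_le R N b (f t)); first exact: mf.
have h := conv_diff_sup u0i u0_ge0 (Zi t0) a01 T0 Zc Zs d0 d1 th0 thd ub thE.
by apply: filterS2 (ae_f t0) h => x ->.
Qed.

End Decay.

(** For N = 1 the value is at most 1/2, also at infinite p; for N = 2 it is 1 - 1/p; for N >= 3 the
    condition p < N / (N - 2) is N (1 - 1/p) < 2. *)
Lemma subcritical_exponent (R : realType) (N : nat) (p : \bar R) : (0 < N)%N ->
  subcritical N p -> 0 <= N%:R / 2 * one_minus_inv p < 1.
Proof.
move=> N0 [p1 H]; have N0' : 0 < N%:R :> R by rewrite ltr0n.
case: p p1 H => [p| |]//= p1 H; last first.
  case: H => [->|[_]|[_]] //; rewrite mulr1; lra.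
rewrite lee_fin in p1; have p0 : 0 < p by lra.
have q0 : 0 < p^-1 by rewrite invr_gt0.
have q1 : p^-1 <= 1 by rewrite invf_le1.
apply/andP; split; first by rewrite mulr_ge0 ?subr_ge0// divr_ge0// ltW.
case: H => [->|[-> _]|[N3]]; [lra|lra|].
have N3' : 3 <= N%:R :> R by rewrite ler_nat.
rewrite lte_fin => pN; have N2 : 0 < N%:R - 2 :> R by lra.
have h : (N%:R - 2) / N%:R < p^-1.
  by rewrite -[X in X < _]invf_div ltf_pV2 ?posrE ?divr_gt0.
have : N%:R * ((N%:R - 2) / N%:R) < N%:R * p^-1 by rewrite ltr_pM2l.
rewrite [X in X < _]mulrC divfK ?gt_eqF//; lra.
Qed.

Theorem theorem2p1 (R : realType) (N : nat) (a : R) (Z : N.-tuple R -> R -> R)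
    (u0 : N.-tuple R -> R) (p : \bar R) :
  (0 < N)%N -> 0 < a < 1 ->
  is_fundamental_solution a Z ->
  integrable_RN u0 -> (forall y, 0 <= u0 y) -> ~ ae_zero u0 ->
  subcritical N p ->
  let M := fine (sint u0) in
  (fun t : R => (t `^ (a * N%:R / 2 * one_minus_inv p))%:E *
     LpnormN p (fun x => (mild_solution Z u0 x t - M * Z x t)%R))%E
    @ +oo --> 0%E.
Proof.
move=> N0 a01 fZ iu0 u0_ge0 _ pc M.
have /andP[th0 th1] := subcritical_exponent N0 pc.
have p1 : (1 <= p)%E := pc.1.
set th := N%:R / 2 * one_minus_inv p in th0 th1.
(* Half of the room below 1 is spent, so th + d <= (1 + th) / 2; the cap 1/2 is the range of the
   increment bound. *)
pose d := Num.min 2^-1 ((1 - th) / 2).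
have d0 : 0 < d by rewrite lt_min; apply/andP; split; lra.
have d1 : d <= 2^-1 by rewrite ge_min lexx.
have d2 : d <= (1 - th) / 2 by rewrite ge_min lexx orbT.
have thd : th + d < 1 by lra.
have /andP[a0 _] := a01.
have u0i := integrable_RNP iu0.
have K0 : 0 < incr_const N d th.
  by rewrite mulr_gt0 ?mulr_gt0 ?exprn_gt0 ?sqrtr_gt0 ?invr_gt0//; lra.
apply: cvge0_pinfty => [t|e e0].
  by rewrite mule_ge0 ?lee_fin ?powR_ge0// LpnormN_ge0.
have eK : 0 < e / incr_const N d th by rewrite divr_gt0.
have [T0 T00 HT] := integral_incr_weight_cvg d0 u0i u0_ge0 eK.
(* The weight is controlled at T = t^a, which exceeds [T0] exactly when t exceeds this threshold. *)
exists (T0 `^ a^-1) => t tT.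
have t0 : 0 < t by rewrite (lt_trans _ tT)// powR_gt0.
have T0t : T0 <= t `^ a.
  rewrite -[leLHS]powRr1 ?(ltW T00)// -(mulVf (lt0r_neq0 a0)) powRrM.
  by rewrite ge0_ler_powR ?nnegrE ?powR_ge0// ltW.
have expE : t `^ (a * N%:R / 2 * one_minus_inv p) = t `^ (a * th).
  by congr (_ `^ _); rewrite /th; ring.
have tp : 0 < t `^ (a * th) by rewrite powR_gt0.
(* The factor (t^a)^(-th) of the estimate is the inverse of the prefactor in the theorem, so what
   remains is [incr_const] times the weighted mass, at most e. *)
pose b := (t `^ (a * th))^-1 * e.
have b0 : 0 < b by rewrite mulr_gt0 ?invr_gt0.
have Lb : (LpnormN p (fun x => (mild_solution Z u0 x t - M * Z x t)%R) <= b%:E)%E.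
  apply: (decay_bound a01 fZ iu0 u0_ge0 t0 (ltW d0) d1 th0 thd p1 erefl b0).
  have Tt : (t `^ a) `^ (- th) = (t `^ (a * th))^-1 by rewrite -powRrM mulrN powRN.
  under eq_integral do rewrite EFinM.
  have c0 : 0 <= incr_const N d th * (t `^ a) `^ (- th) by rewrite mulr_ge0 ?powR_ge0// ltW.
  rewrite ge0_integralZl//; last 2 first.
  - apply/measurable_EFinP; apply: measurable_funM; first exact: iu0.1.
    exact: measurable_incr_weight.
  - by move=> y _; rewrite lee_fin mulr_ge0 ?incr_weight_ge0.
  apply: (@le_trans _ _ ((incr_const N d th * (t `^ a) `^ (- th))%:E * (e / incr_const N d th)%:E)%E).
    by apply: lee_wpmul2l; [rewrite lee_fin|exact: HT].
  rewrite -EFinM lee_fin Tt /b le_eqVlt; apply/orP; left; apply/eqP.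
  by move: (incr_const N d th) K0 (_^-1) => c c0' z; field; rewrite gt_eqF.
rewrite expE; apply: (@le_trans _ _ ((t `^ (a * th))%:E * b%:E)%E).
  by apply: lee_wpmul2l => //; rewrite lee_fin ltW.
by rewrite -EFinM lee_fin /b mulVKf// gt_eqF.
Qed.
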